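(* Let $\Bbbk$ be a commutative ring and let $(\mathcal C,\star,\mathbf 1)$ be a strictly monoidal dg category over $\Bbbk$, with derived horizontal trace $\mathrm{Tr}(\mathcal C)$. There is a natural dg functor $\mathrm{Tr}\colon\mathcal C\to\mathrm{Tr}(\mathcal C)$ which is homotopy trace-like: it is equipped with closed degree-zero morphisms $\mathrm{Tr}(X\star Y)\to\mathrm{Tr}(Y\star X)$, for all objects $X,Y$ of $\mathcal C$, that are natural in $Y$ and natural up to coherent homotopy in $X$. Moreover, the endomorphism algebra of $\mathrm{Tr}(\mathbf 1)$ (that is, the cohomology algebra of the dg algebra $\mathrm{End}_{\mathrm{Tr}(\mathcal C)}(\mathrm{Tr}(\mathbf 1))$) is naturally isomorphic to the Hochschild homology algebra $\mathrm{HH}_\bullet(\mathcal C)$.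
   Context: Dg categories are enriched in cochain complexes of $\Bbbk$-modules (differentials of degree $+1$). Write $Y\mathcal C X:=\mathrm{Hom}_{\mathcal C}(X,Y)$, $\mathcal C X:=\bigoplus_Y Y\mathcal CX$, $X\mathcal C:=\bigoplus_Y X\mathcal CY$. A $\mathcal C,\mathcal C$-bimodule is a family of complexes $Y\mathcal M X$ with associative, unital left and right actions of $\mathcal C$ that are degree-zero chain maps. $(\Sigma^rA)^k=A^{k+r}$ with differential multiplied by $(-1)^r$. Two-sided bar complex: $\mathbf B(\mathcal C)=\bigoplus_{r\ge0}\bigoplus_{X_1,\dots,X_{r+1}}\Sigma^r(\mathcal CX_1\otimes_\Bbbk X_1\mathcal CX_2\otimes\cdots\otimes X_{r+1}\mathcal C)$, with elements written $[f_0|f_1|\cdots|f_{r+1}]$, differential equal to the internal differential plus $[f_0|\cdots|f_{r+1}]\mapsto\sum_{i=0}^r(-1)^i[f_0|\cdots|f_i f_{i+1}|\cdots|f_{r+1}]$, and bimodule structure $g\cdot[f_0|\cdots|f_{r+1}]\cdot g'=(-1)^{|g|r}[gf_0|\cdots|f_{r+1}g']$. For a $\mathcal C,\mathcal C$-bimodule $\mathcal M$, let $\mathbf C(\mathcal C,\mathcal M)$ be the quotient of $\mathbf B(\mathcal C)\otimes_{\mathcal C}\mathcal M$ by the span of graded commutators $f\cdot m-(-1)^{|f||m|}m\cdot f$. Its elements are combinations of $[c_1|\cdots|c_r|m]$. The cyclic bar complex is $\mathbf C(\mathcal C):=\mathbf C(\mathcal C,\mathcal C)$ and $\mathrm{HH}_k(\mathcal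 C):=H^{-k}(\mathbf C(\mathcal C))$. Its product is induced by $[\underline c|f]\cdot[\underline d|g]=\pm[\underline d*\underline c\,|\,g\star f]$, where $\underline d*\underline c$ is the shuffle product: the signed sum over all shuffles of the sequences $(d_i\star\mathrm{Id})_i$ and $(\mathrm{Id}\star c_j)_j$ (identities chosen so that the sequence is composable), with Koszul signs in which bar entries have degree shifted by $-1$. Derived horizontal trace: $\mathrm{Tr}(\mathcal C)$ has objects $\mathrm{Tr}(X)$ for $X\in\mathcal C$. For $X,X'\in\mathcal C$ let $\mathcal X_{12}(X',X)=\bigoplus_{Y,Y'}\mathrm{Hom}_{\mathcal C}(X\star Y,Y'\star X')$, with bimodule structure $a\cdot f\cdot b=(a\star\mathrm{Id}_{X'})\circ f\circ(\mathrm{Id}_X\star b)$. Then $\mathrm{Hom}_{\mathrm{Tr}(\mathcal C)}(\mathrm{Tr}(X),\mathrm{Tr}(X')):=\mathbf C(\mathcal C,\mathcal X_{12}(X',X))$. It is spanned by $[c_1|\cdots|c_r|f]$ with $c_i\in\mathrm{Hom}_{\mathcal C}(Y_{i+1},Y_i)$ and $f\in\mathrm{Hom}_{\mathcal C}(X\star Y_1,Y_{r+1}\star X')$. Composition is $[\underline c|f]\circ[\underline d|g]=\pm[\underline d*\underline c\,|\,(\mathrm{Id}\star f)\circ(g\star\mathrm{Id})]$ with Koszul signs. The functor $\mathrm{Tr}$ sends $X\mapsto\mathrm{Tr}(X)$ and $f\mapsto[f]$ (the element with $r=0$, $Y_1=\mathbf 1$). For dg functors $F,G\colon\mathcal C\to\mathcal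 D$, a family of closed degree-zero morphisms $\alpha_X\colon F(X)\to G(X)$ is natural up to coherent homotopy if it is given with a closed degree-zero map of $\mathcal C,\mathcal C$-bimodules from $\mathbf B(\mathcal C)$ to the bimodule $(X',X)\mapsto\mathrm{Hom}_{\mathcal D}(F(X),G(X'))$ sending $[\mathrm{Id}_X|\mathrm{Id}_X]$ to $\alpha_X$. Here it is applied, for each $Y$, to $F=\mathrm{Tr}(-\star Y)$ and $G=\mathrm{Tr}(Y\star-)$. *)

(* Defs.v *)
From HB Require Import structures.
From mathcomp Require Import all_boot all_order all_algebra.
From mathcomp Require Import boolp.
From Stdlib Require Import ClassicalEpsilon.

Set Implicit Arguments.
Unset Strict Implicit.
Unset Printing Implicit Defensive.

Import GRing.Theory.
Local Open Scope ring_scope.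
Local Open Scope quotient_scope.

Section Presented.
Variables (k : pzRingType) (S : Type) (R : seq (k * S) -> Prop).

Definition lincomb (V : lmodType k) (F : S -> V) (l : seq (k * S)) : V :=
  \sum_(x <- l) x.1 *: F x.2.

Definition kills (V : lmodType k) (F : S -> V) : Prop :=
  forall r, R r -> lincomb F r = 0.

(* The k-module with generators S and relations R: formal combinations are
   identified when they have the same value in every k-module in which the
   relations hold. *)
Definition pres_eq (l l' : {classic (seq (k * S))}) : bool :=
  `[< forall (V : lmodType k) (F : S -> V),
        kills F -> lincomb F l = lincomb F l' >].

Lemma pres_eq_equiv : equiv_class_of pres_eq.
Proof.
split=> [l|l l'|l1 l2 l3].
- exact/asboolP.
- by apply/asboolP/asboolP => H V F HF; rewrite H.
- by move=> /asboolP H1 /asboolP H2; apply/asboolP => V F HF; rewrite H1 ?H2.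
Qed.
Canonical pres_equiv := EquivRelPack pres_eq_equiv.

Definition presented := {eq_quot pres_equiv}.
HB.instance Definition _ := Choice.on presented.
HB.instance Definition _ := EqQuotient.on presented.

Definition pcls (l : seq (k * S)) : presented :=
  \pi_presented (l : {classic _}).
Definition prepr (x : presented) : seq (k * S) := repr x.

Lemma pcls_eq l l' :
  (forall (V : lmodType k) (F : S -> V),
     kills F -> lincomb F l = lincomb F l') ->
  pcls l = pcls l'.
Proof. by move=> H; apply/eqmodP/asboolP. Qed.

Lemma prepr_cls l (V : lmodType k) (F : S -> V) :
  kills F -> lincomb F (prepr (pcls l)) = lincomb F l.
Proof. by move=> HF; have /eqmodP/asboolP := reprK (pcls l); exact. Qed.

Definition padd (x y : presented) := pcls (prepr x ++ prepr y).
Definition popp (x : presented) := pcls [seq (- z.1, z.2) | z <- prepr x].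
Definition pscale (a : k) (x : presented) :=
  pcls [seq (a * z.1, z.2) | z <- prepr x].

Section Eval.
Variables (V : lmodType k) (F : S -> V).

Lemma paddE x y : kills F ->
  lincomb F (prepr (padd x y)) = lincomb F (prepr x) + lincomb F (prepr y).
Proof. by move=> HF; rewrite prepr_cls //; exact: big_cat. Qed.

Lemma poppE x : kills F ->
  lincomb F (prepr (popp x)) = - lincomb F (prepr x).
Proof.
move=> HF; rewrite prepr_cls // /lincomb big_map -sumrN.
by apply: eq_bigr => i _; rewrite scaleNr.
Qed.

Lemma pscaleE a x : kills F ->
  lincomb F (prepr (pscale a x)) = a *: lincomb F (prepr x).
Proof.
move=> HF; rewrite prepr_cls // /lincomb big_map scaler_sumr.
by apply: eq_bigr => i _; rewrite scalerA.
Qed.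
End Eval.

Lemma pext x y :
  (forall (V : lmodType k) (F : S -> V),
     kills F -> lincomb F (prepr x) = lincomb F (prepr y)) -> x = y.
Proof.
by move=> H; rewrite -[x]reprK -[y]reprK; exact: (@pcls_eq (prepr x) (prepr y)).
Qed.

Lemma paddA : associative padd.
Proof. by move=> x y z; apply: pext => V F HF; rewrite !paddE // addrA. Qed.
Lemma paddC : commutative padd.
Proof. by move=> x y; apply: pext => V F HF; rewrite !paddE // addrC. Qed.
Lemma padd0 : left_id (pcls [::]) padd.
Proof.
move=> x; apply: pext => V F HF.
by rewrite paddE // prepr_cls // /lincomb big_nil add0r.
Qed.
Lemma paddN : left_inverse (pcls [::]) popp padd.
Proof.
move=> x; apply: pext => V F HF.
by rewrite paddE // poppE // prepr_cls // /lincomb big_nil addNr.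
Qed.
HB.instance Definition _ :=
  GRing.isZmodule.Build presented paddA paddC padd0 paddN.

Lemma pscaleA a b x : pscale a (pscale b x) = pscale (a * b) x.
Proof. by apply: pext => V F HF; rewrite !pscaleE // scalerA. Qed.
Lemma pscale1 : left_id 1 pscale.
Proof. by move=> x; apply: pext => V F HF; rewrite !pscaleE // scale1r. Qed.
Lemma pscaleDr : right_distributive pscale +%R.
Proof.
by move=> a x y; apply: pext => V F HF; rewrite !(pscaleE, paddE) // scalerDr.
Qed.
Lemma pscaleDl x : {morph pscale^~ x : a b / a + b}.
Proof.
by move=> a b; apply: pext => V F HF; rewrite !(pscaleE, paddE) // scalerDl.
Qed.
HB.instance Definition _ := GRing.Zmodule_isLmodule.Build k presented
  pscaleA pscale1 pscaleDr pscaleDl.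

Definition pgen (s : S) : presented := pcls [:: (1, s)].

(* Extension of F from generators to the presented module; this is the
   induced linear map when F kills the relations (plift_linear, plift_gen). *)
Definition plift (V : lmodType k) (F : S -> V) (x : presented) : V :=
  lincomb F (prepr x).

Lemma plift_linear (V : lmodType k) (F : S -> V) : kills F ->
  forall a x y, plift F (a *: x + y) = a *: plift F x + plift F y.
Proof. by move=> HF a x y; rewrite /plift paddE // pscaleE. Qed.

Lemma plift_gen (V : lmodType k) (F : S -> V) : kills F ->
  forall s, plift F (pgen s) = F s.
Proof.
by move=> HF s; rewrite /plift prepr_cls // /lincomb big_seq1 scale1r.
Qed.

End Presented.

Section Complexes.
Variable k : comPzRingType.

Definition sgn (n : int) : k := (-1) ^+ `|n|%N.

Inductive lspan (V : lmodType k) (W : V -> Prop) : V -> Prop :=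
| span0 : lspan W 0
| spanS a x y : W x -> lspan W y -> lspan W (a *: x + y).

(* Graded modules are internal direct sums: hdeg n is the summand of degree n
   of the total module. *)
Record cplx := Cplx {
  car :> lmodType k;
  hdeg : int -> car -> Prop;
  cdiff : car -> car }.

Record is_complex (A : cplx) : Prop := {
  cx_hdeg0 : forall n, hdeg n (0 : A);
  cx_hdegL : forall n a (x y : A),
    hdeg n x -> hdeg n y -> hdeg n (a *: x + y);
  cx_sum : forall x : A, exists (s : seq int) (w : int -> A),
    (forall n, hdeg n (w n)) /\ x = \sum_(n <- s) w n;
  cx_direct : forall (s : seq int) (w : int -> A),
    uniq s -> (forall n, hdeg n (w n)) -> \sum_(n <- s) w n = 0 ->
    forall n, n \in s -> w n = 0;
  cx_diffL : forall a (x y : A), cdiff (a *: x + y) = a *: cdiff x + cdiff y;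
  cx_diff_hdeg : forall n (x : A), hdeg n x -> hdeg (n + 1) (cdiff x);
  cx_diffK : forall x : A, cdiff (cdiff x) = 0 }.

Record is_cplx_map (A B : cplx) (u : A -> B) : Prop := {
  cm_linear : forall a x y, u (a *: x + y) = a *: u x + u y;
  cm_hdeg : forall n x, hdeg n x -> hdeg n (u x);
  cm_diff : forall x, u (cdiff x) = cdiff (u x) }.

Record helt (A : cplx) := Helt {
  hval :> A;
  hdg : int;
  hvalP : hdeg hdg hval }.

(* Cohomology of A, all degrees together: the cocycles modulo coboundaries.
   The first relation makes z |-> [z] linear on cocycles. *)
Section Cohomology.
Variable A : cplx.

Inductive coh_rel : seq (k * {z : A | cdiff z = 0}) -> Prop :=
| coh_lin a (z z1 z2 : {z : A | cdiff z = 0}) :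
    sval z = a *: sval z1 + sval z2 ->
    coh_rel [:: (1, z); (- a, z1); (- 1, z2)]
| coh_bnd (z : {z : A | cdiff z = 0}) (b : A) :
    sval z = cdiff b -> coh_rel [:: (1, z)].

Definition coh : lmodType k := presented coh_rel.

Definition coh_cls (z : A) : coh :=
  if pselect (cdiff z = 0) is left e then pgen coh_rel (exist _ z e) else 0.

Definition coh_deg (n : int) (x : coh) : Prop :=
  exists z : A, [/\ hdeg n z, cdiff z = 0 & x = coh_cls z].

Definition coh_mul (mul : A -> A -> A) (x y : coh) : coh :=
  plift (fun z1 => plift (fun z2 => coh_cls (mul (sval z1) (sval z2))) y) x.
End Cohomology.

Record dgdata := DgData {
  ob : Type;
  dghom : ob -> ob -> cplx;
  dgid : forall X, dghom X X;
  dgcomp : forall X Y Z, dghom Y Z -> dghom X Y -> dghom X Z }.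

Record is_dgcat (D : dgdata) : Prop := {
  dg_cplx : forall X Y : ob D, is_complex (dghom X Y);
  dg_compLl : forall (X Y Z : ob D) a (f f' : dghom Y Z) (g : dghom X Y),
    dgcomp (a *: f + f') g = a *: dgcomp f g + dgcomp f' g;
  dg_compLr : forall (X Y Z : ob D) a (f : dghom Y Z) (g g' : dghom X Y),
    dgcomp f (a *: g + g') = a *: dgcomp f g + dgcomp f g';
  dg_comp_hdeg : forall (X Y Z : ob D) p q (f : dghom Y Z) (g : dghom X Y),
    hdeg p f -> hdeg q g -> hdeg (p + q) (dgcomp f g);
  dg_comp_diff : forall (X Y Z : ob D) p (f : dghom Y Z) (g : dghom X Y),
    hdeg p f ->
    cdiff (dgcomp f g) = dgcomp (cdiff f) g + sgn p *: dgcomp f (cdiff g);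
  dg_compA : forall (W X Y Z : ob D)
      (f : dghom Y Z) (g : dghom X Y) (h : dghom W X),
    dgcomp f (dgcomp g h) = dgcomp (dgcomp f g) h;
  dg_comp1l : forall (X Y : ob D) (f : dghom X Y), dgcomp (dgid Y) f = f;
  dg_comp1r : forall (X Y : ob D) (f : dghom X Y), dgcomp f (dgid X) = f;
  dg_id_hdeg : forall X : ob D, hdeg 0 (dgid X);
  dg_id_diff : forall X : ob D, cdiff (dgid X) = 0 }.

Record dgcat := DgCat { dg_data :> dgdata; dgP : is_dgcat dg_data }.

Record is_dgfunctor (C D : dgdata) (F0 : ob C -> ob D)
    (F1 : forall X Y, dghom X Y -> dghom (F0 X) (F0 Y)) : Prop := {
  df_cplx : forall X Y : ob C, is_cplx_map (@F1 X Y);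
  df_comp : forall (X Y Z : ob C) (f : dghom Y Z) (g : dghom X Y),
    F1 _ _ (dgcomp f g) = dgcomp (F1 _ _ f) (F1 _ _ g);
  df_id : forall X : ob C, F1 _ _ (dgid X) = dgid (F0 X) }.

Definition castH (D : dgdata) (X X' Y Y' : ob D) (eX : X = X') (eY : Y = Y')
    (f : dghom X Y) : dghom X' Y' :=
  ecast Z (dghom Z Y') eX (ecast Z (dghom X Z) eY f).

End Complexes.

Notation "g ∘ f" := (dgcomp g f) (at level 40, left associativity).

Section Homogeneous.
Variables (k : comPzRingType) (C : dgcat k).

Definition hid (X : ob C) : helt (dghom X X) := Helt (dg_id_hdeg (dgP C) X).

Definition hcomp (X Y Z : ob C) (f : helt (dghom Y Z)) (g : helt (dghom X Y)) :
    helt (dghom X Z) :=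
  Helt (dg_comp_hdeg (dgP C) (hvalP f) (hvalP g)).

Definition hdiff (X Y : ob C) (f : helt (dghom X Y)) : helt (dghom X Y) :=
  Helt (cx_diff_hdeg (dg_cplx (dgP C) X Y) (hvalP f)).

End Homogeneous.

(* [bm M Y X] is Y M X.  Actions are specified on homogeneous elements of C,
   which determines them. *)
Record bimod (k : comPzRingType) (C : dgcat k) := Bimod {
  bm : ob C -> ob C -> cplx k;
  lact : forall Y' Y X, helt (dghom Y Y') -> bm Y X -> bm Y' X;
  ract : forall Y X X', bm Y X -> helt (dghom X' X) -> bm Y X' }.

Record is_bimod (k : comPzRingType) (C : dgcat k) (M : bimod C) : Prop := {
  bi_cplx : forall Y X, is_complex (bm M Y X);
  bi_lactLl : forall Y' Y X a (f f1 f2 : helt (dghom Y Y')) (m : bm M Y X),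
    hdg f1 = hdg f -> hdg f2 = hdg f ->
    hval f = a *: hval f1 + hval f2 ->
    lact f m = a *: lact f1 m + lact f2 m;
  bi_lactLr : forall Y' Y X a (f : helt (dghom Y Y')) (m1 m2 : bm M Y X),
    lact f (a *: m1 + m2) = a *: lact f m1 + lact f m2;
  bi_ractLl : forall Y X X' a (m1 m2 : bm M Y X) (f : helt (dghom X' X)),
    ract (a *: m1 + m2) f = a *: ract m1 f + ract m2 f;
  bi_ractLr : forall Y X X' a (m : bm M Y X) (f f1 f2 : helt (dghom X' X)),
    hdg f1 = hdg f -> hdg f2 = hdg f ->
    hval f = a *: hval f1 + hval f2 ->
    ract m f = a *: ract m f1 + ract m f2;
  bi_lact_hdeg : forall Y' Y X p (f : helt (dghom Y Y')) (m : bm M Y X),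
    hdeg p m -> hdeg (hdg f + p) (lact f m);
  bi_ract_hdeg : forall Y X X' p (m : bm M Y X) (f : helt (dghom X' X)),
    hdeg p m -> hdeg (p + hdg f) (ract m f);
  bi_lact_diff : forall Y' Y X (f : helt (dghom Y Y')) (m : bm M Y X),
    cdiff (lact f m) = lact (hdiff f) m + sgn k (hdg f) *: lact f (cdiff m);
  bi_ract_diff : forall Y X X' p (m : bm M Y X) (f : helt (dghom X' X)),
    hdeg p m ->
    cdiff (ract m f) = ract (cdiff m) f + sgn k p *: ract m (hdiff f);
  bi_lactA : forall Y'' Y' Y X (f : helt (dghom Y' Y'')) (g : helt (dghom Y Y'))
      (m : bm M Y X),
    lact f (lact g m) = lact (hcomp f g) m;
  bi_ractA : forall Y X X' X'' (m : bm M Y X) (f : helt (dghom X' X))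
      (g : helt (dghom X'' X')),
    ract (ract m f) g = ract m (hcomp f g);
  bi_lract : forall Y' Y X X' (f : helt (dghom Y Y')) (m : bm M Y X)
      (g : helt (dghom X' X)),
    ract (lact f m) g = lact f (ract m g);
  bi_lact1 : forall Y X (m : bm M Y X), lact (hid Y) m = m;
  bi_ract1 : forall Y X (m : bm M Y X), ract m (hid X) = m }.

Record is_bimod_map (k : comPzRingType) (C : dgcat k) (M N : bimod C)
    (u : forall Y X, bm M Y X -> bm N Y X) : Prop := {
  bh_cplx : forall Y X, is_cplx_map (u Y X);
  bh_lact : forall Y' Y X (g : helt (dghom Y Y')) (m : bm M Y X),
    u _ _ (lact g m) = lact g (u _ _ m);
  bh_ract : forall Y X X' (m : bm M Y X) (g : helt (dghom X' X)),
    u _ _ (ract m g) = ract (u _ _ m) g }.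

Section Bar.
Variables (k : comPzRingType) (C : dgcat k).

(* [hchain Y X]: strings c_1|...|c_r of homogeneous morphisms
   Y = X_1 <- X_2 <- ... <- X_{r+1} = X. *)
Inductive hchain : ob C -> ob C -> Type :=
| hnil X : hchain X X
| hcons Y Z X : helt (dghom Z Y) -> hchain Z X -> hchain Y X.

Fixpoint csize Y X (c : hchain Y X) : nat :=
  if c is hcons _ _ _ _ c' then (csize c').+1 else 0%N.

Fixpoint cdeg Y X (c : hchain Y X) : int :=
  if c is hcons _ _ _ f c' then hdg f + cdeg c' else 0.

(* [chain_lin a c c1 c2]: the strings agree except in one slot, where the
   entry of c is a times that of c1 plus that of c2. *)
Inductive chain_lin (a : k) :
    forall Y X, hchain Y X -> hchain Y X -> hchain Y X -> Prop :=
| lin_here Y Z X (f f1 f2 : helt (dghom Z Y)) (c : hchain Z X) :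
    hdg f1 = hdg f -> hdg f2 = hdg f ->
    hval f = a *: hval f1 + hval f2 ->
    chain_lin a (hcons f c) (hcons f1 c) (hcons f2 c)
| lin_there Y Z X (f : helt (dghom Z Y)) (c c1 c2 : hchain Z X) :
    chain_lin a c c1 c2 ->
    chain_lin a (hcons f c) (hcons f c1) (hcons f c2).

(* The sum over i of (-1)^(|f_1|+...+|f_(i-1)|) K [..|d f_i|..]. *)
Fixpoint dint (V : lmodType k) Y X (c : hchain Y X) :
    (hchain Y X -> V) -> V :=
  match c in hchain Y X return (hchain Y X -> V) -> V with
  | hnil _ => fun _ => 0
  | hcons _ _ _ f c' => fun K =>
      K (hcons (hdiff f) c')
      + sgn k (hdg f) *: dint c' (fun c'' => K (hcons f c''))
  end.

Definition merge_head (V : lmodType k) Y Z X (f : helt (dghom Z Y))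
    (c : hchain Z X) (K : hchain Y X -> V) : V :=
  match c in hchain Z X return helt (dghom Z Y) -> (hchain Y X -> V) -> V with
  | hnil _ => fun _ _ => 0
  | hcons _ _ _ g c' => fun f K => K (hcons (hcomp f g) c')
  end f K.

(* The alternating sum, starting with sign +, of K [..|f_i f_(i+1)|..] over
   all adjacent pairs of entries. *)
Fixpoint faces (V : lmodType k) Y X (c : hchain Y X) :
    (hchain Y X -> V) -> V :=
  match c in hchain Y X return (hchain Y X -> V) -> V with
  | hnil _ => fun _ => 0
  | hcons _ _ _ f c' => fun K =>
      merge_head f c' K - faces c' (fun c'' => K (hcons f c''))
  end.

(* Strings with at least two entries are read as [f_0|...|f_(r+1)]. *)
Definition blen Y X (c : hchain Y X) : int := (csize c)%:Z - 2.
Definition bdeg Y X (c : hchain Y X) : int := cdeg c - blen c.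

(* Multiplication on the first, respectively last, entry; the values on the
   empty string are irrelevant. *)
Definition clact Y' Y X (g : helt (dghom Y Y')) (c : hchain Y X) : hchain Y' X :=
  match c in hchain Y X return helt (dghom Y Y') -> hchain Y' X with
  | hnil X => fun g => hcons g (hnil X)
  | hcons _ _ _ f c' => fun g => hcons (hcomp g f) c'
  end g.

Fixpoint cract Y X (c : hchain Y X) :
    forall X', helt (dghom X' X) -> hchain Y X' :=
  match c in hchain Y X return forall X', helt (dghom X' X) -> hchain Y X' with
  | hnil _ => fun X' g => hcons g (hnil X')
  | hcons Y _ _ f c' => fun X' g =>
      match c' in hchain Z X
        return helt (dghom Z Y) -> helt (dghom X' X) -> hchain Z X' -> hchain Y X'
      with
      | hnil _ => fun f g _ => hcons (hcomp f g) (hnil X')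
      | hcons _ _ _ _ _ => fun f _ c'g => hcons f c'g
      end f g (cract c' g)
  end.

Fixpoint crcons Y X (c : hchain Y X) :
    forall X', helt (dghom X' X) -> hchain Y X' :=
  match c in hchain Y X return forall X', helt (dghom X' X) -> hchain Y X' with
  | hnil _ => fun X' g => hcons g (hnil X')
  | hcons _ _ _ f c' => fun _ g => hcons f (crcons c' g)
  end.

(* [pad c] is Id|c_1|...|c_r|Id. *)
Definition pad Y X (c : hchain Y X) : hchain Y X :=
  hcons (hid Y) (crcons c (hid X)).

(* Two-sided bar complex.  Strings with fewer than two entries are set to 0,
   so that [f_0|f_1] has no bar differential. *)
Inductive bar_rel Y X : seq (k * hchain Y X) -> Prop :=
| bar_lin a c c1 c2 : chain_lin a c c1 c2 ->
    bar_rel [:: (1, c); (- a, c1); (- 1, c2)]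
| bar_short c : (csize c < 2)%N -> bar_rel [:: (1, c)].

Definition bar_mod Y X : lmodType k := presented (@bar_rel Y X).

Definition bar_sym Y X (c : hchain Y X) : bar_mod Y X := pgen (@bar_rel Y X) c.

Definition bar_diff Y X : bar_mod Y X -> bar_mod Y X :=
  plift (fun c => sgn k (blen c) *: dint c (@bar_sym Y X)
                 + faces c (@bar_sym Y X)).

Definition bar_cplx Y X : cplx k :=
  @Cplx k (bar_mod Y X)
    (fun n => lspan (fun x => exists2 c, bdeg c = n & x = bar_sym c))
    (@bar_diff Y X).

Definition bar : bimod C :=
  @Bimod k C bar_cplx
    (fun Y' Y X g => plift (fun c =>
       sgn k (hdg g * blen c) *: bar_sym (clact g c) : bar_cplx Y' X))
    (fun Y X X' x g => plift (fun c => bar_sym (cract c g) : bar_cplx Y X') x).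

(* C(C, M): the quotient of B(C) (x)_C M by graded commutators.  It is
   generated by the symbols [f_0|...|f_(r+1)] (x) m; cyc_bal is the balancing
   relation of (x)_C and cyc_comm the commutator relation
   f.(b (x) m) = (-1)^(|f||b (x) m|) (b (x) m).f, which only leaves the part
   of B(C) (x)_C M from an object to itself. *)
Section Cyclic.
Variable M : bimod C.

Record cycsym := CycSym {
  cs_tgt : ob C;
  cs_src : ob C;
  cs_chain : hchain cs_tgt cs_src;
  cs_mod : bm M cs_src cs_tgt }.

Inductive cyc_rel : seq (k * cycsym) -> Prop :=
| cyc_linl a Y Z (c c1 c2 : hchain Y Z) (m : bm M Z Y) :
    chain_lin a c c1 c2 ->
    cyc_rel [:: (1, CycSym c m); (- a, CycSym c1 m); (- 1, CycSym c2 m)]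
| cyc_linr a Y Z (c : hchain Y Z) (m1 m2 : bm M Z Y) :
    cyc_rel [:: (1, CycSym c (a *: m1 + m2));
                (- a, CycSym c m1); (- 1, CycSym c m2)]
| cyc_short Y Z (c : hchain Y Z) (m : bm M Z Y) :
    (csize c < 2)%N -> cyc_rel [:: (1, CycSym c m)]
| cyc_bal Y Z Z' (c : hchain Y Z) (g : helt (dghom Z' Z)) (m : bm M Z' Y) :
    cyc_rel [:: (1, CycSym (cract c g) m); (- 1, CycSym c (lact g m))]
| cyc_comm Y Y' Z p (f : helt (dghom Y Y')) (c : hchain Y Z) (m : bm M Z Y') :
    hdeg p m ->
    cyc_rel [:: (sgn k (hdg f * blen c), CycSym (clact f c) m);
                (- sgn k (hdg f * (bdeg c + p)), CycSym c (ract m f))].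

Definition cyc_mod : lmodType k := presented cyc_rel.

Definition cyc_sym Y Z (c : hchain Y Z) (m : bm M Z Y) : cyc_mod :=
  pgen cyc_rel (CycSym c m).

Definition cyc_diff : cyc_mod -> cyc_mod :=
  plift (fun s : cycsym =>
    let c := cs_chain s in let m := cs_mod s in
    sgn k (blen c) *: dint c (fun c' => cyc_sym c' m)
    + faces c (fun c' => cyc_sym c' m)
    + sgn k (bdeg c) *: cyc_sym c (cdiff m)).

Definition cyc : cplx k :=
  @Cplx k cyc_mod
    (fun n => lspan (fun x => exists Y Z (c : hchain Y Z) (m : bm M Z Y) p,
       [/\ hdeg p m, bdeg c + p = n & x = cyc_sym c m]))
    cyc_diff.

(* [c_1|...|c_r|m] *)
Definition cyc_elt Y Z (c : hchain Y Z) (m : bm M Z Y) : cyc :=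
  cyc_sym (pad c) m.

(* Bar entries carry degree |c_i| - 1. *)
Fixpoint sdeg Y Z (c : hchain Y Z) : int :=
  if c is hcons _ _ _ f c' then hdg f - 1 + sdeg c' else 0.

(* The complex uses the shift Sigma^r in front of c_1 (x) ... (x) c_r, whereas
   the Koszul rule for shuffles is for Sigma c_1 (x) ... (x) Sigma c_r.  Moving
   the shifts in front of their entries gives (-1)^(sum_i (r - i)|c_i|). *)
Fixpoint shift_exp Y Z (c : hchain Y Z) : int :=
  if c is hcons _ _ _ f c' then hdg f * (csize c')%:Z + shift_exp c' else 0.

(* The symbol [c_1|...|c_r|m] with each c_i separately shifted. *)
Definition scyc_elt Y Z (c : hchain Y Z) (m : bm M Z Y) : cyc :=
  sgn k (shift_exp c) *: cyc_elt c m.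
End Cyclic.

Definition diag_bimod : bimod C :=
  @Bimod k C (fun Y X => dghom X Y)
    (fun Y' Y X f m => f ∘ m) (fun Y X X' m f => m ∘ f).

(* The bimodule (X', X) |-> Hom_D(F X, G X'). *)
Definition hom_bimod (D : dgdata k) (F0 G0 : ob C -> ob D)
    (F1 : forall X Y, dghom X Y -> dghom (F0 X) (F0 Y))
    (G1 : forall X Y, dghom X Y -> dghom (G0 X) (G0 Y)) : bimod C :=
  @Bimod k C (fun X' X => dghom (F0 X) (G0 X'))
    (fun Y' Y X a h => G1 _ _ (hval a) ∘ h)
    (fun Y X X' h b => h ∘ F1 _ _ (hval b)).

Definition natural_up_to_coherent_homotopy (D : dgdata k)
    (F0 G0 : ob C -> ob D)
    (F1 : forall X Y, dghom X Y -> dghom (F0 X) (F0 Y))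
    (G1 : forall X Y, dghom X Y -> dghom (G0 X) (G0 Y))
    (alpha : forall X, dghom (F0 X) (G0 X)) : Prop :=
  exists u : forall X' X, bm bar X' X -> bm (hom_bimod F1 G1) X' X,
    is_bimod_map u
    /\ forall X, u X X (bar_sym (pad (hnil X))) = alpha X.

End Bar.

Lemma diag_bimodP (k : comPzRingType) (C : dgcat k) : is_bimod (diag_bimod C).
Proof.
have P := dgP C; split=> /=.
- by move=> Y X; exact: dg_cplx.
- by move=> Y' Y X a f f1 f2 m _ _ ->; rewrite (dg_compLl P).
- by move=> *; rewrite (dg_compLr P).
- by move=> *; rewrite (dg_compLl P).
- by move=> Y X X' a m f f1 f2 _ _ ->; rewrite (dg_compLr P).
- by move=> Y' Y X p f m; apply: dg_comp_hdeg => //; exact: hvalP.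
- by move=> Y X X' p m f h; apply: dg_comp_hdeg => //; exact: hvalP.
- by move=> Y' Y X f m; rewrite (dg_comp_diff P _ (hvalP f)).
- by move=> Y X X' p m f h; rewrite (dg_comp_diff P _ h).
- by move=> *; rewrite (dg_compA P).
- by move=> *; rewrite (dg_compA P).
- by move=> *; rewrite (dg_compA P).
- by move=> *; rewrite (dg_comp1l P).
- by move=> *; rewrite (dg_comp1r P).
Qed.

(* Strictness on morphisms is stated by transport (castH) along the equalities
   of objects. *)
Record smdgcat (k : comPzRingType) := SmDgCat {
  sm_cat :> dgcat k;
  tob : ob sm_cat -> ob sm_cat -> ob sm_cat;
  tone : ob sm_cat;
  thom : forall X X' Y Y' : ob sm_cat,
    dghom X X' -> dghom Y Y' -> dghom (tob X Y) (tob X' Y');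
  tobA : forall X Y Z, tob X (tob Y Z) = tob (tob X Y) Z;
  tob1l : forall X, tob tone X = X;
  tob1r : forall X, tob X tone = X;
  thomLl : forall (X X' Y Y' : ob sm_cat) a (f1 f2 : dghom X X') (g : dghom Y Y'),
    thom (a *: f1 + f2) g = a *: thom f1 g + thom f2 g;
  thomLr : forall (X X' Y Y' : ob sm_cat) a (f : dghom X X') (g1 g2 : dghom Y Y'),
    thom f (a *: g1 + g2) = a *: thom f g1 + thom f g2;
  thom_hdeg : forall (X X' Y Y' : ob sm_cat) p q
      (f : dghom X X') (g : dghom Y Y'),
    hdeg p f -> hdeg q g -> hdeg (p + q) (thom f g);
  thom_diff : forall (X X' Y Y' : ob sm_cat) p (f : dghom X X') (g : dghom Y Y'),
    hdeg p f ->
    cdiff (thom f g) = thom (cdiff f) g + sgn k p *: thom f (cdiff g);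
  thom_id : forall X Y : ob sm_cat, thom (dgid X) (dgid Y) = dgid (tob X Y);
  thom_comp : forall (X X' X'' Y Y' Y'' : ob sm_cat) p q
      (f : dghom X' X'') (f' : dghom X X') (g : dghom Y' Y'') (g' : dghom Y Y'),
    hdeg p f' -> hdeg q g ->
    thom f g ∘ thom f' g' = sgn k (q * p) *: thom (f ∘ f') (g ∘ g');
  thomA : forall (X X' Y Y' Z Z' : ob sm_cat)
      (f : dghom X X') (g : dghom Y Y') (h : dghom Z Z'),
    castH (tobA X Y Z) (tobA X' Y' Z') (thom f (thom g h))
    = thom (thom f g) h;
  thom1l : forall (X X' : ob sm_cat) (f : dghom X X'),
    castH (tob1l X) (tob1l X') (thom (dgid tone) f) = f;
  thom1r : forall (X X' : ob sm_cat) (f : dghom X X'),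
    castH (tob1r X) (tob1r X') (thom f (dgid tone)) = f }.

Notation "X ⋆ Y" := (tob X Y) (at level 38, left associativity).
Notation "f ⋆⋆ g" := (thom f g) (at level 38, left associativity).
Arguments tone {k} s.

Section Trace.
Variables (k : comPzRingType) (C : smdgcat k).

Definition hthom (X X' Y Y' : ob C) (f : helt (dghom X X'))
    (g : helt (dghom Y Y')) : helt (dghom (X ⋆ Y) (X' ⋆ Y')) :=
  Helt (thom_hdeg (hvalP f) (hvalP g)).

Fixpoint cthoml (Z : ob C) Y Y' (c : hchain Y Y') :
    hchain (Z ⋆ Y) (Z ⋆ Y') :=
  match c in hchain Y Y' return hchain (Z ⋆ Y) (Z ⋆ Y') with
  | hnil Y => hnil (Z ⋆ Y)
  | hcons _ _ _ f c' => hcons (hthom (hid Z) f) (cthoml Z c')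
  end.

Fixpoint cthomr (Z : ob C) Y Y' (c : hchain Y Y') :
    hchain (Y ⋆ Z) (Y' ⋆ Z) :=
  match c in hchain Y Y' return hchain (Y ⋆ Z) (Y' ⋆ Z) with
  | hnil Y => hnil (Y ⋆ Z)
  | hcons _ _ _ f c' => hcons (hthom f (hid Z)) (cthomr Z c')
  end.

(* All shuffles of (d_i * Id)_i and (Id * c_j)_j with their signs: an entry
   c_j that moves to the left of d_i, ..., d_s contributes the exponent
   (|c_j| - 1) (|d_i| - 1 + ... + |d_s| - 1). *)
Fixpoint shuffle Z Z' (d : hchain (C:=C) Z Z') {struct d} :
    forall Y Y', hchain (C:=C) Y Y' -> seq (k * hchain (Z ⋆ Y) (Z' ⋆ Y')) :=
  match d in hchain Z Z'
    return forall Y Y', hchain Y Y' -> seq (k * hchain (Z ⋆ Y) (Z' ⋆ Y')) with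
  | hnil Z => fun Y Y' c => [:: (1, cthoml Z c)]
  | hcons Z1 _ Z' d1 d' =>
      fix shuffle_d Y Y' (c : hchain Y Y') {struct c} :
          seq (k * hchain (Z1 ⋆ Y) (Z' ⋆ Y')) :=
        match c in hchain Y Y'
          return seq (k * hchain (Z1 ⋆ Y) (Z' ⋆ Y')) with
        | hnil Y => [:: (1, cthomr Y (hcons d1 d'))]
        | hcons Y1 _ _ c1 c' =>
            [seq (t.1, hcons (hthom d1 (hid Y1)) t.2)
               | t <- shuffle d' (hcons c1 c')]
            ++ [seq (sgn k ((hdg c1 - 1) * sdeg (hcons d1 d')) * t.1,
                     hcons (hthom (hid Z1) c1) t.2)
                  | t <- shuffle_d _ _ c']
        end
  end.

Definition cyclic_bar : cplx k := cyc (diag_bimod C).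

(* Koszul signs: d_1, ..., d_s move to the left of c_1, ..., c_r, f, and then
   g to the left of f. *)
Definition is_cyclic_bar_mul (mul : cyclic_bar -> cyclic_bar -> cyclic_bar) :
    Prop :=
  [/\ forall a x x' y, mul (a *: x + x') y = a *: mul x y + mul x' y,
      forall a x y y', mul x (a *: y + y') = a *: mul x y + mul x y'
    & forall (Y Y' Z Z' : ob C) (c : hchain Y Y') (d : hchain Z Z')
        (f : helt (dghom Y Y')) (g : helt (dghom Z Z')),
      mul (scyc_elt (M := diag_bimod C) c f) (scyc_elt (M := diag_bimod C) d g)
      = sgn k (sdeg d * (sdeg c + hdg f) + hdg f * hdg g) *:
        \sum_(t <- shuffle d c)
          t.1 *: scyc_elt (M := diag_bimod C) t.2 (g ⋆⋆ f)].

(* The symbols [c|f] span, so there is at most one such product. *)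
Definition cyclic_bar_mul : cyclic_bar -> cyclic_bar -> cyclic_bar :=
  epsilon (inhabits (fun _ _ => 0)) is_cyclic_bar_mul.

Definition cyclic_bar_one : cyclic_bar :=
  cyc_elt (M := diag_bimod C) (hnil (tone C)) (dgid (tone C)).

(* A dg algebra is a dg category with one object. *)
Definition cyclic_bar_alg : dgdata k :=
  @DgData k unit (fun _ _ => cyclic_bar) (fun _ => cyclic_bar_one)
    (fun _ _ _ => cyclic_bar_mul).

(* HH_n is the part coh_deg (- n). *)
Definition HH : lmodType k := coh cyclic_bar.

Definition X12 (X' X : ob C) : bimod C :=
  @Bimod k C (fun Y' Y => dghom (X ⋆ Y) (Y' ⋆ X'))
    (fun Y'' Y' Y a f => (hval a ⋆⋆ dgid X') ∘ f)
    (fun Y'' Y' Y f b => f ∘ (dgid X ⋆⋆ hval b)).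

Definition trhom (X X' : ob C) : cplx k := cyc (X12 X' X).

Definition trelt X X' Y Y' (c : hchain Y Y') (f : dghom (X ⋆ Y) (Y' ⋆ X')) :
    trhom X X' := cyc_elt (M := X12 X' X) c f.
Definition strelt X X' Y Y' (c : hchain Y Y') (f : dghom (X ⋆ Y) (Y' ⋆ X')) :
    trhom X X' := scyc_elt (M := X12 X' X) c f.

(* (Id * f) o (g * Id) *)
Definition trglue (X X' X'' Y Y' Z Z' : ob C)
    (f : dghom (X' ⋆ Y) (Y' ⋆ X'')) (g : dghom (X ⋆ Z) (Z' ⋆ X')) :
    dghom (X ⋆ (Z ⋆ Y)) ((Z' ⋆ Y') ⋆ X'') :=
  castH erefl (tobA Z' Y' X'') (dgid Z' ⋆⋆ f)
  ∘ castH (esym (tobA X Z Y)) (esym (tobA Z' X' Y)) (g ⋆⋆ dgid Y).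

(* Koszul sign: d_1, ..., d_s move to the left of c_1, ..., c_r, f. *)
Definition is_trcomp
    (op : forall X X' X'', trhom X' X'' -> trhom X X' -> trhom X X'') : Prop :=
  [/\ forall X X' X'' a (x x' : trhom X' X'') (y : trhom X X'),
        op _ _ _ (a *: x + x') y = a *: op _ _ _ x y + op _ _ _ x' y,
      forall X X' X'' a (x : trhom X' X'') (y y' : trhom X X'),
        op _ _ _ x (a *: y + y') = a *: op _ _ _ x y + op _ _ _ x y'
    & forall (X X' X'' Y Y' Z Z' : ob C) (c : hchain Y Y') (d : hchain Z Z')
        (f : helt (dghom (X' ⋆ Y) (Y' ⋆ X''))) (g : dghom (X ⋆ Z) (Z' ⋆ X')),
      op X X' X'' (strelt c f) (strelt d g)
      = sgn k (sdeg d * (sdeg c + hdg f)) *: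
        \sum_(t <- shuffle d c) t.1 *: strelt t.2 (trglue f g)].

(* The symbols [c|f] span, so there is at most one such composition. *)
Definition trcomp :
    forall X X' X'', trhom X' X'' -> trhom X X' -> trhom X X'' :=
  epsilon (inhabits (fun _ _ _ _ _ => 0)) is_trcomp.

Definition trmor X X' (f : dghom X X') : trhom X X' :=
  trelt (hnil (tone C)) (castH (esym (tob1r X)) (esym (tob1l X')) f).

(* Tr(C), with the object Tr(X) represented by X. *)
Definition Tr : dgdata k :=
  @DgData k (ob C) trhom (fun X => trmor (dgid X)) trcomp.

(* The morphism Tr(X * Y) -> Tr(Y * X) represented by the identity of
   X * Y * X, with r = 0 and Y_1 = X. *)
Definition trswap (X Y : ob C) : @dghom k Tr (X ⋆ Y) (Y ⋆ X) :=
  trelt (hnil X) (castH erefl (esym (tobA X Y X)) (dgid (X ⋆ Y ⋆ X))).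

Record homotopy_trace_like
    (alpha : forall X Y, @dghom k Tr (X ⋆ Y) (Y ⋆ X)) : Prop := {
  htl_hdeg : forall X Y, hdeg 0 (alpha X Y);
  htl_closed : forall X Y, cdiff (alpha X Y) = 0;
  htl_natural : forall (X Y Y' : ob C) (g : dghom Y Y'),
    @dgcomp k Tr _ _ _ (trmor (g ⋆⋆ dgid X)) (alpha X Y)
    = @dgcomp k Tr _ _ _ (alpha X Y') (trmor (dgid X ⋆⋆ g));
  htl_coherent : forall Y,
    @natural_up_to_coherent_homotopy k C Tr
      (fun X => X ⋆ Y) (fun X => Y ⋆ X)
      (fun X X' f => trmor (f ⋆⋆ dgid Y)) (fun X X' f => trmor (dgid Y ⋆⋆ f))
      (fun X => alpha X Y) }.

End Trace.

Lemma X12_bimodP (k : comPzRingType) (C : smdgcat k) (X' X : ob C) :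
  is_bimod (X12 X' X).
Proof.
have P := dgP C.
have i0 (Z : ob C) : hdeg 0 (dgid Z) by apply: (dg_id_hdeg P).
have L Y' Y (f : helt (@dghom _ C Y Y')) : hdeg (hdg f) (hval f ⋆⋆ dgid X').
  by have := thom_hdeg (hvalP f) (i0 X'); rewrite addr0.
have R Y' Y (f : helt (@dghom _ C Y Y')) : hdeg (hdg f) (dgid X ⋆⋆ hval f).
  by have := thom_hdeg (i0 X) (hvalP f); rewrite add0r.
have dL Y' Y (f : helt (@dghom _ C Y Y')) :
    cdiff (hval f ⋆⋆ dgid X') = cdiff (hval f) ⋆⋆ dgid X'.
  have t0 : (hval f ⋆⋆ (0 : dghom X' X')) = 0.
    have := thomLr (-1) (hval f) (0 : dghom X' X') 0.
    by rewrite scaler0 addr0 scaleN1r addNr.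
  by rewrite (thom_diff _ (hvalP f)) (dg_id_diff P) t0 scaler0 addr0.
have dR Y' Y (f : helt (@dghom _ C Y Y')) :
    cdiff (dgid X ⋆⋆ hval f) = dgid X ⋆⋆ cdiff (hval f).
  have t0 : ((0 : dghom X X) ⋆⋆ hval f) = 0.
    have := thomLl (-1) (0 : dghom X X) 0 (hval f).
    by rewrite scaler0 addr0 scaleN1r addNr.
  by rewrite (thom_diff _ (i0 X)) (dg_id_diff P) t0 add0r /sgn /= expr0 scale1r.
split=> /=.
- by move=> Y Z; exact: dg_cplx.
- by move=> Y' Y Z a f f1 f2 m _ _ ->; rewrite thomLl (dg_compLl P).
- by move=> *; rewrite (dg_compLr P).
- by move=> *; rewrite (dg_compLl P).
- by move=> Y Z Z' a m f f1 f2 _ _ ->; rewrite thomLr (dg_compLr P).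
- by move=> Y' Y Z p f m; exact: dg_comp_hdeg.
- by move=> Y Z Z' p m f h; exact: dg_comp_hdeg.
- by move=> Y' Y Z f m; rewrite (dg_comp_diff P _ (L _ _ f)) dL.
- by move=> Y Z Z' p m f h; rewrite (dg_comp_diff P _ h) dR.
- move=> Y'' Y' Y Z f g m; rewrite (dg_compA P).
  by rewrite (thom_comp _ _ (hvalP g) (i0 _)) mul0r /sgn /= expr0 scale1r (dg_comp1l P).
- move=> Y Z Z' Z'' m f g; rewrite -(dg_compA P).
  by rewrite (thom_comp _ _ (i0 X) (hvalP f)) mulr0 /sgn /= expr0 scale1r (dg_comp1l P).
- by move=> *; rewrite (dg_compA P).
- by move=> *; rewrite thom_id (dg_comp1l P).
- by move=> *; rewrite thom_id (dg_comp1r P).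
Qed.

(* Isomorphisms of graded k-algebras between the cohomology algebras of the
   endomorphism dg algebras of P in D and of Q in E. *)
Record is_coh_end_iso (k : comPzRingType) (D E : dgdata k) (P : ob D)
    (Q : ob E) (theta : coh (dghom P P) -> coh (dghom Q Q)) : Prop := {
  ci_linear : forall a x y, theta (a *: x + y) = a *: theta x + theta y;
  ci_bij : bijective theta;
  ci_deg : forall n x, coh_deg n x <-> coh_deg n (theta x);
  ci_one : theta (coh_cls (dgid P)) = coh_cls (dgid Q);
  ci_mul : forall x y,
    theta (coh_mul (@dgcomp _ _ P P P) x y)
    = coh_mul (@dgcomp _ _ Q Q Q) (theta x) (theta y) }.

Record smfunctor (k : comPzRingType) (C D : smdgcat k) := SmFunctor {
  sf0 :> ob C -> ob D;
  sf1 : forall X Y, dghom X Y -> dghom (sf0 X) (sf0 Y);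
  sf_dg : is_dgfunctor sf1;
  sf_tob : forall X Y, sf0 (X ⋆ Y) = sf0 X ⋆ sf0 Y;
  sf_tone : sf0 (tone C) = tone D;
  sf_thom : forall X X' Y Y' (f : dghom X X') (g : dghom Y Y'),
    castH (sf_tob X Y) (sf_tob X' Y') (sf1 (f ⋆⋆ g)) = sf1 f ⋆⋆ sf1 g }.

Section Naturality.
Variables (k : comPzRingType) (C D : smdgcat k) (Phi : smfunctor C D).

Definition hmap X Y (f : helt (dghom X Y)) : helt (dghom (Phi X) (Phi Y)) :=
  Helt (cm_hdeg (df_cplx (sf_dg Phi) X Y) (hvalP f)).

Fixpoint cmap Y X (c : hchain Y X) : hchain (Phi Y) (Phi X) :=
  match c in hchain Y X return hchain (Phi Y) (Phi X) with
  | hnil X => hnil (Phi X)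
  | hcons _ _ _ f c' => hcons (hmap f) (cmap c')
  end.

(* [c|f] |-> [Phi c|Phi f] on C(C), respectively on Hom complexes of Tr(C). *)
Definition is_cyclic_bar_map (u : cyclic_bar C -> cyclic_bar D) : Prop :=
  is_cplx_map u
  /\ forall Y Y' (c : hchain Y Y') (f : dghom Y Y'),
       u (cyc_elt (M := diag_bimod C) c f)
       = cyc_elt (M := diag_bimod D) (cmap c) (sf1 Phi f).

Definition is_tr_map
    (v : forall X X', trhom X X' -> trhom (Phi X) (Phi X')) : Prop :=
  (forall X X', is_cplx_map (v X X'))
  /\ forall X X' Y Y' (c : hchain Y Y') (f : dghom (X ⋆ Y) (Y' ⋆ X')),
       v X X' (trelt c f)
       = trelt (cmap c) (castH (sf_tob Phi X Y) (sf_tob Phi Y' X') (sf1 Phi f)).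

End Naturality.

(* Naturality in C, with respect to strictly monoidal dg functors, of the
   functor C -> Tr(C) and of theta. *)
Definition is_natural (k : comPzRingType)
    (theta : forall C : smdgcat k,
       HH C -> coh (@dghom k (Tr C) (tone C) (tone C))) : Prop :=
  forall (C D : smdgcat k) (Phi : smfunctor C D),
  exists (u : cyclic_bar C -> cyclic_bar D)
         (v : forall X X', trhom X X' -> trhom (Phi X) (Phi X')),
    [/\ is_cyclic_bar_map Phi u,
        is_tr_map v,
        forall X X' (f : dghom X X'), v X X' (trmor f) = trmor (sf1 Phi f)
      & forall (z : cyclic_bar C) (z' : @dghom k (Tr C) (tone C) (tone C)),
          cdiff z = 0 -> cdiff z' = 0 ->
          theta C (coh_cls z) = coh_cls z' ->
          theta D (coh_cls (u z))
          = coh_cls (@castH k (Tr D) _ _ _ _ (sf_tone Phi) (sf_tone Phi)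
                       (v _ _ z'))].

(* Main.v *)
Require Import Defs.
From mathcomp Require Import all_boot all_order all_algebra.
From mathcomp Require Import boolp.
From Stdlib Require Import ClassicalEpsilon Eqdep.
From mathcomp Require Import zify ring.

Set Implicit Arguments.
Unset Strict Implicit.
Unset Printing Implicit Defensive.

Import GRing.Theory.
Local Open Scope ring_scope.

(** The Hom complexes of Tr(C) and the cyclic bar complex are all of the form
    C(C, M) for a bimodule M, so one analysis of C(C, M) serves both.

    Balancing and the graded commutator relation move the outer entries of a
    symbol [f_0|c|f_1] (x) m into m, at the cost of a Koszul sign.  Hence the
    symbols [c|m] generate C(C, M) ([cyc_ind]), and a map out of it may be
    prescribed freely on them as long as it is linear in every slot
    ([cyc_rec]).  After each bar entry is suspended separately, the differential
    has only Koszul signs ([cdiff_scyc]): it is the sum of the internal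
    differential, the inner faces, the face that acts on m by the first entry
    and the face that acts on m by the last one.

    Composition in Tr(C) is the shuffle product of strings together with the
    gluing (f, g) |-> (Id * f)(g * Id) of the module entries.  The Leibniz rule
    ([trcomp_diff]) splits accordingly.  The shuffle product is a chain map for
    the internal differential ([shuffle_sdint]) and for the inner faces
    ([shuffle_sfaces]): the faces that multiply an entry d * Id by an entry
    Id * c occur in pairs, which cancel by the interchange law.  The first and
    the last entry of a shuffle come from one of the two strings
    ([shuffle_head], [shuffle_last]), and gluing turns their action into an
    action on f or on g.  Shuffles and gluing are strictly associative and unital
    ([shuffle_assoc], [trglue_assoc]), and therefore so is composition.

    The morphism Tr(X * Y) -> Tr(Y * X) is represented by an identity of C with
    r = 0, so it is natural in Y on the nose.  Its coherent naturality in X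
    comes from the map b |-> b (x) Id_(X * Y * X') out of the bar complex, which
    makes sense because X12(Y * X', X * Y) contains this identity as an element
    from X' to X ([coherence]).

    Finally X12(1, 1) is the diagonal bimodule up to the strict unit laws, so
    C(C) and End(Tr(1)) are isomorphic complexes ([cyc_to_tr]).  Gluing
    corresponds to (f, g) |-> (-1)^(|f||g|) g * f, which is the product of C(C);
    thus C(C) is a dg algebra because End(Tr(1)) is one, and the isomorphism
    already holds before passing to cohomology.  All these maps are given by the
    same formula on symbols, whence naturality.

    The associators of a strictly monoidal category are equalities of objects.
    Morphisms and strings between propositionally equal objects are compared in
    the total space of the corresponding family ([tot]), where casts
    disappear. *)

(** * Signs *)

Definition oddz (n : int) : bool := odd `|n|%N.

Lemma oddzD m n : oddz (m + n) = oddz m (+) oddz n.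
Proof. rewrite /oddz; lia. Qed.

Lemma oddzN m : oddz (- m) = oddz m.
Proof. by rewrite /oddz abszN. Qed.

Lemma oddzM m n : oddz (m * n) = oddz m && oddz n.
Proof. by rewrite /oddz abszM oddM. Qed.

Lemma oddzS (n : nat) : oddz ((n.+1)%:Z) = ~~ oddz n%:Z.
Proof. by []. Qed.
Lemma oddz0 : oddz 0 = false. Proof. by []. Qed.
Lemma oddz1 : oddz 1 = true. Proof. by []. Qed.
Lemma oddz2 : oddz 2 = false. Proof. by []. Qed.

Definition oddE := (oddzD, oddzN, oddzM, oddzS, oddz0, oddz1, oddz2).

Section Signs.
Variable k : comPzRingType.
Lemma sgn_eq m n : oddz m = oddz n -> sgn k m = sgn k n.
Proof. by move=> e; rewrite /sgn -signr_odd -[RHS]signr_odd -/(oddz m) e. Qed.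

Lemma sgnD m n : sgn k (m + n) = sgn k m * sgn k n.
Proof.
rewrite /sgn -signr_odd -/(oddz _) oddzD signr_addb /oddz !signr_odd //.
Qed.

Lemma sgn0 : sgn k 0 = 1. Proof. by []. Qed.
Lemma sgn1 : sgn k 1 = -1. Proof. by rewrite /sgn expr1. Qed.

Lemma sgnS m : sgn k (m + 1) = - sgn k m.
Proof. by rewrite sgnD sgn1 mulrN1. Qed.

Lemma scaleN_sgn (V : lmodType k) (x : V) : - x = sgn k 1 *: x.
Proof. by rewrite sgn1 scaleN1r. Qed.

Lemma sgn_sgn (V : lmodType k) m n (x : V) :
  sgn k m *: (sgn k n *: x) = sgn k (m + n) *: x.
Proof. by rewrite scalerA sgnD. Qed.

Lemma sgn_scaleC (V : lmodType k) m a (x : V) :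
  a *: (sgn k m *: x) = sgn k m *: (a *: x).
Proof. by rewrite !scalerA mulrC. Qed.

Lemma sgn_move (V : lmodType k) m n (x y : V) :
  sgn k m *: x = sgn k n *: y -> x = sgn k (m + n) *: y.
Proof.
move=> e; rewrite -sgn_sgn -e sgn_sgn (@sgn_eq (m + m) 0) ?sgn0 ?scale1r //.
by rewrite oddzD addbb.
Qed.

End Signs.

(** An identity between signs is a boolean tautology in the parities of the
    degrees involved. *)
Ltac parity := apply: sgn_eq; rewrite /= ?oddE /=;
  repeat match goal with |- context [oddz ?n] =>
    let b := fresh in set b := oddz n; clearbody b end;
  repeat match goal with |- context [?b] => is_var b;
    match type of b with bool => destruct b end end; reflexivity.

Section Peel.
Variables (k : comPzRingType) (V : lmodType k).
Lemma sgn_peel m n (x y z : V) : sgn k m = sgn k n -> y = z ->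
  sgn k m *: x + y = sgn k n *: x + z.
Proof. by move=> -> ->. Qed.

Lemma sgn_peel1 m n (x : V) : sgn k m = sgn k n -> sgn k m *: x = sgn k n *: x.
Proof. by move=> ->. Qed.
Lemma sgn_wrap (x y : V) : sgn k 0 *: x = sgn k 0 *: y -> x = y.
Proof. by rewrite sgn0 !scale1r. Qed.

Lemma sgn_pair m (x : V) : 0 = sgn k m *: x + sgn k (m + 1) *: x.
Proof. by rewrite sgnS scaleNr subrr. Qed.
End Peel.

(** [sgn_match] proves an equality between two sums of signed terms that agree up
    to order: it gives every term an explicit sign, abstracts the terms, and
    rotates the right-hand side until the leading terms agree. *)
Ltac sgn_atoms :=
  repeat match goal with |- context [sgn _ _ *: ?x] =>
    lazymatch x with
    | sgn _ _ *: _ => fail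
    | _ => tryif is_var x then fail else (let v := fresh "v" in set v := x; clearbody v)
    end
  end.

Ltac sgn_terms := rewrite ?scalerDr ?scalerN ?scaleNr ?opprD ?opprK
  ?scaleN_sgn ?scalerDr ?sgn_sgn ?scaler0 ?addr0 ?add0r.

Ltac sgn_match_step :=
  match goal with
  | |- sgn _ _ *: ?x + _ = sgn _ _ *: ?x + _ => apply: sgn_peel; [by parity|]
  | |- sgn _ _ *: ?x = sgn _ _ *: ?x => apply: sgn_peel1; by parity
  | |- _ = _ => rewrite [RHS]addrC -?addrA
  end.

Ltac sgn_match := rewrite ?add0r ?addr0; apply: sgn_wrap; sgn_terms; sgn_atoms; rewrite -?addrA; do 60? sgn_match_step.

(** * Linear maps and presented modules *)

Definition linear_map (k : pzRingType) (U V : lmodType k) (F : U -> V) : Prop :=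
  forall a x y, F (a *: x + y) = a *: F x + F y.

Section LinearMaps.
Variables (k : pzRingType) (U V : lmodType k) (F : U -> V).
Hypothesis HF : linear_map F.

Lemma lin0 : F 0 = 0.
Proof. by have := HF (-1) 0 0; rewrite scaler0 addr0 scaleN1r addNr. Qed.
Lemma linZ a x : F (a *: x) = a *: F x.
Proof. by rewrite -[a *: x]addr0 HF lin0 addr0. Qed.
Lemma linD x y : F (x + y) = F x + F y.
Proof. by rewrite -[x in LHS]scale1r HF scale1r. Qed.
Lemma linN x : F (- x) = - F x.
Proof. by rewrite -scaleN1r linZ scaleN1r. Qed.
Lemma lin_sum I (s : seq I) (w : I -> U) :
  F (\sum_(i <- s) w i) = \sum_(i <- s) F (w i).
Proof. exact: (big_morph F linD lin0). Qed.
End LinearMaps.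

Section Spans.
Variable k : comPzRingType.

Lemma lspan_gen (V : lmodType k) (W : V -> Prop) x : W x -> lspan W x.
Proof. by move=> Wx; have := spanS 1 Wx (span0 W); rewrite addr0 scale1r. Qed.

Lemma lspanL (V : lmodType k) (W : V -> Prop) a x y :
  lspan W x -> lspan W y -> lspan W (a *: x + y).
Proof.
elim=> [|b u v Wu _ IH] Wy; first by rewrite scaler0 add0r.
by rewrite scalerDr scalerA -addrA; apply: spanS => //; exact: IH.
Qed.

Lemma lspan_map (V V' : lmodType k) (W : V -> Prop) (W' : V' -> Prop)
    (F : V -> V') : linear_map F -> (forall x, W x -> lspan W' (F x)) ->
  forall x, lspan W x -> lspan W' (F x).
Proof.
move=> HF H x; elim=> [|a u v Wu _ IH]; first by rewrite (lin0 HF); exact: span0.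
by rewrite HF; apply: lspanL; [exact: H|].
Qed.

End Spans.

Section PresentedFacts.
Variables (k : pzRingType) (S : Type) (R : seq (k * S) -> Prop).

Lemma pgen_kills : kills R (pgen R).
Proof.
move=> r Rr.
have E l : lincomb (pgen R) l = pcls R l.
  rewrite /lincomb; elim: l => [|[a s] l IH]; first by rewrite big_nil.
  rewrite big_cons IH /=; apply: pext => V F HF.
  rewrite paddE // pscaleE // !prepr_cls // /lincomb big_seq1 big_cons.
  by rewrite scale1r.
rewrite E; apply: pcls_eq => V F HF.
by rewrite HF // /lincomb big_nil.
Qed.

Lemma presented_ind (P : presented R -> Prop) :
  P 0 -> (forall a x y, P x -> P y -> P (a *: x + y)) ->
  (forall s, P (pgen R s)) -> forall x, P x.
Proof.
move=> P0 PL Pg x.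
have -> : x = lincomb (pgen R) (prepr x).
  apply: pext => V F HF.
  have HL := plift_linear HF.
  rewrite -[RHS]/(plift F _) /lincomb (lin_sum HL).
  by apply: eq_bigr => i _; rewrite (linZ HL) plift_gen.
rewrite /lincomb; elim: (prepr x) => [|z l IH]; first by rewrite big_nil.
by rewrite big_cons; apply: PL.
Qed.

End PresentedFacts.

(** * Homogeneous components *)

Section Components.
Variables (k : comPzRingType) (A : cplx k).
Hypothesis HA : is_complex A.

Lemma cdiff_lin : linear_map (@cdiff k A). Proof. exact: (cx_diffL HA). Qed.

Lemma hdegZ n a (x : A) : hdeg n x -> hdeg n (a *: x).
Proof. by move=> h; rewrite -[_ *: _]addr0; apply: (cx_hdegL HA) => //; exact: (cx_hdeg0 HA). Qed.

Lemma hdegD n (x y : A) : hdeg n x -> hdeg n y -> hdeg n (x + y).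
Proof. by move=> h h'; rewrite -[x]scale1r; exact: (cx_hdegL HA). Qed.

Lemma hdegB n (x y : A) : hdeg n x -> hdeg n y -> hdeg n (x - y).
Proof. by move=> h h'; apply: hdegD => //; rewrite -scaleN1r; exact: hdegZ. Qed.

(** Only [w] is determined by [x] ([decomposes_uniq]); the finite list [s] may be
    enlarged freely, which is how two decompositions are compared. *)
Definition decomposes (x : A) (s : seq int) (w : int -> A) : Prop :=
  [/\ uniq s, forall n, hdeg n (w n), forall n, n \notin s -> w n = 0
    & x = \sum_(n <- s) w n].

Lemma sum_widen (s s' : seq int) (w : int -> A) :
  uniq s -> uniq s' -> {subset s <= s'} -> (forall n, n \notin s -> w n = 0) ->
  \sum_(n <- s) w n = \sum_(n <- s') w n.
Proof.
move=> us us' ss' w0.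
rewrite [RHS](bigID (mem s)) /= [X in _ + X]big1 ?addr0; last first.
  by move=> n; exact: w0.
rewrite -[RHS]big_filter; apply: perm_big; apply: uniq_perm => //.
  by rewrite filter_uniq.
by move=> n; rewrite mem_filter andb_idr //; exact: ss'.
Qed.

Lemma decomposes_widen x s s' w :
  decomposes x s w -> uniq s' -> {subset s <= s'} -> decomposes x s' w.
Proof.
move=> [us hw w0 ->] us' ss'; split=> //.
  by move=> n ns'; apply: w0; apply: contraNN ns' => /ss'.
exact: sum_widen.
Qed.

Lemma decomposesL a x y s s' w w' :
  decomposes x s w -> decomposes y s' w' ->
  decomposes (a *: x + y) (undup (s ++ s')) (fun n => a *: w n + w' n).
Proof.
move=> Hx Hy; pose t := undup (s ++ s').
have [|n sn|ut hw w0 ->] := @decomposes_widen _ _ t _ Hx.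
- exact: undup_uniq.
- by rewrite mem_undup mem_cat sn.
have [//|n sn|_ hw' w0' ->] := @decomposes_widen _ _ t _ Hy.
  by rewrite mem_undup mem_cat sn orbT.
split=> //.
- by move=> n; apply: (cx_hdegL HA).
- by move=> n nt; rewrite w0 // w0' // scaler0 addr0.
- by rewrite scaler_sumr -big_split.
Qed.

Lemma decomposes0 : decomposes 0 [::] (fun=> 0).
Proof. by split=> //; [move=> n; exact: (cx_hdeg0 HA)|rewrite big_nil]. Qed.

Lemma decomposes_hdeg n x :
  hdeg n x -> decomposes x [:: n] (fun m => if m == n then x else 0).
Proof.
move=> hx; split=> //.
- by move=> m; case: eqP => [->|_] //; exact: (cx_hdeg0 HA).
- by move=> m; rewrite inE => /negbTE ->.
- by rewrite big_seq1 eqxx.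
Qed.

Lemma decomposes_exists x : exists w s, decomposes x s w.
Proof.
have [s [w [hw ->]]] := cx_sum HA x.
elim: s => [|n s [w' [s' IH]]].
  by exists (fun=> 0), [::]; rewrite big_nil; exact: decomposes0.
rewrite big_cons -[w n]scale1r.
by eexists; eexists; exact: decomposesL (decomposes_hdeg (hw n)) IH.
Qed.

Lemma decomposes_uniq x s s' w w' :
  decomposes x s w -> decomposes x s' w' -> w =1 w'.
Proof.
move=> Hx Hy n; pose t := undup (n :: s ++ s').
have tn m : (m == n) || (m \in s) || (m \in s') -> m \in t.
  by rewrite mem_undup inE mem_cat orbA.
have ut : uniq t by exact: undup_uniq.
have [|_ hw w0 e1] := decomposes_widen Hx ut.
  by move=> m sm; apply: tn; rewrite sm orbT.
have [|_ hw' w0' e2] := decomposes_widen Hy ut.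
  by move=> m sm; apply: tn; rewrite sm orbT.
apply/eqP; rewrite -subr_eq0; apply/eqP.
apply: (cx_direct HA ut (w := fun m => w m - w' m)).
- by move=> m; exact: hdegB.
- by rewrite sumrB -e1 -e2 subrr.
- by apply: tn; rewrite eqxx.
Qed.

Definition component (n : int) (x : A) : A :=
  sval (constructive_indefinite_description _ (decomposes_exists x)) n.

Lemma componentP x : exists s, decomposes x s (component^~ x).
Proof. exact: svalP (constructive_indefinite_description _ (decomposes_exists x)). Qed.

Lemma component_eq x s w : decomposes x s w -> forall n, component n x = w n.
Proof. by move=> H n; have [s' H'] := componentP x; exact: decomposes_uniq H' H n. Qed.

Lemma component_lin n : linear_map (component n).
Proof.
move=> a x y; have [s Hx] := componentP x; have [s' Hy] := componentP y.
exact: component_eq (decomposesL a Hx Hy) n.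
Qed.

Lemma component_hdeg n x : hdeg n (component n x).
Proof. by have [s []] := componentP x. Qed.

Lemma component_homog m n x : hdeg n x ->
  component m x = if m == n then x else 0.
Proof. by move=> /decomposes_hdeg /component_eq ->. Qed.

Lemma homog_ind (P : A -> Prop) :
  P 0 -> (forall a x y, P x -> P y -> P (a *: x + y)) ->
  (forall n x, hdeg n x -> P x) -> forall x, P x.
Proof.
move=> P0 PL Ph x; have [s [w [hw ->]]] := cx_sum HA x.
elim: s => [|n s IH]; first by rewrite big_nil.
by rewrite big_cons -[w n]scale1r; apply: PL => //; exact: Ph (hw n).
Qed.

Lemma homog_ext (V : lmodType k) (F G : A -> V) :
  linear_map F -> linear_map G -> (forall n x, hdeg n x -> F x = G x) -> F =1 G.
Proof.
move=> HF HG H; apply: homog_ind => [|a x y Ex Ey|//].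
  by rewrite (lin0 HF) (lin0 HG).
by rewrite HF HG Ex Ey.
Qed.

(** The Koszul sign rule refers to the degree of its argument; [twist e] is the
    linear extension of x |-> (-1)^(e|x|) x to inhomogeneous elements, needed
    because maps out of C(C, M) have to be linear in all of M. *)
Definition twist (e : int) (x : A) : A :=
  \sum_(n <- sval (constructive_indefinite_description _ (componentP x)))
    sgn k (e * n) *: component n x.

Lemma twist_eq e x s w : decomposes x s w ->
  twist e x = \sum_(n <- s) sgn k (e * n) *: w n.
Proof.
move=> H; rewrite /twist.
case: (constructive_indefinite_description _ _) => s' H' /=.
have E := decomposes_uniq H H'.
pose t := undup (s ++ s').
transitivity (\sum_(n <- t) sgn k (e * n) *: w n).
  rewrite (@sum_widen s' t).
  - by apply: eq_bigr => n _; rewrite E.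
  - by case: H'.
  - exact: undup_uniq.
  - by move=> n sn; rewrite mem_undup mem_cat sn orbT.
  - by move=> n; case: H' => _ _ w0 _ /w0 ->; rewrite scaler0.
symmetry; apply: sum_widen.
- by case: H.
- exact: undup_uniq.
- by move=> n sn; rewrite mem_undup mem_cat sn.
- by move=> n; case: H => _ _ w0 _ /w0 ->; rewrite scaler0.
Qed.

Lemma twist_lin e : linear_map (twist e).
Proof.
move=> a x y; have [s Hx] := componentP x; have [s' Hy] := componentP y.
have sub1 : {subset s <= undup (s ++ s')}.
  by move=> n sn; rewrite mem_undup mem_cat sn.
have sub2 : {subset s' <= undup (s ++ s')}.
  by move=> n sn; rewrite mem_undup mem_cat sn orbT.
rewrite (twist_eq e (decomposesL a Hx Hy)).
rewrite (twist_eq e (decomposes_widen Hx (undup_uniq _) sub1)).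
rewrite (twist_eq e (decomposes_widen Hy (undup_uniq _) sub2)).
rewrite scaler_sumr -big_split; apply: eq_bigr => n _ /=.
by rewrite scalerDr !scalerA mulrC.
Qed.

Lemma twist_homog e n x : hdeg n x -> twist e x = sgn k (e * n) *: x.
Proof. by move=> /decomposes_hdeg /(twist_eq e) ->; rewrite big_seq1 eqxx. Qed.

End Components.

(** * Calculus of chains *)

Lemma helt_eq (k : comPzRingType) (A : cplx k) (f g : helt A) :
  hval f = hval g -> hdg f = hdg g -> f = g.
Proof.
case: f g => [x p hx] [y q hy] /= exy epq.
by subst y q; rewrite (Prop_irrelevance hx hy).
Qed.

Section Chains.
Variables (k : comPzRingType) (C : dgcat k).
Local Notation hc := (hchain (C := C)).
Local Notation hh X Y := (helt (@dghom k C X Y)).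

Definition multilinear (V : lmodType k) Y X (K : hc Y X -> V) : Prop :=
  forall a c c1 c2, chain_lin a c c1 c2 -> K c = a *: K c1 + K c2.

Lemma multilinear_cons (V : lmodType k) Y Z X (f : hh Z Y) (K : hc Y X -> V) :
  multilinear K -> multilinear (fun c : hc Z X => K (hcons f c)).
Proof. by move=> HK a c c1 c2 H; apply: HK; constructor. Qed.

Section Head.
Variables (V : lmodType k) (Y Z X : ob C) (K : hc Y X -> V).
Hypothesis HK : multilinear K.

Lemma head_lin a (f f1 f2 : hh Z Y) (c : hc Z X) :
  hdg f1 = hdg f -> hdg f2 = hdg f -> hval f = a *: hval f1 + hval f2 ->
  K (hcons f c) = a *: K (hcons f1 c) + K (hcons f2 c).
Proof. by move=> *; apply: HK; constructor. Qed.

Lemma head_zero (f : hh Z Y) (c : hc Z X) : hval f = 0 -> K (hcons f c) = 0.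
Proof.
move=> f0; rewrite (@head_lin (-1) f f f) ?f0 ?scaler0 ?addr0 //.
by rewrite scaleN1r addNr.
Qed.

Lemma head_scale a (f g : hh Z Y) (c : hc Z X) :
  hdg f = hdg g -> hval f = a *: hval g -> K (hcons f c) = a *: K (hcons g c).
Proof.
move=> e ef; pose z := Helt (cx_hdeg0 (dg_cplx (dgP C) Z Y) (hdg f)).
by rewrite (@head_lin a f g z) ?ef ?addr0 // [K (hcons z c)]head_zero // addr0.
Qed.
End Head.

(** Strings are built from the left, whereas the last entry of a bar symbol is
    the one that acts on the module; this view peels it off. *)
Inductive snoc_view : forall Y X, hc Y X -> Prop :=
| view_nil X : snoc_view (hnil X)
| view_snoc Y Z X (c : hc Y Z) (f : hh X Z) : snoc_view (crcons c f).

Lemma snocP Y X (c : hc Y X) : snoc_view c.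
Proof.
elim: c => [{Y}X|{}Y Z {}X f c IH]; first exact: view_nil.
case: IH f => [X' f|Y' Z' X' c' g f].
  exact: (view_snoc (hnil Y) f).
exact: (view_snoc (hcons f c') g).
Qed.

Fixpoint last_elim (V : Type) (v0 : V) Y X (c : hc Y X) :
    (forall Z, hc Y Z -> hh X Z -> V) -> V :=
  match c in hchain Y X return (forall Z, hc Y Z -> hh X Z -> V) -> V with
  | hnil _ => fun _ => v0
  | hcons Y Z X f c' => fun L =>
      match c' in hchain Z X
        return hh Z Y -> (forall Z, hc Y Z -> hh X Z -> V) -> V -> V
      with
      | hnil Z => fun f L _ => L Y (hnil Y) f
      | hcons _ _ _ _ _ => fun _ _ v => v
      end f L (last_elim v0 c' (fun Z0 c0 g => L Z0 (hcons f c0) g))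
  end.

Lemma last_elim_snoc V v0 Y X Z (c : hc Y Z) (g : hh X Z)
    (L : forall Z, hc Y Z -> hh X Z -> V) :
  last_elim v0 (crcons c g) L = L Z c g.
Proof.
elim: c X g L => [//|{}Y Z' {}Z f c IH] X g L.
rewrite -[RHS](IH X g (fun Z c g => L Z (hcons f c) g)) /=.
by case: c {IH} f g.
Qed.

Lemma cract_snoc Y X Z X' (c : hc Y Z) (f : hh X Z) (g : hh X' X) :
  cract (crcons c f) g = crcons c (hcomp f g).
Proof.
elim: c X f X' g => [//|{}Y Z' {}Z h c IH] X f X' g /=.
by rewrite -(IH X f X' g); case: c {IH} h f g.
Qed.

Lemma csize_snoc Y X Z (c : hc Y Z) (f : hh X Z) :
  csize (crcons c f) = (csize c).+1.
Proof. by elim: c X f => [//|{}Y Z' {}Z h c IH] X f /=; rewrite IH. Qed.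

Lemma cdeg_snoc Y X Z (c : hc Y Z) (f : hh X Z) :
  cdeg (crcons c f) = cdeg c + hdg f.
Proof.
elim: c X f => [X'|{}Y Z' {}Z h c IH] X f /=; first by rewrite addr0 add0r.
by rewrite IH addrA.
Qed.

(** ** The internal differential and the faces *)

Lemma dint_congr (V : lmodType k) Y X (c : hc Y X) (K K' : hc Y X -> V) :
  (forall c', csize c' = csize c -> cdeg c' = cdeg c + 1 -> K c' = K' c') ->
  dint c K = dint c K'.
Proof.
elim: c K K' => [//|{}Y Z {}X f c IH] K K' H /=.
rewrite H //=; last by rewrite -addrA [1 + _]addrC addrA.
by congr (_ + _ *: _); apply: IH => c' es ed; apply: H; rewrite /= ?es ?ed ?addrA.
Qed.

Lemma merge_congr (V : lmodType k) Y Z X (f : hh Z Y) (c : hc Z X)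
    (K K' : hc Y X -> V) :
  (forall c', csize c' = csize c -> cdeg c' = hdg f + cdeg c -> K c' = K' c') ->
  merge_head f c K = merge_head f c K'.
Proof. by case: c f K K' => [//|{}Z Z' {}X g c] f K K' H /=; rewrite H //= addrA. Qed.

Lemma faces_congr (V : lmodType k) Y X (c : hc Y X) (K K' : hc Y X -> V) :
  (forall c', (csize c').+1 = csize c -> cdeg c' = cdeg c -> K c' = K' c') ->
  faces c K = faces c K'.
Proof.
elim: c K K' => [//|{}Y Z {}X f c IH] K K' H /=; congr (_ - _).
  by apply: merge_congr => c' es ed; apply: H; rewrite /= ?es.
by apply: IH => c' es ed; apply: H; rewrite /= ?es ?ed.
Qed.

Lemma dint_linK (V : lmodType k) Y X (c : hc Y X) a (K K' : hc Y X -> V) :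
  dint c (fun c' => a *: K c' + K' c') = a *: dint c K + dint c K'.
Proof.
elim: c K K' => [|{}Y Z {}X f c IH] K K' /=; first by rewrite scaler0 addr0.
by rewrite IH !scalerDr !scalerA [_ * a]mulrC addrACA.
Qed.

Lemma merge_linK (V : lmodType k) Y Z X (f : hh Z Y) (c : hc Z X) a
    (K K' : hc Y X -> V) :
  merge_head f c (fun c' => a *: K c' + K' c')
  = a *: merge_head f c K + merge_head f c K'.
Proof. by case: c f K K' => [//|{}Z Z' {}X g c] f K K' /=; rewrite ?scaler0 ?addr0. Qed.

Lemma faces_linK (V : lmodType k) Y X (c : hc Y X) a (K K' : hc Y X -> V) :
  faces c (fun c' => a *: K c' + K' c') = a *: faces c K + faces c K'.
Proof.
elim: c K K' => [|{}Y Z {}X f c IH] K K' /=; first by rewrite scaler0 addr0.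
by rewrite IH merge_linK scalerBr opprD addrACA.
Qed.

Lemma dint0 (V : lmodType k) Y X (c : hc Y X) : dint c (fun=> 0 : V) = 0.
Proof. by elim: c => //= {}Y Z {}X f c ->; rewrite scaler0 addr0. Qed.

Lemma merge0 (V : lmodType k) Y Z X (f : hh Z Y) (c : hc Z X) :
  merge_head f c (fun=> 0 : V) = 0.
Proof. by case: c f. Qed.

Lemma faces0 (V : lmodType k) Y X (c : hc Y X) : faces c (fun=> 0 : V) = 0.
Proof. by elim: c => //= {}Y Z {}X f c ->; rewrite merge0 subr0. Qed.

Lemma dintZ (V : lmodType k) Y X (c : hc Y X) a (K : hc Y X -> V) :
  dint c (fun c' => a *: K c') = a *: dint c K.
Proof.
rewrite -[RHS]addr0 -(dint0 V c) -dint_linK.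
by apply: dint_congr => *; rewrite addr0.
Qed.

Lemma mergeZ (V : lmodType k) Y Z X (f : hh Z Y) (c : hc Z X) a
    (K : hc Y X -> V) :
  merge_head f c (fun c' => a *: K c') = a *: merge_head f c K.
Proof. by case: c f K => [//|{}Z Z' {}X g c] f K //=; rewrite scaler0. Qed.

Lemma facesZ (V : lmodType k) Y X (c : hc Y X) a (K : hc Y X -> V) :
  faces c (fun c' => a *: K c') = a *: faces c K.
Proof.
rewrite -[RHS]addr0 -(faces0 V c) -faces_linK.
by apply: faces_congr => *; rewrite addr0.
Qed.

Lemma dintD (V : lmodType k) Y X (c : hc Y X) (K K' : hc Y X -> V) :
  dint c (fun c' => K c' + K' c') = dint c K + dint c K'.
Proof.
rewrite -[X in X + _]scale1r -dint_linK.
by apply: dint_congr => *; rewrite scale1r.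
Qed.

Lemma mergeD (V : lmodType k) Y Z X (f : hh Z Y) (c : hc Z X)
    (K K' : hc Y X -> V) :
  merge_head f c (fun c' => K c' + K' c') = merge_head f c K + merge_head f c K'.
Proof. by case: c f K K' => [//|{}Z Z' {}X g c] f K K' //=; rewrite addr0. Qed.

Lemma facesD (V : lmodType k) Y X (c : hc Y X) (K K' : hc Y X -> V) :
  faces c (fun c' => K c' + K' c') = faces c K + faces c K'.
Proof.
rewrite -[X in X + _]scale1r -faces_linK.
by apply: faces_congr => *; rewrite scale1r.
Qed.

Lemma dint_map (V W : lmodType k) (F : V -> W) : linear_map F ->
  forall Y X (c : hc Y X) K, F (dint c K) = dint c (fun c' => F (K c')).
Proof.
move=> HF Y X c; elim: c => [?|{}Y Z {}X f c IH] K /=; first exact: (lin0 HF).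
by rewrite (linD HF) (linZ HF) IH.
Qed.

Lemma faces_map (V W : lmodType k) (F : V -> W) : linear_map F ->
  forall Y X (c : hc Y X) K, F (faces c K) = faces c (fun c' => F (K c')).
Proof.
move=> HF Y X c; elim: c => [?|{}Y Z {}X f c IH] K /=; first exact: (lin0 HF).
rewrite (linD HF) (linN HF) IH; congr (_ - _).
by case: c f K {IH} => [W' f K|{}Z Z' {}X g c f K] //=; exact: (lin0 HF).
Qed.

Lemma dint_mem (V : lmodType k) (P : V -> Prop) Y X (c : hc Y X)
    (K : hc Y X -> V) :
  P 0 -> (forall a x y, P x -> P y -> P (a *: x + y)) ->
  (forall c', csize c' = csize c -> cdeg c' = cdeg c + 1 -> P (K c')) ->
  P (dint c K).
Proof.
move=> P0 PL; elim: c K => [//|{}Y Z {}X f c IH] K H /=.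
rewrite addrC; apply: PL.
  by apply: IH => c' es ed; apply: H; rewrite /= ?es ?ed ?addrA.
by apply: H; rewrite //= -addrA [1 + _]addrC addrA.
Qed.

Lemma faces_mem (V : lmodType k) (P : V -> Prop) Y X (c : hc Y X)
    (K : hc Y X -> V) :
  P 0 -> (forall a x y, P x -> P y -> P (a *: x + y)) ->
  (forall c', (csize c').+1 = csize c -> cdeg c' = cdeg c -> P (K c')) ->
  P (faces c K).
Proof.
move=> P0 PL; elim: c K => [//|{}Y Z {}X f c IH] K H /=.
rewrite addrC -scaleN1r; apply: PL.
  by apply: IH => c' es ed; apply: H; rewrite /= ?es ?ed ?addrA.
case: c f K H {IH} => [//|{}Z Z' {}X g c] f K H /=; apply: H => //=.
by rewrite addrA.
Qed.

Lemma hdiff_lin X Y a (f f1 f2 : hh X Y) :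
  hval f = a *: hval f1 + hval f2 ->
  hval (hdiff f) = a *: hval (hdiff f1) + hval (hdiff f2).
Proof. by move=> /= ->; rewrite (cx_diffL (dg_cplx (dgP C) X Y)). Qed.

Lemma chain_lin_shape a Y X (c c1 c2 : hc Y X) : chain_lin a c c1 c2 ->
  [/\ csize c1 = csize c, csize c2 = csize c, cdeg c1 = cdeg c
    & cdeg c2 = cdeg c].
Proof.
elim=> [Y1 Z X1 f f1 f2 d e1 e2 _|Y1 Z X1 f d d1 d2 _ [e1 e2 e3 e4]] /=.
  by rewrite e1 e2.
by rewrite e1 e2 e3 e4.
Qed.

Lemma dint_multilinear (V : lmodType k) Y X (K : hc Y X -> V) :
  multilinear K -> multilinear (fun c => dint c K).
Proof.
move=> HK a c c1 c2 H; elim: H K HK.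
  move=> Y1 Z X1 f f1 f2 {}c e1 e2 ef K HK /=.
  rewrite (@head_lin _ _ _ _ _ HK a (hdiff f) (hdiff f1) (hdiff f2)) /= ?e1 ?e2 //;
    last exact: hdiff_lin.
  have -> : dint c (fun c' => K (hcons f c')) =
     dint c (fun c' => a *: K (hcons f1 c') + K (hcons f2 c')).
    by apply: dint_congr => c' _ _; exact: head_lin.
  by rewrite dint_linK !scalerDr !scalerA [_ * a]mulrC addrACA.
move=> Y1 Z X1 f {}c {}c1 {}c2 H IH K HK /=.
rewrite (HK a (hcons (hdiff f) c) (hcons (hdiff f) c1) (hcons (hdiff f) c2));
  last by constructor.
rewrite (IH _ (multilinear_cons f HK)).
by rewrite !scalerDr !scalerA [_ * a]mulrC addrACA.
Qed.

Lemma faces_multilinear (V : lmodType k) Y X (K : hc Y X -> V) :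
  multilinear K -> multilinear (fun c => faces c K).
Proof.
have P := dgP C.
move=> HK a c c1 c2 H; elim: H K HK.
  move=> Y1 Z X1 f f1 f2 {}c e1 e2 ef K HK /=.
  have -> : faces c (fun c' => K (hcons f c')) =
     faces c (fun c' => a *: K (hcons f1 c') + K (hcons f2 c')).
    by apply: faces_congr => c' _ _; exact: head_lin.
  rewrite faces_linK scalerBr opprD addrACA; congr (_ + _).
  case: c f f1 f2 e1 e2 ef K HK => [W|Z1 Z2 X2 g c] f f1 f2 e1 e2 ef K HK /=.
    by rewrite scaler0 addr0.
  apply: (head_lin HK); rewrite /= ?e1 ?e2 //.
  by rewrite ef (dg_compLl P).
move=> Y1 Z X1 f {}c {}c1 {}c2 H IH K HK /=.
rewrite (IH _ (multilinear_cons f HK)).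
rewrite scalerBr opprD addrACA; congr (_ + _).
case: H f K HK {IH}.
  move=> Z1 Z2 X2 g g1 g2 d e1 e2 eg f K HK /=.
  apply: (head_lin HK); rewrite /= ?e1 ?e2 //.
  by rewrite eg (dg_compLr P).
move=> Z1 Z2 X2 g d d1 d2 H f K HK /=.
by apply: HK; constructor.
Qed.

(** The internal differential and the faces, applied to all multilinear
    functions of a string, satisfy the identities of a double complex. *)
Lemma dint_dint (V : lmodType k) Y X (c : hc Y X) (K : hc Y X -> V) :
  multilinear K -> dint c (fun c' => dint c' K) = 0.
Proof.
elim: c K => [//|{}Y Z {}X f c IH] K HK /=.
rewrite (head_zero HK) ?add0r; last first.
  by rewrite /= (cx_diffK (dg_cplx (dgP C) Z Y)).
rewrite dintD dintZ (IH _ (multilinear_cons f HK)) scaler0 addr0.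
by rewrite sgnD sgn1 mulrN1 scaleNr addNr.
Qed.

Lemma hcompA W X Y Z (f : hh Y Z) (g : hh X Y) (h : hh W X) :
  hcomp f (hcomp g h) = hcomp (hcomp f g) h.
Proof. by apply: helt_eq; rewrite /= ?addrA // (dg_compA (dgP C)). Qed.

Lemma faces_faces (V : lmodType k) Y X (c : hc Y X) (K : hc Y X -> V) :
  faces c (fun c' => faces c' K) = 0.
Proof.
elim: c K => [//|{}Y Z {}X f c IH] K /=.
have -> : faces c (fun c' => merge_head f c' K - faces c' (fun c'' => K (hcons f c'')))
    = faces c (fun c' => merge_head f c' K).
  have := faces_linK c (-1) (fun c' => faces c' (fun c'' => K (hcons f c'')))
    (fun c' => merge_head f c' K).
  rewrite IH scaler0 add0r => <-.
  by apply: faces_congr => *; rewrite scaleN1r addrC.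
case: c f K {IH} => [W|{}Z Z' {}X g c] f K /=; first by rewrite subr0.
rewrite opprB addrA subrK.
case: c f g K => [W|{}Z' Z'' {}X h c] f g K /=; first by rewrite subr0.
by rewrite hcompA subrr.
Qed.

Lemma merge_dint (V : lmodType k) Y Z X (f : hh Z Y) (c : hc Z X)
    (K : hc Y X -> V) : multilinear K ->
  merge_head f c (fun c' => dint c' K)
  = merge_head (hdiff f) c K
    + sgn k (hdg f) *: dint c (fun c' => merge_head f c' K).
Proof.
case: c f K => [W|{}Z Z' {}X g c] f K HK /=; first by rewrite scaler0 addr0.
rewrite scalerDr scalerA -sgnD addrA; congr (_ + _).
have e : hdg f + hdg (hdiff g) = hdg f + hdg g + 1 by rewrite /= addrA.
have e' : hdg (hdiff f) + hdg g = hdg f + hdg g + 1 by rewrite /= addrAC.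
rewrite addrC.
apply: (head_lin HK); rewrite //=.
by rewrite (dg_comp_diff (dgP C) _ (hvalP f)) addrC.
Qed.

Lemma dint_faces (V : lmodType k) Y X (c : hc Y X) (K : hc Y X -> V) :
  multilinear K ->
  dint c (fun c' => faces c' K) = faces c (fun c' => dint c' K).
Proof.
elim: c K => [//|{}Y Z {}X f c IH] K HK /=.
rewrite merge_dint //.
have -> : dint c (fun c' => merge_head f c' K - faces c' (fun c'' => K (hcons f c'')))
  = dint c (fun c' => merge_head f c' K)
    - dint c (fun c' => faces c' (fun c'' => K (hcons f c''))).
  rewrite -[X in _ - X]scale1r -scaleNr addrC -dint_linK.
  by apply: dint_congr => *; rewrite scaleN1r addrC.
rewrite (IH _ (multilinear_cons f HK)) facesD facesZ.
by rewrite scalerBr opprD !addrA; congr (_ - _); rewrite addrAC.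
Qed.

Lemma dint_snoc (V : lmodType k) Y Z X (c : hc Y Z) (g : hh X Z)
    (K : hc Y X -> V) :
  dint (crcons c g) K
  = dint c (fun c' => K (crcons c' g)) + sgn k (cdeg c) *: K (crcons c (hdiff g)).
Proof.
elim: c X g K => [W|{}Y Z' {}Z f c IH] X g K /=.
  by rewrite sgn0 scale1r scaler0 addr0 add0r.
by rewrite IH scalerDr scalerA -sgnD addrA.
Qed.

Lemma faces_cons (V : lmodType k) Y Z X (f : hh Z Y) (c : hc Z X)
    (K : hc Y X -> V) :
  faces (hcons f c) K = merge_head f c K - faces c (fun c' => K (hcons f c')).
Proof. by []. Qed.

(** Appending an entry adds one face, which merges it with the former last
    entry. *)
Lemma faces_snoc (V : lmodType k) Y Z X (c : hc Y Z) (g : hh X Z)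
    (K : hc Y X -> V) :
  faces (crcons c g) K
  = faces c (fun c' => K (crcons c' g))
    - sgn k (csize c)%:Z *:
      last_elim 0 c (fun _ c0 f => K (crcons c0 (hcomp f g))).
Proof.
elim: c X g K => [W|{}Y Z' {}Z f c IH] X g K.
  by rewrite /= scaler0.
rewrite [crcons _ _]/= !faces_cons IH.
case: c {IH} f g K => [W|Z1 Z2 Z3 h c] f g K.
  by rewrite /= scaler0 !subr0 add0r sgn1 scaleN1r opprK.
rewrite opprB addrA [in LHS]addrAC; congr (_ - _ + _).
by rewrite -scaleNr -[- sgn _ _]mulN1r -sgn1 -sgnD; congr (_ *: _); parity.
Qed.

Lemma last_lin a Y X Z (c : hc Y Z) (f f1 f2 : hh X Z) :
  hdg f1 = hdg f -> hdg f2 = hdg f -> hval f = a *: hval f1 + hval f2 ->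
  chain_lin a (crcons c f) (crcons c f1) (crcons c f2).
Proof.
elim: c X f f1 f2 => [W|{}Y Z' {}Z g c IH] X f f1 f2 e1 e2 ef /=.
  exact: lin_here.
by apply: lin_there; apply: IH.
Qed.

Lemma chain_lin_snoc a Y X Z (c c1 c2 : hc Y Z) (f : hh X Z) :
  chain_lin a c c1 c2 ->
  chain_lin a (crcons c f) (crcons c1 f) (crcons c2 f).
Proof.
move=> H; elim: H X f => [Y1 Z1 X1 g g1 g2 d e1 e2 eg|
   Y1 Z1 X1 g d d1 d2 _ IH] X f /=.
  exact: lin_here.
by apply: lin_there; apply: IH.
Qed.

End Chains.

(** * The complex C(C, M) *)

Lemma csize_clact k (C : dgcat k) Y Y' X (f : helt (@dghom k C Y Y'))
    (c : hchain Y X) : (0 < csize c)%N -> csize (clact f c) = csize c.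
Proof. by case: c f. Qed.

Lemma csize_cract k (C : dgcat k) Y X X' (f : helt (@dghom k C X' X))
    (c : hchain Y X) : (0 < csize c)%N -> csize (cract c f) = csize c.
Proof.
move=> h; case: (snocP c) h f => [X1|Y1 X1 Z1 d g] // _ f.
by rewrite cract_snoc !csize_snoc.
Qed.

Lemma csize_clact_short k (C : dgcat k) Y Y' X (f : helt (@dghom k C Y Y'))
    (c : hchain Y X) : (csize c < 2)%N -> (csize (clact f c) < 2)%N.
Proof. by case: c f. Qed.

Lemma csize_cract_short k (C : dgcat k) Y X X' (f : helt (@dghom k C X' X))
    (c : hchain Y X) : (csize c < 2)%N -> (csize (cract c f) < 2)%N.
Proof.
move=> h; case: (snocP c) h f => [X1|Y1 X1 Z1 d g] // h f.
by rewrite csize_cract // csize_snoc.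
Qed.

Section CycRelations.
Variables (k : comPzRingType) (C : dgcat k) (M : bimod C).
Local Notation hc := (hchain (C := C)).
Local Notation hh X Y := (helt (@dghom k C X Y)).

(** The short-string clause makes the balancing and commutator clauses automatic
    for strings with fewer than two entries, where the default values of [clact]
    and [cract] have no meaning; they are required only for bar symbols. *)
Record respects_cyc_rel (V : lmodType k)
    (F : forall Y Z, hc Y Z -> bm M Z Y -> V) : Prop := {
  rc_chain : forall Y Z m, multilinear (fun c => F Y Z c m);
  rc_mod : forall Y Z c, linear_map (F Y Z c);
  rc_short : forall Y Z c m, (csize c < 2)%N -> F Y Z c m = 0;
  rc_bal : forall Y Z Z' c (g : hh Z' Z) m, (2 <= csize c)%N ->
    F Y Z' (cract c g) m = F Y Z c (lact g m);
  rc_comm : forall Y Y' Z p (f : hh Y Y') c m, hdeg p m -> (2 <= csize c)%N ->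
    sgn k (hdg f * blen c) *: F Y' Z (clact f c) m
    = sgn k (hdg f * (bdeg c + p)) *: F Y Z c (ract m f) }.

Lemma cyc_kills (V : lmodType k) (F : forall Y Z, hc Y Z -> bm M Z Y -> V) :
  respects_cyc_rel F ->
  kills (@cyc_rel k C M) (fun s => F _ _ (cs_chain s) (cs_mod s)).
Proof.
move=> H r; case=> {r}.
- move=> a Y Z c c1 c2 m Hc; rewrite /lincomb !big_cons big_nil /=.
  rewrite scale1r scaleN1r addr0 (rc_chain H m Hc) scaleNr.
  by rewrite -opprD subrr.
- move=> a Y Z c m1 m2; rewrite /lincomb !big_cons big_nil /=.
  rewrite scale1r scaleN1r addr0 (rc_mod H) scaleNr.
  by rewrite -opprD subrr.
- by move=> Y Z c m sc; rewrite /lincomb big_seq1 (rc_short H) // scaler0.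
- move=> Y Z Z' c g m; rewrite /lincomb !big_cons big_nil /= addr0.
  rewrite scale1r scaleN1r; case: (ltnP (csize c) 2) => sc; last first.
    by rewrite (rc_bal H) // subrr.
  rewrite (rc_short H _ sc) (rc_short H) ?subrr //.
  exact: csize_cract_short.
- move=> Y Y' Z p f c m hm; rewrite /lincomb !big_cons big_nil /= addr0.
  rewrite scaleNr; case: (ltnP (csize c) 2) => sc; last first.
    by rewrite (rc_comm H _ hm) // subrr.
  rewrite (rc_short H _ sc) (rc_short H) ?scaler0 ?subrr //.
  exact: csize_clact_short.
Qed.

Definition cyc_lift (V : lmodType k) (F : forall Y Z, hc Y Z -> bm M Z Y -> V)
    (x : cyc M) : V :=
  plift (fun s : cycsym M => F _ _ (cs_chain s) (cs_mod s)) x.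

Section Lift.
Variables (V : lmodType k) (F : forall Y Z, hc Y Z -> bm M Z Y -> V).
Hypothesis HF : respects_cyc_rel F.

Lemma cyc_lift_lin : linear_map (cyc_lift F).
Proof. exact: (plift_linear (cyc_kills HF)). Qed.

Lemma cyc_lift_sym Y Z (c : hc Y Z) (m : bm M Z Y) :
  cyc_lift F (cyc_sym c m) = F c m.
Proof. exact: (plift_gen (cyc_kills HF)). Qed.
End Lift.

Lemma cyc_sym_respects : respects_cyc_rel (@cyc_sym k C M).
Proof.
have K := @pgen_kills _ _ (@cyc_rel k C M).
have Kc Y Z (c : hc Y Z) m : (csize c < 2)%N -> cyc_sym c m = 0 :> cyc_mod M.
  move=> sc; have := K _ (@cyc_short k C M _ _ c m sc).
  by rewrite /lincomb big_seq1 scale1r.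
split=> //.
- move=> Y Z m a c c1 c2 Hc.
  have := K _ (@cyc_linl k C M a _ _ c c1 c2 m Hc).
  rewrite /lincomb !big_cons big_nil addr0 /= scale1r scaleN1r scaleNr -opprD.
  by move/eqP; rewrite subr_eq0 => /eqP.
- move=> Y Z c a m1 m2; have := K _ (@cyc_linr k C M a _ _ c m1 m2).
  rewrite /lincomb !big_cons big_nil addr0 /= scale1r scaleN1r scaleNr -opprD.
  by move/eqP; rewrite subr_eq0 => /eqP.
- move=> Y Z Z' c g m _; have := K _ (@cyc_bal k C M _ _ _ c g m).
  rewrite /lincomb !big_cons big_nil addr0 /= scale1r scaleN1r.
  by move/eqP; rewrite subr_eq0 => /eqP.
- move=> Y Y' Z p f c m hm _; have := K _ (@cyc_comm k C M _ _ _ p f c m hm).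
  rewrite /lincomb !big_cons big_nil addr0 /= scaleNr.
  by move/eqP; rewrite subr_eq0 => /eqP.
Qed.

Lemma cyc_sym_ind (P : cyc M -> Prop) :
  P 0 -> (forall a x y, P x -> P y -> P (a *: x + y)) ->
  (forall Y Z (c : hc Y Z) (m : bm M Z Y), P (cyc_sym c m)) -> forall x, P x.
Proof. by move=> P0 PL Ps; apply: presented_ind => // -[Y Z c m]; exact: Ps. Qed.

End CycRelations.

Section CycComplex.
Variables (k : comPzRingType) (C : dgcat k) (M : bimod C).
Hypothesis HM : is_bimod M.
Local Notation hc := (hchain (C := C)).
Local Notation hh X Y := (helt (@dghom k C X Y)).
Local Notation sym := (@cyc_sym k C M _ _).
Let R := cyc_sym_respects M.

Definition sym_diff Y Z (c : hc Y Z) (m : bm M Z Y) : cyc_mod M :=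
  sgn k (blen c) *: dint c (fun c' => cyc_sym c' m)
  + faces c (fun c' => cyc_sym c' m) + sgn k (bdeg c) *: cyc_sym c (cdiff m).

Lemma bdeg_cract Y X X' (f : hh X' X) (c : hc Y X) : (0 < csize c)%N ->
  bdeg (cract c f) = bdeg c + hdg f.
Proof.
move=> h; case: (snocP c) h f => [X1|Y1 X1 Z1 d g] // _ f.
rewrite cract_snoc /bdeg /blen !cdeg_snoc !csize_snoc /=; ring.
Qed.

Lemma bdeg_clact Y Y' X (f : hh Y Y') (c : hc Y X) : (0 < csize c)%N ->
  bdeg (clact f c) = hdg f + bdeg c.
Proof. case: c f => [//|Y1 Y2 Y3 g c] f _; rewrite /bdeg /blen /=; ring. Qed.

Lemma blen_cract Y X X' (f : hh X' X) (c : hc Y X) : (0 < csize c)%N ->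
  blen (cract c f) = blen c.
Proof. by move=> h; rewrite /blen csize_cract. Qed.

Lemma blen_clact Y Y' X (f : hh Y Y') (c : hc Y X) : (0 < csize c)%N ->
  blen (clact f c) = blen c.
Proof. by move=> h; rewrite /blen csize_clact. Qed.

Lemma dint_short Y Z (c : hc Y Z) (m : bm M Z Y) : (csize c < 2)%N ->
  dint c (fun c' => cyc_sym c' m) = 0.
Proof.
move=> sc; rewrite -[RHS](dint0 (cyc_mod M) c); apply: dint_congr => c' es _.
by rewrite (rc_short R) ?es.
Qed.

Lemma faces_short Y Z (c : hc Y Z) (m : bm M Z Y) : (csize c < 3)%N ->
  faces c (fun c' => cyc_sym c' m) = 0.
Proof.
move=> sc; rewrite -[RHS](faces0 (cyc_mod M) c); apply: faces_congr => c' es _.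
by rewrite (rc_short R) // -ltnS es.
Qed.

Lemma faces_cract (V : lmodType k) Y Z Z' (c : hc Y Z) (g : hh Z' Z)
    (K : hc Y Z' -> V) : (0 < csize c)%N ->
  faces (cract c g) K = faces c (fun c' => K (cract c' g)).
Proof.
move=> h; case: (snocP c) h g K => [X1|Y1 X1 Z1 d f] // _ g K.
rewrite cract_snoc !faces_snoc; congr (_ - _ *: _).
  by apply: faces_congr => c' _ _; rewrite cract_snoc.
case: (snocP d) f K => [X2|Y2 X2 Z2 d' f'] // f K.
by rewrite !last_elim_snoc cract_snoc hcompA.
Qed.

Lemma faces_clact (V : lmodType k) Y Y' Z (f : hh Y Y') (c : hc Y Z)
    (K : hc Y' Z -> V) : (0 < csize c)%N ->
  faces (clact f c) K = faces c (fun c' => K (clact f c')).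
Proof.
case: c f K => [//|Y1 Y2 Y3 g c] f K _ /=; congr (_ - _).
by case: c g K => [//|Z1 Z2 Z3 h c] g K /=; rewrite hcompA.
Qed.

Lemma dint_cract (V : lmodType k) Y Z Z' (c : hc Y Z) (g : hh Z' Z)
    (K : hc Y Z' -> V) : multilinear K -> (0 < csize c)%N ->
  dint (cract c g) K
  = dint c (fun c' => K (cract c' g)) + sgn k (cdeg c) *: K (cract c (hdiff g)).
Proof.
move=> HK h; case: (snocP c) h g K HK => [X1|Y1 X1 Z1 d f] // _ g K HK.
rewrite !cract_snoc !dint_snoc -addrA; congr (_ + _).
  by apply: dint_congr => c' _ _; rewrite cract_snoc.
rewrite cract_snoc cdeg_snoc sgnD -scalerA -scalerDr; congr (_ *: _).
rewrite addrC; apply: HK; apply: last_lin => //=.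
- by rewrite addrA.
- by rewrite addrAC.
- by rewrite (dg_comp_diff (dgP C) _ (hvalP f)) addrC.
Qed.

(** The differential is compatible with moving an entry into the module since
    both actions on M satisfy the Leibniz rule.  The computation uses no outer
    faces: on uncollapsed symbols [f_0|...|f_(r+1)] (x) m these are ordinary
    faces of the string. *)
Lemma sym_diff_respects : respects_cyc_rel sym_diff.
Proof.
split.
- move=> Y Z m a c c1 c2 H; rewrite /sym_diff.
  have [e1 e2 e3 e4] := chain_lin_shape H.
  rewrite /bdeg /blen e1 e2 e3 e4 (rc_chain R _ H).
  rewrite (dint_multilinear (rc_chain R m) H) (faces_multilinear (rc_chain R m) H).
  by rewrite !scalerDr -!sgn_scaleC [RHS]addrACA [X in _ = X + _]addrACA.
- move=> Y Z c a m1 m2; rewrite /sym_diff.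
  have -> : dint c (fun c' => cyc_sym c' (a *: m1 + m2) : cyc_mod M) =
      a *: dint c (fun c' => cyc_sym c' m1) + dint c (fun c' => cyc_sym c' m2).
    by rewrite -dint_linK; apply: dint_congr => c' _ _; exact: (rc_mod R).
  have -> : faces c (fun c' => cyc_sym c' (a *: m1 + m2) : cyc_mod M) =
      a *: faces c (fun c' => cyc_sym c' m1) + faces c (fun c' => cyc_sym c' m2).
    by rewrite -faces_linK; apply: faces_congr => c' _ _; exact: (rc_mod R).
  rewrite (cx_diffL (bi_cplx HM Z Y)) (rc_mod R).
  by rewrite !scalerDr -!sgn_scaleC [RHS]addrACA [X in _ = X + _]addrACA.
- move=> Y Z c m sc; rewrite /sym_diff dint_short // faces_short ?(leq_trans sc) //.
  by rewrite (rc_short R) // !scaler0 !addr0.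
- move=> Y Z Z' c g m sc; have sc0 : (0 < csize c)%N by exact: ltnW.
  rewrite /sym_diff (dint_cract _ (rc_chain R m)) // faces_cract //.
  rewrite bdeg_cract // blen_cract // !(rc_bal R) // (bi_lact_diff HM).
  have -> : dint c (fun c' => cyc_sym (cract c' g) m : cyc_mod M)
          = dint c (fun c' => cyc_sym c' (lact g m)).
    by apply: dint_congr => c' es _; rewrite (rc_bal R) // es.
  have -> : faces c (fun c' => cyc_sym (cract c' g) m : cyc_mod M)
          = faces c (fun c' => cyc_sym c' (lact g m)).
    apply: faces_congr => c' es _; case: (ltnP (csize c') 2) => sc'.
      rewrite !(rc_short R) // csize_cract //.
      by move: sc; rewrite -es.
    by rewrite (rc_bal R).
  rewrite (linD (rc_mod R _)) (linZ (rc_mod R _)) !scalerDr !scalerA -!sgnD.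
  rewrite -!addrA; congr (_ + _); rewrite addrCA; congr (_ + (_ + _)).
  by congr (_ *: _); rewrite /bdeg; parity.
- move=> Y Y' Z p f c m hm sc.
  have hm' := cx_diff_hdeg (bi_cplx HM _ _) hm.
  have sc0 : (0 < csize c)%N by exact: ltnW.
  rewrite /sym_diff (bi_ract_diff HM _ hm) blen_clact // bdeg_clact //.
  case: c f m hm hm' sc sc0 => [//|Y1 Y2 Y3 g c] f m hm hm' sc _.
  have Kcomm c' (q : int) n : hdeg q n ->
      cyc_sym (clact f c') n
      = sgn k (hdg f * (cdeg c' + q)) *: cyc_sym c' (ract n f) :> cyc_mod M.
    move=> hn; case: (ltnP (csize c') 2) => sc'.
      rewrite !(rc_short R) ?scaler0 //.
      exact: csize_clact_short.
    rewrite (sgn_move (rc_comm R f hn sc')).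
    by congr (_ *: _); rewrite /bdeg; parity.
  rewrite (Kcomm _ (hcons g c) (p + 1)) //.
  rewrite {1}[faces (clact _ _) _](_ : _ = sgn k (hdg f * (cdeg (hcons g c) + p)) *:
      faces (hcons g c) (fun c' => cyc_sym c' (ract m f))); last first.
    rewrite -facesZ; transitivity (faces (hcons g c) (fun c' => cyc_sym (clact f c') m : cyc_mod M)).
      exact: faces_clact.
    by apply: faces_congr => c' _ ed; rewrite (Kcomm _ c' p) // ed.
  rewrite {1}[dint (clact _ _) _](_ : _ =
      sgn k (hdg f * (cdeg (hcons g c) + p + 1) + hdg f) *:
        dint (hcons g c) (fun c' => cyc_sym c' (ract m f))
      + cyc_sym (clact (hdiff f) (hcons g c)) m); last first.
    transitivity (sgn k (hdg f) *: dint (hcons g c)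
        (fun c' => cyc_sym (clact f c') m : cyc_mod M)
        + cyc_sym (clact (hdiff f) (hcons g c)) m).
      rewrite /= scalerDr scalerA -sgnD addrAC; congr (_ + _).
      apply: (head_lin (rc_chain R m)) => //=.
      + by rewrite addrA.
      + by rewrite addrAC.
      + by rewrite (dg_comp_diff (dgP C) _ (hvalP f)) addrC.
    congr (_ + _); rewrite [in RHS]addrC sgnD -scalerA; congr (_ *: _).
    rewrite -dintZ; apply: dint_congr => c' _ ed.
    by rewrite (Kcomm _ c' p) // ed; congr (_ *: _); parity.
  have Kd : cyc_sym (clact (hdiff f) (hcons g c)) m
    = sgn k ((hdg f + 1) * (cdeg (hcons g c) + p)) *:
      cyc_sym (hcons g c) (ract m (hdiff f)) :> cyc_mod M.
    rewrite (sgn_move (rc_comm R (hdiff f) hm sc)).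
    by congr (_ *: _); rewrite /bdeg /=; parity.
  rewrite Kd (linD (rc_mod R _)) (linZ (rc_mod R _)).
  move: (dint _ _) (faces _ _) => A B.
  rewrite !scalerDr !scalerA -!sgnD -!addrA; congr (_ + _).
    by congr (_ *: _); rewrite /bdeg; parity.
  rewrite addrCA; congr (_ + _); first by congr (_ *: _); rewrite /bdeg; parity.
  by rewrite addrC; congr (_ + _); congr (_ *: _); rewrite /bdeg; parity.
Qed.
End CycComplex.

Lemma sdegE k (C : dgcat k) Y Z (c : hchain (C := C) Y Z) :
  sdeg c = cdeg c - (csize c)%:Z.
Proof. by elim: c => [//|{}Y X {}Z f c IH] /=; rewrite IH; ring. Qed.

Lemma sdeg_cons k (C : dgcat k) Y Z X (f : helt (@dghom k C Z Y))
    (c : hchain (C := C) Z X) : sdeg (hcons f c) = hdg f - 1 + sdeg c.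
Proof. by []. Qed.

Lemma sdeg_snoc k (C : dgcat k) Y Z X (c : hchain (C := C) Y Z)
    (f : helt (@dghom k C X Z)) : sdeg (crcons c f) = sdeg c + (hdg f - 1).
Proof.
by rewrite !sdegE cdeg_snoc csize_snoc -addn1 PoszD; ring.
Qed.

Section SuspendedCalculus.
Variables (k : comPzRingType) (C : dgcat k).
Local Notation hc := (hchain (C := C)).
Local Notation hh X Y := (helt (@dghom k C X Y)).

Definition head_elim (V : Type) (v0 : V) Y X (c : hc Y X) :
    (forall Z, hh Z Y -> hc Z X -> V) -> V :=
  match c in hchain Y X return (forall Z, hh Z Y -> hc Z X -> V) -> V with
  | hnil _ => fun _ => v0
  | hcons _ _ _ f c' => fun L => L _ f c'
  end.

(** The internal differential and the faces of a string whose entries are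
    suspended one by one.  They agree with [dint] and [faces] up to the signs
    recorded by [shift_exp] ([sdintE], [sfacesE]), and make every sign the Koszul
    sign for entries of degree |c_i| - 1. *)
Fixpoint sdint (V : lmodType k) Y X (c : hc Y X) : (hc Y X -> V) -> V :=
  match c in hchain Y X return (hc Y X -> V) -> V with
  | hnil _ => fun _ => 0
  | hcons _ _ _ f c' => fun K =>
      - K (hcons (hdiff f) c')
      - sgn k (hdg f) *: sdint c' (fun c'' => K (hcons f c''))
  end.

Fixpoint sfaces (V : lmodType k) Y X (c : hc Y X) : (hc Y X -> V) -> V :=
  match c in hchain Y X return (hc Y X -> V) -> V with
  | hnil _ => fun _ => 0
  | hcons _ _ _ f c' => fun K =>
      - sgn k (hdg f) *: merge_head f c' K
      - sgn k (hdg f) *: sfaces c' (fun c'' => K (hcons f c''))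
  end.

Lemma sdint_congr (V : lmodType k) Y X (c : hc Y X) (K K' : hc Y X -> V) :
  (forall c', csize c' = csize c -> cdeg c' = cdeg c + 1 -> K c' = K' c') ->
  sdint c K = sdint c K'.
Proof.
elim: c K K' => [//|{}Y Z {}X f c IH] K K' H /=.
rewrite H //=; last by rewrite -addrA [1 + _]addrC addrA.
by congr (_ - _ *: _); apply: IH => c' es ed; apply: H; rewrite /= ?es ?ed ?addrA.
Qed.

Lemma sfaces_congr (V : lmodType k) Y X (c : hc Y X) (K K' : hc Y X -> V) :
  (forall c', (csize c').+1 = csize c -> cdeg c' = cdeg c -> K c' = K' c') ->
  sfaces c K = sfaces c K'.
Proof.
elim: c K K' => [//|{}Y Z {}X f c IH] K K' H /=; congr (_ *: _ - _ *: _).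
  by apply: merge_congr => c' es ed; apply: H; rewrite /= ?es.
by apply: IH => c' es ed; apply: H; rewrite /= ?es ?ed.
Qed.

Lemma sdintZ (V : lmodType k) Y X (c : hc Y X) a (K : hc Y X -> V) :
  sdint c (fun c' => a *: K c') = a *: sdint c K.
Proof.
elim: c K => [?|{}Y Z {}X f c IH] K /=; first by rewrite scaler0.
by rewrite IH scalerBr scalerN !scalerA mulrC.
Qed.

Lemma sfacesZ (V : lmodType k) Y X (c : hc Y X) a (K : hc Y X -> V) :
  sfaces c (fun c' => a *: K c') = a *: sfaces c K.
Proof.
elim: c K => [?|{}Y Z {}X f c IH] K /=; first by rewrite scaler0.
by rewrite IH mergeZ scalerBr !scalerA mulrC [_ * a]mulrC.
Qed.

Lemma sdintE (V : lmodType k) Y X (c : hc Y X) (K : hc Y X -> V) :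
  sdint c (fun c' => sgn k (shift_exp c') *: K c')
  = sgn k (shift_exp c + (csize c)%:Z) *: dint c K.
Proof.
elim: c K => [?|{}Y Z {}X f c IH] K /=; first by rewrite scaler0.
rewrite (@sdint_congr _ _ _ _ _ (fun c' => sgn k (hdg f * (csize c)%:Z) *:
  (sgn k (shift_exp c') *: K (hcons f c')))); last first.
  by move=> c' es _; rewrite sgn_sgn es.
rewrite sdintZ IH !scaleN_sgn !scalerDr !sgn_sgn.
by congr (_ *: _ + _ *: _); parity.
Qed.

Lemma sfacesE (V : lmodType k) Y X (c : hc Y X) (K : hc Y X -> V) :
  sfaces c (fun c' => sgn k (shift_exp c') *: K c')
  = - sgn k (shift_exp c) *: faces c K.
Proof.
elim: c K => [?|{}Y Z {}X f c IH] K /=; first by rewrite scaler0.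
rewrite (@sfaces_congr _ _ _ _ _ (fun c' => sgn k (hdg f * ((csize c)%:Z - 1)) *:
  (sgn k (shift_exp c') *: K (hcons f c')))); last first.
  by move=> c' es _; rewrite sgn_sgn -es; congr (_ *: _); parity.
rewrite sfacesZ IH !scaleNr !scaleN_sgn !scalerDr !sgn_sgn.
congr (_ + _ *: _); last by parity.
case: c f K {IH} => [W f K|Y1 Y2 Y3 g c f K] /=; first by rewrite !scaler0.
by rewrite sgn_sgn; congr (_ *: _); parity.
Qed.

End SuspendedCalculus.

Section CycComplex.
Variables (k : comPzRingType) (C : dgcat k) (M : bimod C).
Hypothesis HM : is_bimod M.
Local Notation hc := (hchain (C := C)).
Local Notation hh X Y := (helt (@dghom k C X Y)).
Local Notation sym := (@cyc_sym k C M _ _).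
Let R := cyc_sym_respects M.

Lemma cyc_diff_lin : linear_map (@cyc_diff k C M).
Proof. exact: (cyc_lift_lin (sym_diff_respects HM)). Qed.

Lemma cyc_diff_sym Y Z (c : hc Y Z) (m : bm M Z Y) :
  cyc_diff (cyc_sym c m) = sym_diff c m.
Proof. exact: (cyc_lift_sym (sym_diff_respects HM)). Qed.

Lemma cyc_diff_diff x : cyc_diff (cyc_diff x) = 0 :> cyc_mod M.
Proof.
have DL := cyc_diff_lin.
elim/cyc_sym_ind: x => [|a x y Ex Ey|Y Z c m].
- by rewrite !(lin0 DL).
- by rewrite !DL Ex Ey scaler0 addr0.
rewrite cyc_diff_sym /sym_diff !(linD DL) !(linZ DL) cyc_diff_sym.
rewrite (dint_map DL) (faces_map DL).
have HK := rc_chain R m; set K := fun c => cyc_sym c m.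
pose K' := fun c : hc Y Z => cyc_sym c (cdiff m) : cyc_mod M.
rewrite (@dint_congr _ _ _ _ _ _ _ (fun c' => sgn k (blen c) *: dint c' K
   + faces c' K + sgn k (bdeg c + 1) *: K' c')); last first.
  move=> c' es ed; rewrite cyc_diff_sym /sym_diff /bdeg /blen es ed.
  by congr (_ + sgn k _ *: _); ring.
rewrite (@faces_congr _ _ _ _ _ _ _ (fun c' => sgn k (blen c + 1) *: dint c' K
   + faces c' K + sgn k (bdeg c + 1) *: K' c')); last first.
  move=> c' es ed; rewrite cyc_diff_sym /sym_diff /bdeg /blen -es ed.
  by congr (_ *: _ + _ + _ *: _); parity.
rewrite !dintD !facesD !dintZ !facesZ dint_dint // dint_faces //.
rewrite faces_faces /sym_diff (cx_diffK (bi_cplx HM _ _)) (lin0 (rc_mod R _)).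
rewrite !scaler0 add0r !addr0 !scalerDr !sgn_sgn.
rewrite [blen c + (_ + 1)]addrA [blen c + bdeg c]addrC !sgnS !scaleNr.
set x := _ *: faces c _; set y := _ *: dint c _; set z := _ *: faces c _.
by rewrite [x - y + _]addrACA subrr add0r -opprD addNr.
Qed.

Lemma cyc_sym_hdeg Y Z (c : hc Y Z) (m : bm M Z Y) p n :
  hdeg p m -> n = bdeg c + p -> hdeg n (cyc_sym c m : cyc M).
Proof. by move=> hm ->; apply: lspan_gen; exists Y, Z, c, m, p. Qed.

Lemma lact_lin Y' Y X (g : hh Y Y') : linear_map (fun m : bm M Y X => lact g m).
Proof. by move=> a x y; exact: (bi_lactLr HM). Qed.

Lemma ract_lin Y X X' (g : hh X' X) : linear_map (fun m : bm M Y X => ract m g).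
Proof. by move=> a x y; exact: (bi_ractLl HM). Qed.

(** The grading is direct because the projection to degree n, defined on symbols
    through the components of m, respects the relations. *)
Definition cyc_component (n : int) Y Z (c : hc Y Z) (m : bm M Z Y) : cyc_mod M :=
  cyc_sym c (component (bi_cplx HM Z Y) (n - bdeg c) m).

Lemma cyc_component_respects n : respects_cyc_rel (cyc_component n).
Proof.
split; rewrite /cyc_component.
- move=> Y Z m a c c1 c2 H; have [e1 e2 e3 e4] := chain_lin_shape H.
  by rewrite /bdeg /blen e1 e2 e3 e4; exact: (rc_chain R _ H).
- move=> Y Z c a x y; rewrite component_lin; exact: (rc_mod R).
- by move=> *; rewrite (rc_short R).
- move=> Y Z Z' c g m sc; rewrite (rc_bal R) //; congr cyc_sym.
  rewrite (bdeg_cract _ (ltnW sc)) opprD addrA; set q := n - bdeg c.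
  move: m; apply: (homog_ext (bi_cplx HM _ _)).
  + move=> a x y; rewrite (component_lin (bi_cplx HM _ _)).
    by rewrite (bi_lactLr HM).
  + move=> a x y; rewrite (bi_lactLr HM).
    by rewrite (component_lin (bi_cplx HM _ _)).
  + move=> p x hx; rewrite (component_homog _ _ hx).
    rewrite (component_homog _ _ (bi_lact_hdeg HM g hx)).
    rewrite subr_eq [p + _]addrC; case: eqP => // _.
    by rewrite (lin0 (lact_lin _)).
- move=> Y Y' Z p f c m hm sc.
  have sc0 := ltnW sc.
  rewrite bdeg_clact // (component_homog _ _ hm).
  rewrite (component_homog _ _ (bi_ract_hdeg HM f hm)).
  have -> : (n - (hdg f + bdeg c) == p) = (n - bdeg c == p + hdg f).
    by rewrite opprD addrCA addrC subr_eq.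
  case: ifP => _; first exact: (rc_comm R f hm sc).
  by rewrite !(lin0 (rc_mod R _)) !scaler0.
Qed.

Lemma cyc_complex : is_complex (cyc M).
Proof.
split.
- by move=> n; exact: span0.
- by move=> n a x y; exact: lspanL.
- have E : forall x : cyc M, exists s w, decomposes x s w.
    apply: cyc_sym_ind => [|a x y [s [w Hx]] [s' [w' Hy]]|Y Z c m].
    + exists [::], (fun=> 0); split=> //; last by rewrite big_nil.
      by move=> n; exact: span0.
    + exists (undup (s ++ s')), (fun n => a *: w n + w' n).
      have [us hw w0 ex] := Hx; have [us' hw' w0' ey] := Hy.
      split; first exact: undup_uniq.
      * by move=> n; apply: lspanL; [exact: hw|exact: hw'].
      * move=> n; rewrite mem_undup mem_cat negb_or => /andP[ns ns'].
        by rewrite w0 // w0' // scaler0 addr0.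
      * rewrite big_split /= -scaler_sumr ex ey; congr (_ *: _ + _).
          apply: (@sum_widen k (cyc M)) => //; first exact: undup_uniq.
          by move=> n sn; rewrite mem_undup mem_cat sn.
        apply: (@sum_widen k (cyc M)) => //; first exact: undup_uniq.
        by move=> n sn; rewrite mem_undup mem_cat sn orbT.
    + have [s [us hw w0 em]] := componentP (bi_cplx HM Z Y) m.
      exists [seq bdeg c + n | n <- s],
        (fun n => cyc_component n c m); split.
      * by rewrite map_inj_uniq // => n n' /addrI.
      * move=> n; apply: cyc_sym_hdeg (component_hdeg _ _ _) _.
        by rewrite addrC subrK.
      * move=> n ns; rewrite /cyc_component w0 ?(lin0 (rc_mod R _)) //.
        apply: contraNN ns => sn; apply/mapP.
        by exists (n - bdeg c); rewrite // addrC subrK.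
      * rewrite big_map {1}em (lin_sum (rc_mod R _)); apply: eq_bigr => n _.
        by rewrite /cyc_component addrAC subrr add0r.
  move=> x; have [s [w [us hw w0 ->]]] := E x.
  by exists s, w.
- move=> s w us hw e n ns.
  pose P q := cyc_lift (cyc_component q).
  have PL q : linear_map (P q) by exact: cyc_lift_lin (cyc_component_respects q).
  have Ph q m x : hdeg m x -> P q x = if q == m then x else 0.
    elim=> [|a u v [Y [Z [c [y [p [hy <- ->]]]]]] _ IH].
      by rewrite (lin0 (PL q)); case: ifP.
    rewrite (PL q) IH /P cyc_lift_sym; last exact: cyc_component_respects.
    rewrite /cyc_component (component_homog _ _ hy) subr_eq [p + _]addrC.
    by case: ifP => // _; rewrite (lin0 (rc_mod R _)) scaler0 addr0.
  have := congr1 (P n) e.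
  rewrite (lin_sum (PL n)) (lin0 (PL n)) (bigD1_seq n) //= (Ph n n) // eqxx.
  rewrite big1 ?addr0 // => m mn.
  by rewrite (Ph n m) // eq_sym (negbTE mn).
- exact: cyc_diff_lin.
- move=> n; apply: (lspan_map cyc_diff_lin) => x [Y [Z [c [m [p [hm <- ->]]]]]].
  rewrite /= cyc_diff_sym /sym_diff -[X in lspan _ X]addrA; apply: lspanL.
    apply: (dint_mem (span0 _) (@lspanL _ _ _)) => c' es ed.
    by apply: (cyc_sym_hdeg hm); rewrite /bdeg /blen es ed; ring.
  rewrite -[faces _ _]scale1r; apply: lspanL.
    apply: (faces_mem (span0 _) (@lspanL _ _ _)) => c' es ed.
    by apply: (cyc_sym_hdeg hm); rewrite /bdeg /blen -es ed -[(csize c').+1]addn1 PoszD; ring.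
  rewrite -[_ *: _]addr0; apply: lspanL; last exact: span0.
  apply: (cyc_sym_hdeg (cx_diff_hdeg (bi_cplx HM _ _) hm)); ring.
- exact: cyc_diff_diff.
Qed.
End CycComplex.

(** * Generators and universal property *)

Section ChainFacts.
Variables (k : comPzRingType) (C : dgcat k).
Local Notation hc := (hchain (C := C)).
Local Notation hh X Y := (helt (@dghom k C X Y)).

Lemma hcomp1l X Y (f : hh X Y) : hcomp (hid Y) f = f.
Proof. by apply: helt_eq; rewrite /= ?add0r // (dg_comp1l (dgP C)). Qed.

Lemma hcomp1r X Y (f : hh X Y) : hcomp f (hid X) = f.
Proof. by apply: helt_eq; rewrite /= ?addr0 // (dg_comp1r (dgP C)). Qed.

Lemma cract_pad Y X X' (c : hc Y X) (f : hh X' X) :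
  cract (pad c) f = hcons (hid Y) (crcons c f).
Proof. by rewrite (@cract_snoc _ _ Y X X X' (hcons (hid Y) c)) hcomp1l. Qed.

Lemma csize_pad Y X (c : hc Y X) : csize (pad c) = (csize c).+2.
Proof. by rewrite /= csize_snoc. Qed.

Lemma cdeg_pad Y X (c : hc Y X) : cdeg (pad c) = cdeg c.
Proof. by rewrite /= cdeg_snoc /= addr0 add0r. Qed.

Lemma blen_pad Y X (c : hc Y X) : blen (pad c) = csize c.
Proof. by rewrite /blen csize_pad -addn2 PoszD addrK. Qed.

Lemma bdeg_pad Y X (c : hc Y X) : bdeg (pad c) = sdeg c.
Proof. by rewrite /bdeg blen_pad cdeg_pad sdegE. Qed.

Lemma chain_lin_shift a Y X (c c1 c2 : hc Y X) : chain_lin a c c1 c2 ->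
  shift_exp c1 = shift_exp c /\ shift_exp c2 = shift_exp c.
Proof.
elim=> [Y1 Z X1 f f1 f2 d e1 e2 _|Y1 Z X1 f d d1 d2 H [e1 e2]] /=.
  by rewrite e1 e2.
by have [-> -> _ _] := chain_lin_shape H; rewrite e1 e2.
Qed.

Lemma last_elim_congr (V : Type) (v0 : V) Y X (c : hc Y X)
    (L L' : forall Z, hc Y Z -> hh X Z -> V) :
  (forall Z (c0 : hc Y Z) f, sdeg c = sdeg c0 + (hdg f - 1) ->
     L Z c0 f = L' Z c0 f) ->
  last_elim v0 c L = last_elim v0 c L'.
Proof.
case: (snocP c) L L' => [//|Y1 Z X1 c0 f] L L' H.
by rewrite !last_elim_snoc; apply: H; rewrite sdeg_snoc.
Qed.

Lemma last_elim_linL (V : lmodType k) Y X (c : hc Y X) a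
    (L L1 L2 : forall Z, hc Y Z -> hh X Z -> V) :
  (forall Z c0 f, L Z c0 f = a *: L1 Z c0 f + L2 Z c0 f) ->
  last_elim 0 c L = a *: last_elim 0 c L1 + last_elim 0 c L2.
Proof.
case: (snocP c) L L1 L2 => [X1|Y1 Z X1 c0 f] L L1 L2 H.
  by rewrite /= scaler0 addr0.
by rewrite !last_elim_snoc.
Qed.

Lemma last_elim_multilinear (V : lmodType k) Y X
    (L : forall Z, hc Y Z -> hh X Z -> V) :
  (forall Z f, multilinear (fun c => L Z c f)) ->
  (forall a Z c (f f1 f2 : hh X Z), hdg f1 = hdg f -> hdg f2 = hdg f ->
    hval f = a *: hval f1 + hval f2 -> L Z c f = a *: L Z c f1 + L Z c f2) ->
  multilinear (fun c => last_elim 0 c L).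
Proof.
move=> Hc Hf a c c1 c2 H; elim: H L Hc Hf => {c c1 c2 Y X}.
  move=> Y Z X f f1 f2 c e1 e2 ef L Hc Hf.
  case: c f f1 f2 e1 e2 ef L Hc Hf => [W|Z1 Z2 Z3 g c] f f1 f2 e1 e2 ef L Hc Hf.
    exact: Hf.
  apply: (@last_elim_linL _ _ _ (hcons g c)) => W c0 h.
  by apply: Hc; constructor.
move=> Y Z X f c c1 c2 H IH L Hc Hf.
have E (d : hc Z X) : (0 < csize d)%N ->
    last_elim 0 (hcons f d) L = last_elim 0 d (fun W c0 g => L W (hcons f c0) g).
  by case: d f L {Hc Hf IH}.
have [s1 s2 _ _] := chain_lin_shape H.
have s0 : (0 < csize c)%N by case: H {IH s1 s2 E Hc Hf}.
rewrite !E ?s1 ?s2 //; apply: IH => [W g|b W d g g1 g2 e1 e2 eg].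
  exact: (multilinear_cons f (Hc W g)).
exact: Hf.
Qed.

End ChainFacts.

Section CycGenerators.
Variables (k : comPzRingType) (C : dgcat k) (M : bimod C).
Hypothesis HM : is_bimod M.
Local Notation hc := (hchain (C := C)).
Local Notation hh X Y := (helt (@dghom k C X Y)).
Local Notation sym := (@cyc_sym k C M _ _).
Let R := cyc_sym_respects M.

Lemma sym_clact_pad Y Y' Z (f : hh Y Y') (c : hc Y Z) (m : bm M Z Y') p :
  hdeg p m ->
  cyc_sym (clact f (pad c)) m
  = sgn k (hdg f * (cdeg c + p)) *: cyc_elt c (ract m f) :> cyc_mod M.
Proof.
move=> hm; have sc : (2 <= csize (pad c))%N by rewrite csize_pad.
rewrite (sgn_move (rc_comm R f hm sc)); congr (_ *: _).
by rewrite bdeg_pad blen_pad sdegE; parity.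
Qed.

Lemma sym_cract_pad Y Z Z' (c : hc Y Z) (g : hh Z' Z) (m : bm M Z' Y) :
  cyc_sym (cract (pad c) g) m = cyc_elt c (lact g m).
Proof. by rewrite (rc_bal R) // csize_pad. Qed.

(** The normal form: f_1 moves into m by balancing, then f_0 moves around to the
    other side of m by the commutator relation. *)
Lemma sym_cons_snoc Y Y' Z Z' (f0 : hh Y Y') (c : hc Y Z) (f1 : hh Z' Z)
    (m : bm M Z' Y') p : hdeg p m ->
  cyc_sym (hcons f0 (crcons c f1)) m
  = sgn k (hdg f0 * (cdeg c + hdg f1 + p)) *:
    cyc_elt c (lact f1 (ract m f0)) :> cyc_mod M.
Proof.
move=> hm.
have -> : hcons f0 (crcons c f1) = clact f0 (cract (pad c) f1).
  by rewrite cract_pad /= hcomp1r.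
have sc : (2 <= csize (cract (pad c) f1))%N by rewrite csize_cract csize_pad.
rewrite (sgn_move (rc_comm R f0 hm sc)) sym_cract_pad; congr (_ *: _).
by rewrite bdeg_cract ?csize_pad // blen_cract ?csize_pad // bdeg_pad blen_pad sdegE; parity.
Qed.

Lemma cyc_elt_scyc Y Z (c : hc Y Z) (m : bm M Z Y) :
  cyc_elt c m = sgn k (shift_exp c) *: scyc_elt c m.
Proof.
by rewrite /scyc_elt sgn_sgn (@sgn_eq _ _ 0) ?sgn0 ?scale1r // oddzD addbb.
Qed.

Lemma scyc_elt_lin Y Z (c : hc Y Z) : linear_map (@scyc_elt k C M Y Z c).
Proof.
by move=> a x y; rewrite /scyc_elt /cyc_elt (rc_mod R) scalerDr sgn_scaleC.
Qed.

Lemma cyc_elt_multilinear Y Z (m : bm M Z Y) :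
  multilinear (fun c => cyc_elt c m).
Proof.
move=> a c c1 c2 H; rewrite /cyc_elt.
by apply: (rc_chain R); apply: lin_there; exact: chain_lin_snoc.
Qed.

Lemma scyc_elt_multilinear Y Z (m : bm M Z Y) :
  multilinear (fun c => scyc_elt c m).
Proof.
move=> a c c1 c2 H; rewrite /scyc_elt (cyc_elt_multilinear m H).
by have [-> ->] := chain_lin_shift H; rewrite scalerDr sgn_scaleC.
Qed.

Lemma scyc_elt_hdeg Y Z (c : hc Y Z) (m : bm M Z Y) p :
  hdeg p m -> hdeg (sdeg c + p) (scyc_elt c m).
Proof.
move=> hm; apply: (hdegZ (cyc_complex HM)); apply: cyc_sym_hdeg hm _.
by rewrite bdeg_pad.
Qed.

Lemma cyc_ind (P : cyc M -> Prop) :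
  P 0 -> (forall a x y, P x -> P y -> P (a *: x + y)) ->
  (forall Y Z (c : hc Y Z) (m : bm M Z Y) p, hdeg p m -> P (scyc_elt c m)) ->
  forall x, P x.
Proof.
move=> P0 PL Pg; apply: cyc_sym_ind => // Y Z c m.
move: m; apply: (homog_ind (bi_cplx HM Z Y)) => [|a x y Px Py|p m hm].
- by rewrite (lin0 (rc_mod R _)).
- by rewrite (rc_mod R); exact: PL.
case: (ltnP (csize c) 2) => sc; first by rewrite (rc_short R).
case: c m hm sc => [//|Y1 Y2 Y3 f0 c] m hm sc.
case: (snocP c) f0 m hm sc => [//|Z1 Z2 Z3 d f1] f0 m hm _.
rewrite (sym_cons_snoc _ _ _ hm) cyc_elt_scyc scalerA -[_ *: _]addr0; apply: PL => //.
apply: Pg; apply: (bi_lact_hdeg HM); exact: (bi_ract_hdeg HM) hm.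
Qed.

Lemma cyc_hdeg_ind (n : int) (P : cyc M -> Prop) :
  P 0 -> (forall a x y, P x -> P y -> P (a *: x + y)) ->
  (forall Y Z (c : hc Y Z) (m : bm M Z Y) p, hdeg p m -> sdeg c + p = n ->
     P (scyc_elt c m)) -> forall x, hdeg n x -> P x.
Proof.
move=> P0 PL Pg x; elim=> [//|a u v [Y [Z [c [m [p [hm ed ->]]]]]] _ Pv].
suff Pu : P (cyc_sym c m) by exact: (PL a _ v Pu Pv).
case: (ltnP (csize c) 2) => sc; first by rewrite (rc_short R).
case: c m hm ed sc => [//|Y1 Y2 Y3 f0 c] m hm ed sc.
case: (snocP c) f0 m hm ed sc => [//|Z1 Z2 Z3 d f1] f0 m hm ed _.
rewrite (sym_cons_snoc _ _ _ hm) cyc_elt_scyc scalerA -[_ *: _]addr0; apply: PL => //.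
apply: Pg; first by apply: (bi_lact_hdeg HM); exact: (bi_ract_hdeg HM) hm.
by rewrite -ed /bdeg /blen /= cdeg_snoc csize_snoc sdegE -[(_.+2)]addn2 PoszD; ring.
Qed.

Lemma cyc_ext (V : lmodType k) (F G : cyc M -> V) :
  linear_map F -> linear_map G ->
  (forall Y Z (c : hc Y Z) (m : bm M Z Y) p, hdeg p m ->
     F (scyc_elt c m) = G (scyc_elt c m)) -> F =1 G.
Proof.
move=> HF HG H; apply: cyc_ind => [|a x y Ex Ey|//].
  by rewrite (lin0 HF) (lin0 HG).
by rewrite HF HG Ex Ey.
Qed.

Lemma twist_lact e Y' Y X (g : hh Y Y') (m : bm M Y X) :
  twist (bi_cplx HM Y' X) e (lact g m)
  = sgn k (e * hdg g) *: lact g (twist (bi_cplx HM Y X) e m).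
Proof.
have TL := twist_lin (bi_cplx HM Y X) e; have TL' := twist_lin (bi_cplx HM Y' X) e.
have LL := lact_lin HM (X := X) g.
move: m; apply: (homog_ext (bi_cplx HM Y X)) => [a x y|a x y|p x hx].
- by rewrite LL TL'.
- by rewrite TL LL scalerDr sgn_scaleC.
rewrite (twist_homog _ _ hx) (twist_homog _ _ (bi_lact_hdeg HM g hx)).
by rewrite (linZ LL) sgn_sgn mulrDr.
Qed.

Lemma twist0 Y X (m : bm M Y X) : twist (bi_cplx HM Y X) 0 m = m.
Proof.
move: m; apply: (homog_ext (bi_cplx HM Y X)) => [a x y|//|p x hx]; first exact: twist_lin.
by rewrite (twist_homog _ _ hx) mul0r sgn0 scale1r.
Qed.

Section Rec.
Variables (V : lmodType k) (G : forall Y Z, hc Y Z -> bm M Z Y -> V).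
Hypothesis G_chain : forall Y Z (m : bm M Z Y), multilinear (fun c => G c m).
Hypothesis G_mod : forall Y Z (c : hc Y Z), linear_map (@G Y Z c).

(** The value forced by [sym_cons_snoc]; the part of the sign that depends on the
    degree of m is carried by [twist]. *)
Definition unpad Y Z (c : hc Y Z) (m : bm M Z Y) : V :=
  head_elim 0 c (fun Y1 f0 c' => last_elim 0 c' (fun Z1 c0 f1 =>
    sgn k (hdg f0 * (cdeg c0 + hdg f1)) *:
    G c0 (lact f1 (ract (twist (bi_cplx HM Z Y) (hdg f0) m) f0)))).

Lemma unpad_cons_snoc Y Y1 Z1 Z (f0 : hh Y1 Y) (c : hc Y1 Z1) (f1 : hh Z Z1)
    (m : bm M Z Y) :
  unpad (hcons f0 (crcons c f1)) m = sgn k (hdg f0 * (cdeg c + hdg f1)) *: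
    G c (lact f1 (ract (twist (bi_cplx HM Z Y) (hdg f0) m) f0)).
Proof. by rewrite /unpad /= last_elim_snoc. Qed.

Lemma unpad_respects : respects_cyc_rel unpad.
Proof.
split.
- move=> Y Z m a c c1 c2 H; case: H m => {c c1 c2 Y Z}.
    move=> Y Z X f f1 f2 c e1 e2 ef m; rewrite /unpad /=.
    apply: last_elim_linL => W c0 g; rewrite e1 e2.
    rewrite (bi_ractLr HM _ e1 e2 ef) (lact_lin HM) G_mod scalerDr.
    by rewrite sgn_scaleC.
  move=> Y Z X f c c1 c2 H m; rewrite /unpad /=.
  move: a c c1 c2 H; apply: last_elim_multilinear => [W g a c c1 c2 H|].
    have [_ _ -> ->] := chain_lin_shape H.
    by rewrite (G_chain _ H) scalerDr sgn_scaleC.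
  move=> a W c g g1 g2 e1 e2 eg; rewrite e1 e2.
  by rewrite (bi_lactLl HM _ e1 e2 eg) G_mod scalerDr sgn_scaleC.
- move=> Y Z c a m1 m2; rewrite /unpad.
  case: c m1 m2 => [W|Y1 Y2 Y3 f c] m1 m2 /=; first by rewrite scaler0 addr0.
  apply: last_elim_linL => W c0 g.
  by rewrite twist_lin (ract_lin HM) (lact_lin HM) G_mod scalerDr sgn_scaleC.
- move=> Y Z [//|Y1 Y2 Y3 f c] m; rewrite /unpad /=.
  by case: c f m.
- move=> Y Z Z' [//|Y1 Y2 Y3 f0 c] g m sc.
  case: (snocP c) f0 g m sc => [//|Z1 Z2 Z3 d f1] f0 g m _.
  rewrite (@cract_snoc _ _ _ _ _ _ (hcons f0 d)) (_ : crcons (hcons f0 d) _ = hcons f0 (crcons d (hcomp f1 g))) // !unpad_cons_snoc.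
  rewrite twist_lact (linZ (ract_lin HM _)) (linZ (lact_lin HM _)).
  rewrite (linZ (G_mod _)) sgn_sgn (bi_lract HM) (bi_lactA HM).
  by congr (_ *: _); rewrite /=; parity.
- move=> Y Y' Z p f c; case: c f => [//|Y1 Y2 Y3 f0 c] f m hm sc.
  case: (snocP c) f f0 m hm sc => [//|Z1 Z2 Z3 d f1] f f0 m hm _.
  rewrite [clact _ _]/= !unpad_cons_snoc.
  rewrite (twist_homog _ _ hm) (twist_homog _ _ (bi_ract_hdeg HM f hm)).
  rewrite !(linZ (ract_lin HM _)) !(linZ (lact_lin HM _)) !(linZ (G_mod _)).
  rewrite (bi_ractA HM) !sgn_sgn; congr (_ *: _).
  by rewrite /bdeg /blen /= cdeg_snoc csize_snoc; parity.
Qed.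

(** Maps out of the complex can be prescribed freely on the symbols [c|m]. *)
Definition cyc_rec (x : cyc M) : V := cyc_lift unpad x.

Lemma cyc_rec_lin : linear_map cyc_rec.
Proof. exact: cyc_lift_lin unpad_respects. Qed.

Lemma cyc_rec_elt Y Z (c : hc Y Z) (m : bm M Z Y) : cyc_rec (cyc_elt c m) = G c m.
Proof.
rewrite [LHS](cyc_lift_sym unpad_respects) unpad_cons_snoc /=.
rewrite mul0r sgn0 scale1r twist0 -(bi_lract HM).
by rewrite (bi_lact1 HM) (bi_ract1 HM).
Qed.
End Rec.

(** The differential in terms of suspended symbols: all signs are Koszul signs
    for strings of entries of degree |c_i| - 1. *)
Lemma cdiff_scyc Y Z (c : hc Y Z) (m : bm M Z Y) p : hdeg p m ->
  cdiff (scyc_elt c m)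
  = sdint c (fun c' => scyc_elt c' m) + sfaces c (fun c' => scyc_elt c' m)
    + head_elim 0 c (fun W f c' =>
        sgn k (hdg f * (sdeg c' + p)) *: scyc_elt c' (ract m f))
    - last_elim 0 c (fun W c' f => sgn k (sdeg c') *: scyc_elt c' (lact f m))
    + sgn k (sdeg c) *: scyc_elt c (cdiff m).
Proof.
move=> hm; rewrite {1}/scyc_elt (linZ (cdiff_lin (cyc_complex HM))).
have -> : cdiff (cyc_elt c m) = sym_diff (pad c) m by exact: (cyc_diff_sym HM).
rewrite /sym_diff bdeg_pad blen_pad.
have -> : dint (pad c) (fun c' => cyc_sym c' m : cyc_mod M)
        = dint c (fun c' => cyc_elt c' m).
  have z0 : hval (hdiff (hid Y)) = 0 by exact: (dg_id_diff (dgP C)).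
  rewrite /= (head_zero (rc_chain R m) _ z0) add0r.
  rewrite sgn0 scale1r dint_snoc -[RHS]addr0; congr (_ + _).
  have z : hval (hdiff (hid Z)) = 0 by exact: (dg_id_diff (dgP C)).
  have := rc_chain R m (lin_there (hid Y) (@last_lin _ _ (-1) _ _ _ c (hdiff (hid Z))
    (hdiff (hid Z)) (hdiff (hid Z)) erefl erefl _)).
  move=> ->; last by rewrite z scaler0 addr0.
  by rewrite scaleN1r addNr scaler0.
rewrite sdintE sfacesE.
have -> : faces (pad c) (fun c' => cyc_sym c' m : cyc_mod M)
  = head_elim 0 c (fun W f c' =>
        sgn k (hdg f * (cdeg c' + p)) *: cyc_elt c' (ract m f))
    - faces c (fun c' => cyc_elt c' m)
    + sgn k (csize c) *: last_elim 0 c (fun W c' f => cyc_elt c' (lact f m)).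
  rewrite /pad faces_cons faces_snoc opprB addrA addrAC; congr (_ - _ + _ *: _).
    case: c m hm => [W|Y1 Y2 Y3 f c] m hm /=; first by rewrite (rc_short R).
    rewrite -(sym_clact_pad _ _ hm) /= hcomp1r.
    by rewrite hcomp1l.
  apply: last_elim_congr => W c0 f _.
  by rewrite hcomp1r -sym_cract_pad cract_pad.
rewrite !scalerDr !sgn_sgn scaleNr -!addrA scalerN; congr (_ + _).
rewrite addrCA; congr (_ + _); congr (_ + (_ + _)).
- case: c m hm => [W|Y1 Y2 Y3 f c] m hm /=; first by rewrite scaler0.
  rewrite cyc_elt_scyc !sgn_sgn; congr (_ *: _).
  by rewrite sdegE; parity.
- rewrite scaleN_sgn.
  case: (snocP c) m hm => [X|Y1 Z1 X1 d f] m hm; first by rewrite /= !scaler0.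
  rewrite !last_elim_snoc cyc_elt_scyc !sgn_sgn; congr (_ *: _).
  rewrite csize_snoc sdegE.
  suff -> : shift_exp (crcons d f) = shift_exp d + cdeg d by parity.
  elim: d X1 f {m hm} => [W|Y2 Z2 X2 g d IH] X1 f /=; first by ring.
  by rewrite IH csize_snoc -addn1 PoszD; ring.
- by rewrite addrC -sgn_sgn.
Qed.

End CycGenerators.

(** * Shuffles *)

Section ShuffleSums.
Variables (k : comPzRingType) (C : smdgcat k).
Local Notation hc := (hchain (C := C)).
Local Notation hh X Y := (helt (@dghom k C X Y)).

Lemma thom0l X X' Y Y' (g : @dghom k C Y Y') : (0 : @dghom k C X X') ⋆⋆ g = 0.
Proof.
have HL : linear_map (fun f : @dghom k C X X' => f ⋆⋆ g).
  by move=> a x y; exact: thomLl.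
exact: (lin0 HL).
Qed.

Lemma thom0r X X' Y Y' (f : @dghom k C X X') : f ⋆⋆ (0 : @dghom k C Y Y') = 0.
Proof.
have HL : linear_map (fun g : @dghom k C Y Y' => f ⋆⋆ g).
  by move=> a x y; exact: thomLr.
exact: (lin0 HL).
Qed.

Lemma hdiff_thoml Y X X' (f : hh X X') :
  hdiff (hthom f (hid Y)) = hthom (hdiff f) (hid Y).
Proof.
apply: helt_eq; last by rewrite /= !addr0.
rewrite /= (thom_diff _ (hvalP f)) (dg_id_diff (dgP C)).
by rewrite thom0r scaler0 addr0.
Qed.

Lemma hdiff_thomr Z X X' (f : hh X X') :
  hdiff (hthom (hid Z) f) = hthom (hid Z) (hdiff f).
Proof.
apply: helt_eq; last by rewrite /= !add0r.
rewrite /= (thom_diff _ (dg_id_hdeg (dgP C) Z)) (dg_id_diff (dgP C)).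
by rewrite thom0l sgn0 scale1r add0r.
Qed.

Lemma hcomp_thoml Y X X' X'' (f : hh X' X'') (g : hh X X') :
  hcomp (hthom f (hid Y)) (hthom g (hid Y)) = hthom (hcomp f g) (hid Y).
Proof.
apply: helt_eq; last by rewrite /= !addr0.
rewrite /= (thom_comp _ _ (hvalP g) (dg_id_hdeg (dgP C) Y)).
by rewrite mul0r sgn0 scale1r (dg_comp1l (dgP C)).
Qed.

Lemma hcomp_thomr Z X X' X'' (f : hh X' X'') (g : hh X X') :
  hcomp (hthom (hid Z) f) (hthom (hid Z) g) = hthom (hid Z) (hcomp f g).
Proof.
apply: helt_eq; last by rewrite /= !add0r.
rewrite /= (thom_comp _ _ (dg_id_hdeg (dgP C) Z) (hvalP f)).
by rewrite mulr0 sgn0 scale1r (dg_comp1l (dgP C)).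
Qed.

Lemma hcomp_thom X X' Y Y' (f : hh X X') (g : hh Y Y') :
  hcomp (hthom f (hid Y')) (hthom (hid X) g) = hthom f g.
Proof.
apply: helt_eq; last by rewrite /= add0r addr0.
rewrite /= (thom_comp _ _ (dg_id_hdeg (dgP C) X) (dg_id_hdeg (dgP C) Y')).
by rewrite mulr0 sgn0 scale1r (dg_comp1l (dgP C)) (dg_comp1r (dgP C)).
Qed.

Lemma hcomp_thom_swap X X' Y Y' (f : hh X X') (g : hh Y Y') :
  hval (hcomp (hthom (hid X') g) (hthom f (hid Y)))
  = sgn k (hdg g * hdg f) *: hval (hthom f g).
Proof.
rewrite /= (thom_comp _ _ (hvalP f) (hvalP g)).
by rewrite (dg_comp1l (dgP C)) (dg_comp1r (dgP C)).
Qed.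

(** Shuffles are used only through sums of a function over them, so that no
    formal combination of strings has to be manipulated. *)
Definition shuffle_sum (V : lmodType k) Z Z' (d : hc Z Z') Y Y' (c : hc Y Y')
    (K : hc (Z ⋆ Y) (Z' ⋆ Y') -> V) : V :=
  \sum_(t <- shuffle d c) t.1 *: K t.2.

Section Unfold.
Variable V : lmodType k.

Lemma shuffle_nil_nil Z Y (K : hc (Z ⋆ Y) (Z ⋆ Y) -> V) :
  shuffle_sum (hnil Z) (hnil Y) K = K (hnil _).
Proof. by rewrite /shuffle_sum big_seq1 scale1r. Qed.

Lemma shuffle_nil_cons Z Y Y1 Y' (c1 : hh Y1 Y) (c : hc Y1 Y')
    (K : hc (Z ⋆ Y) (Z ⋆ Y') -> V) :
  shuffle_sum (hnil Z) (hcons c1 c) K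
  = shuffle_sum (hnil Z) c (fun t => K (hcons (hthom (hid Z) c1) t)).
Proof. by rewrite /shuffle_sum !big_seq1. Qed.

Lemma shuffle_cons_nil Z Z1 Z' Y (d1 : hh Z1 Z) (d : hc Z1 Z')
    (K : hc (Z ⋆ Y) (Z' ⋆ Y) -> V) :
  shuffle_sum (hcons d1 d) (hnil Y) K
  = shuffle_sum d (hnil Y) (fun t => K (hcons (hthom d1 (hid Y)) t)).
Proof. by rewrite /shuffle_sum; case: d d1 K => *; rewrite !big_seq1. Qed.

Lemma shuffle_cons_cons Z Z1 Z' Y Y1 Y' (d1 : hh Z1 Z) (d : hc Z1 Z')
    (c1 : hh Y1 Y) (c : hc Y1 Y') (K : hc (Z ⋆ Y) (Z' ⋆ Y') -> V) :
  shuffle_sum (hcons d1 d) (hcons c1 c) K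
  = shuffle_sum d (hcons c1 c) (fun t => K (hcons (hthom d1 (hid Y)) t))
    + sgn k ((hdg c1 - 1) * sdeg (hcons d1 d)) *:
      shuffle_sum (hcons d1 d) c (fun t => K (hcons (hthom (hid Z) c1) t)).
Proof.
rewrite /shuffle_sum [shuffle _ _]/= big_cat !big_map /=; congr (_ + _).
by rewrite scaler_sumr; apply: eq_bigr => t _; rewrite scalerA.
Qed.

Lemma shuffleL Z Z' (d : hc Z Z') Y Y' (c : hc Y Y') a
    (K K' : hc (Z ⋆ Y) (Z' ⋆ Y') -> V) :
  shuffle_sum d c (fun t => a *: K t + K' t)
  = a *: shuffle_sum d c K + shuffle_sum d c K'.
Proof.
rewrite /shuffle_sum scaler_sumr -big_split; apply: eq_bigr => t _ /=.
by rewrite scalerDr !scalerA mulrC.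
Qed.

Lemma shuffleZ Z Z' (d : hc Z Z') Y Y' (c : hc Y Y') a
    (K : hc (Z ⋆ Y) (Z' ⋆ Y') -> V) :
  shuffle_sum d c (fun t => a *: K t) = a *: shuffle_sum d c K.
Proof.
rewrite /shuffle_sum scaler_sumr; apply: eq_bigr => t _ /=.
by rewrite !scalerA mulrC.
Qed.

Lemma shuffleN Z Z' (d : hc Z Z') Y Y' (c : hc Y Y')
    (K : hc (Z ⋆ Y) (Z' ⋆ Y') -> V) :
  shuffle_sum d c (fun t => - K t) = - shuffle_sum d c K.
Proof.
by rewrite /shuffle_sum -sumrN; apply: eq_bigr => t _; rewrite scalerN.
Qed.

Lemma shuffleD Z Z' (d : hc Z Z') Y Y' (c : hc Y Y')
    (K K' : hc (Z ⋆ Y) (Z' ⋆ Y') -> V) :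
  shuffle_sum d c (fun t => K t + K' t) = shuffle_sum d c K + shuffle_sum d c K'.
Proof.
rewrite /shuffle_sum -big_split; apply: eq_bigr => t _ /=.
by rewrite scalerDr.
Qed.

Lemma shuffle_map (W : lmodType k) (F : V -> W) : linear_map F ->
  forall Z Z' (d : hc Z Z') Y Y' (c : hc Y Y') (K : hc (Z ⋆ Y) (Z' ⋆ Y') -> V),
  F (shuffle_sum d c K) = shuffle_sum d c (fun t => F (K t)).
Proof.
move=> HF *; rewrite /shuffle_sum (lin_sum HF); apply: eq_bigr => t _.
exact: (linZ HF).
Qed.

End Unfold.

Definition shuffleE := (shuffle_nil_nil, shuffle_nil_cons, shuffle_cons_nil,
  shuffle_cons_cons).

Lemma shuffle_congr (V : lmodType k) Z Z' (d : hc Z Z') Y Y' (c : hc Y Y')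
    (K K' : hc (Z ⋆ Y) (Z' ⋆ Y') -> V) :
  (forall t, csize t = (csize d + csize c)%N -> cdeg t = cdeg d + cdeg c ->
     K t = K' t) ->
  shuffle_sum d c K = shuffle_sum d c K'.
Proof.
elim: d Y Y' c K K' => [{}Z|{}Z Z1 {}Z' d1 d IHd] Y Y' c.
  elim: c => [{}Y|{}Y Y1 {}Y' c1 c IHc] K K' H; rewrite !shuffleE.
    by apply: H.
  by apply: IHc => t es ed; apply: H; rewrite /= ?es ?ed // !add0r.
elim: c => [{}Y|{}Y Y1 {}Y' c1 c IHc] K K' H; rewrite !shuffleE.
  by apply: IHd => t es ed; apply: H; rewrite /= ?es ?ed // !addr0.
congr (_ + _ *: _).
  by apply: IHd => t es ed; apply: H; rewrite /= ?es ?ed // addr0 addrA.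
by apply: IHc => t es ed; apply: H; rewrite /= ?es ?ed ?addnS // add0r addrCA.
Qed.

Lemma shuffle_lin1 (V : lmodType k) Z Z' Y Y' (c : hc Y Y')
    (K : hc (Z ⋆ Y) (Z' ⋆ Y') -> V) :
  multilinear K -> multilinear (fun d => shuffle_sum d c K).
Proof.
move=> HK a d d1 d2 H; elim: H Y Y' c K HK => {d d1 d2 Z Z'}.
  move=> Z W Z' f f1 f2 d e1 e2 ef Y Y' c.
  elim: c => [{}Y|{}Y Y1 {}Y' c1 c IHc] K HK; rewrite !shuffleE -?shuffleL.
    apply: shuffle_congr => t _ _; apply: (head_lin HK); rewrite /= ?e1 ?e2 //.
    by rewrite ef thomLl.
  rewrite /= e1 e2 (IHc _ (multilinear_cons (hthom (hid Z) c1) HK)).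
  rewrite !scalerDr !scalerA [_ * a]mulrC addrACA -shuffleL; congr (_ + _).
  apply: shuffle_congr => t _ _; apply: (head_lin HK); rewrite /= ?e1 ?e2 //.
  by rewrite ef thomLl.
move=> Z W Z' f d d1 d2 H IH Y Y' c.
have [s1 s2 g1 g2] := chain_lin_shape H.
elim: c => [{}Y|{}Y Y1 {}Y' c1 c IHc] K HK; rewrite !shuffleE.
  exact: (IH _ _ _ _ (multilinear_cons (hthom f (hid Y)) HK)).
rewrite (IH _ _ _ _ (multilinear_cons (hthom f (hid Y)) HK)).
rewrite (IHc _ (multilinear_cons (hthom (hid Z) c1) HK)).
by rewrite /= !sdegE s1 s2 g1 g2 !scalerDr !scalerA [_ * a]mulrC addrACA.
Qed.

Lemma shuffle_lin2 (V : lmodType k) Z Z' Y Y' (d : hc Z Z')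
    (K : hc (Z ⋆ Y) (Z' ⋆ Y') -> V) :
  multilinear K -> multilinear (fun c => shuffle_sum d c K).
Proof.
elim: d Y Y' K => [{}Z|{}Z Z1 {}Z' d1 d IHd] Y Y' K HK a c c1 c2 H;
    elim: H K HK => {c c1 c2 Y Y'}.
- move=> Y W Y' f f1 f2 c e1 e2 ef K HK; rewrite !shuffleE -shuffleL.
  apply: shuffle_congr => t _ _; apply: (head_lin HK); rewrite /= ?e1 ?e2 //.
  by rewrite ef thomLr.
- move=> Y W Y' f c c1 c2 H IH K HK; rewrite !shuffleE.
  exact: (IH _ (multilinear_cons (hthom (hid Z) f) HK)).
- move=> Y W Y' f f1 f2 c e1 e2 ef K HK; rewrite !shuffleE.
  rewrite (IHd _ _ _ (multilinear_cons _ HK) a _ _ _ (lin_here c e1 e2 ef)) e1 e2.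
  rewrite scalerDr !sgn_scaleC addrACA -scalerDr -shuffleL; congr (_ + _ *: _).
  apply: shuffle_congr => t _ _; apply: (head_lin HK); rewrite /= ?e1 ?e2 //.
  by rewrite ef thomLr.
move=> Y W Y' f c c1 c2 H IH K HK; rewrite !shuffleE.
rewrite (IHd _ _ _ (multilinear_cons _ HK) a _ _ _ (lin_there f H)).
rewrite (IH _ (multilinear_cons (hthom (hid Z) f) HK)).
by rewrite !scalerDr !sgn_scaleC addrACA.
Qed.

Lemma sdintD (V : lmodType k) Y X (c : hc Y X) (K K' : hc Y X -> V) :
  sdint c (fun c' => K c' + K' c') = sdint c K + sdint c K'.
Proof.
elim: c K K' => [?|{}Y Z {}X f c IH] K K' /=; first by rewrite addr0.
by rewrite IH scalerDr !opprD addrACA.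
Qed.

Lemma sfacesD (V : lmodType k) Y X (c : hc Y X) (K K' : hc Y X -> V) :
  sfaces c (fun c' => K c' + K' c') = sfaces c K + sfaces c K'.
Proof.
elim: c K K' => [?|{}Y Z {}X f c IH] K K' /=; first by rewrite addr0.
by rewrite IH mergeD !scalerDr !opprD addrACA.
Qed.

Lemma sdint_cons (V : lmodType k) Y Z X (f : hh Z Y) (c : hc Z X)
    (K : hc Y X -> V) :
  sdint (hcons f c) K
  = - K (hcons (hdiff f) c) - sgn k (hdg f) *: sdint c (fun c' => K (hcons f c')).
Proof. by []. Qed.

Lemma sfaces_cons (V : lmodType k) Y Z X (f : hh Z Y) (c : hc Z X)
    (K : hc Y X -> V) :
  sfaces (hcons f c) K = - sgn k (hdg f) *: merge_head f c K
    - sgn k (hdg f) *: sfaces c (fun c' => K (hcons f c')).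
Proof. by []. Qed.

Lemma shuffle_sdint (V : lmodType k) Z Z' (d : hc Z Z') Y Y' (c : hc Y Y')
    (K : hc (Z ⋆ Y) (Z' ⋆ Y') -> V) :
  shuffle_sum d c (fun t => sdint t K)
  = sdint d (fun d' => shuffle_sum d' c K)
    + sgn k (sdeg d) *: sdint c (fun c' => shuffle_sum d c' K).
Proof.
elim: d Y Y' c K => [{}Z|{}Z Z1 {}Z' d1 d IHd] Y Y' c.
  elim: c => [{}Y|{}Y Y1 {}Y' c1 c IHc] K; rewrite !shuffleE.
    by rewrite /= scaler0 addr0.
  under shuffle_congr => t _ _ do rewrite sdint_cons hdiff_thomr.
  rewrite shuffleD !shuffleN shuffleZ IHc sdint_cons shuffleE.
  rewrite (@sdint_congr _ _ _ _ _ c _ (fun c' => shuffle_sum (hnil Z) c'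
    (fun t => K (hcons (hthom (hid Z) c1) t)))); last first.
    by move=> *; rewrite shuffleE.
  by rewrite /= add0r !sgn0 !scale1r !add0r.
elim: c => [{}Y|{}Y Y1 {}Y' c1 c IHc] K; rewrite !shuffleE.
  under shuffle_congr => t _ _ do rewrite sdint_cons hdiff_thoml.
  rewrite shuffleD !shuffleN shuffleZ IHd sdint_cons shuffleE.
  rewrite (@sdint_congr _ _ _ _ _ d _ (fun d' => shuffle_sum d' (hnil Y)
    (fun t => K (hcons (hthom d1 (hid Y)) t)))); last first.
    by move=> *; rewrite shuffleE.
  by rewrite /= addr0 !scaler0 !addr0.
under shuffle_congr => t _ _ do rewrite sdint_cons hdiff_thoml.
under [X in _ + _ *: X]shuffle_congr => t _ _ do rewrite sdint_cons hdiff_thomr.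
rewrite !shuffleD !shuffleN !shuffleZ IHd IHc !sdint_cons !shuffleE.
rewrite (@sdint_congr _ _ _ _ _ d (fun d' => shuffle_sum (hcons d1 d') (hcons c1 c) K)
  (fun d' => shuffle_sum d' (hcons c1 c) (fun t => K (hcons (hthom d1 (hid Y)) t))
   + sgn k ((hdg c1 - 1) * (sdeg (hcons d1 d) + 1)) *: shuffle_sum (hcons d1 d') c
       (fun t => K (hcons (hthom (hid Z) c1) t)))); last first.
  move=> d' es ed; rewrite shuffle_cons_cons /= !sdegE es ed; congr (_ + sgn k _ *: _).
  by ring.
rewrite (@sdint_congr _ _ _ _ _ c (fun c' => shuffle_sum (hcons d1 d) (hcons c1 c') K)
  (fun c' => shuffle_sum d (hcons c1 c') (fun t => K (hcons (hthom d1 (hid Y)) t))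
   + sgn k ((hdg c1 - 1) * sdeg (hcons d1 d)) *: shuffle_sum (hcons d1 d) c'
       (fun t => K (hcons (hthom (hid Z) c1) t)))); last first.
  by move=> *; rewrite shuffleE.
rewrite !sdintD !sdintZ.
sgn_match.
Qed.

End ShuffleSums.

(** ** Faces of a shuffle *)

Section ShuffleFaces.
Variables (k : comPzRingType) (C : smdgcat k).
Local Notation hc := (hchain (C := C)).
Local Notation hh X Y := (helt (@dghom k C X Y)).

(** In a shuffle, the entry after d_1 * Id comes from the same string, or it is
    the first entry Id * c_1 of the other one; the latter case gives the mixed
    product d_1 * c_1. *)
Lemma shuffle_merge_l (V : lmodType k) Z Z1 Z' Y Y' (d1 : hh Z1 Z) (d : hc Z1 Z')
    (c : hc Y Y') (K : hc (Z ⋆ Y) (Z' ⋆ Y') -> V) :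
  shuffle_sum d c (fun t => merge_head (hthom d1 (hid Y)) t K)
  = head_elim 0 d (fun W d2 d' =>
      shuffle_sum d' c (fun t => K (hcons (hthom (hcomp d1 d2) (hid Y)) t)))
    + head_elim 0 c (fun W c1 c' => sgn k ((hdg c1 - 1) * sdeg d) *:
      shuffle_sum d c' (fun t => K (hcons (hthom d1 c1) t))).
Proof.
case: d d1 K => [X|Z2 Z3 X d2 d] d1 K; case: c K => [W|Y1 Y2 W c1 c] K;
  rewrite !shuffleE [head_elim _ _ _]/= [head_elim _ _ _]/= ?addr0 ?add0r //=.
- rewrite mulr0 sgn0 scale1r; apply: shuffle_congr => t _ _ /=.
  by rewrite hcomp_thom.
- by apply: shuffle_congr => t _ _ /=; rewrite hcomp_thoml.
- congr (_ + _ *: _); apply: shuffle_congr => t _ _ /=.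
    by rewrite hcomp_thoml.
  by rewrite hcomp_thom.
Qed.

(** As in [shuffle_merge_l], but the mixed product now appears in the wrong order,
    so the interchange law contributes (-1)^(|c_1||d_1|). *)
Lemma shuffle_merge_r (V : lmodType k) Z Z' Y Y1 Y' (d : hc Z Z') (c1 : hh Y1 Y)
    (c : hc Y1 Y') (K : hc (Z ⋆ Y) (Z' ⋆ Y') -> V) : multilinear K ->
  shuffle_sum d c (fun t => merge_head (hthom (hid Z) c1) t K)
  = head_elim 0 d (fun W d1 d' => sgn k (hdg c1 * hdg d1) *:
      shuffle_sum d' c (fun t => K (hcons (hthom d1 c1) t)))
    + head_elim 0 c (fun W c2 c' => sgn k ((hdg c2 - 1) * sdeg d) *:
      shuffle_sum d c' (fun t => K (hcons (hthom (hid Z) (hcomp c1 c2)) t))).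
Proof.
have swap W (d1 : hh W Z) t (HK : multilinear K) :
    K (hcons (hcomp (hthom (hid Z) c1) (hthom d1 (hid Y1))) t)
    = sgn k (hdg c1 * hdg d1) *: K (hcons (hthom d1 c1) t).
  apply: (head_scale HK); last exact: hcomp_thom_swap.
  by rewrite /= add0r addr0 addrC.
move=> HK; move/(_ _ _ _ HK): swap => swap.
case: c c1 K {HK} swap => [W|Y2 Y3 W c2 c] c1 K swap;
 case: d K swap => [X|Z2 Z3 X d1 d] K swap;
  rewrite !shuffleE [head_elim _ _ _]/= [head_elim _ _ _]/= ?addr0 ?add0r //=.
- by rewrite -shuffleZ; apply: shuffle_congr => t _ _ /=; exact: swap.
- rewrite mulr0 sgn0 scale1r; apply: shuffle_congr => t _ _ /=.
  by rewrite hcomp_thomr.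
- rewrite -[sgn k (hdg c1 * hdg d1) *: _]shuffleZ; congr (_ + _ *: _); apply: shuffle_congr => t _ _ /=.
    exact: swap.
  by rewrite hcomp_thomr.
Qed.

Lemma merge_shuffle1 (V : lmodType k) Z Z1 Z' Y Y1 Y' (d1 : hh Z1 Z)
    (d : hc Z1 Z') (c1 : hh Y1 Y) (c : hc Y1 Y')
    (K : hc (Z ⋆ Y) (Z' ⋆ Y') -> V) :
  merge_head d1 d (fun d' => shuffle_sum d' (hcons c1 c) K)
  = head_elim 0 d (fun W d2 d' => shuffle_sum d' (hcons c1 c)
      (fun t => K (hcons (hthom (hcomp d1 d2) (hid Y)) t)))
    + sgn k ((hdg c1 - 1) * (sdeg (hcons d1 d) + 1)) *:
      merge_head d1 d (fun d' => shuffle_sum d' c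
        (fun t => K (hcons (hthom (hid Z) c1) t))).
Proof.
case: d d1 K => [X|Z2 Z3 X d2 d] d1 K; rewrite /= ?scaler0 ?addr0 //.
by rewrite shuffle_cons_cons; congr (_ + _ *: _); parity.
Qed.

Lemma merge_shuffle2 (V : lmodType k) Z Z1 Z' Y Y1 Y' (d1 : hh Z1 Z)
    (d : hc Z1 Z') (c1 : hh Y1 Y) (c : hc Y1 Y')
    (K : hc (Z ⋆ Y) (Z' ⋆ Y') -> V) :
  merge_head c1 c (fun c' => shuffle_sum (hcons d1 d) c' K)
  = merge_head c1 c (fun c' => shuffle_sum d c'
      (fun t => K (hcons (hthom d1 (hid Y)) t)))
    + head_elim 0 c (fun W c2 c' =>
        sgn k ((hdg c1 + hdg c2 - 1) * sdeg (hcons d1 d)) *: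
        shuffle_sum (hcons d1 d) c'
          (fun t => K (hcons (hthom (hid Z) (hcomp c1 c2)) t))).
Proof.
case: c c1 K => [X|Z2 Z3 X c2 c] c1 K; rewrite /= ?scaler0 ?addr0 //.
by rewrite shuffle_cons_cons.
Qed.

Lemma head_elimZ (V : lmodType k) Y X (c : hc Y X) a
    (L : forall Z, hh Z Y -> hc Z X -> V) :
  head_elim 0 c (fun Z f c' => a *: L Z f c') = a *: head_elim 0 c L.
Proof. by case: c L => [?|Y1 Y2 Y3 f c] L //=; rewrite scaler0. Qed.

Lemma head_elim_congr (V : Type) (v0 : V) Y X (c : hc Y X)
    (L L' : forall Z, hh Z Y -> hc Z X -> V) :
  (forall Z f c0, sdeg c = hdg f - 1 + sdeg c0 -> L Z f c0 = L' Z f c0) ->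
  head_elim v0 c L = head_elim v0 c L'.
Proof. by case: c L L' => [?|Y1 Y2 Y3 f c] L L' H //=; exact: H. Qed.

(** The mixed faces cancel: exchanging d_1 * Id and Id * c_1 changes the shuffle
    sign by (|c_1| - 1)(|d_1| - 1), the face sign by |c_1| - |d_1| and the product
    by |c_1||d_1|, altogether by -1. *)
Lemma shuffle_sfaces (V : lmodType k) Z Z' (d : hc Z Z') Y Y' (c : hc Y Y')
    (K : hc (Z ⋆ Y) (Z' ⋆ Y') -> V) : multilinear K ->
  shuffle_sum d c (fun t => sfaces t K)
  = sfaces d (fun d' => shuffle_sum d' c K)
    + sgn k (sdeg d) *: sfaces c (fun c' => shuffle_sum d c' K).
Proof.
elim: d Y Y' c K => [{}Z|{}Z Z1 {}Z' d1 d IHd] Y Y' c.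
  elim: c => [{}Y|{}Y Y1 {}Y' c1 c IHc] K HK; rewrite !shuffleE.
    by rewrite /= scaler0 addr0.
  under shuffle_congr => t _ _ do rewrite sfaces_cons.
  rewrite shuffleD !shuffleN !shuffleZ (IHc _ (multilinear_cons _ HK)) !sfaces_cons.
  rewrite (shuffle_merge_r _ _ _ HK).
  rewrite (@sfaces_congr _ _ _ _ _ c _ (fun c' => shuffle_sum (hnil Z) c'
    (fun t => K (hcons (hthom (hid Z) c1) t)))); last first.
    by move=> *; rewrite shuffleE.
  rewrite /= !add0r !sgn0 !scale1r; congr (_ *: _ - _).
  case: c c1 K {IHc HK} => [W|Z2 Z3 W c2 c] c1 K //=.
  by rewrite shuffleE mulr0 sgn0 scale1r.
elim: c => [{}Y|{}Y Y1 {}Y' c1 c IHc] K HK; rewrite !shuffleE.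
  under shuffle_congr => t _ _ do rewrite sfaces_cons.
  rewrite shuffleD !shuffleN !shuffleZ (IHd _ _ _ _ (multilinear_cons _ HK)) !sfaces_cons.
  rewrite shuffle_merge_l.
  rewrite (@sfaces_congr _ _ _ _ _ d _ (fun d' => shuffle_sum d' (hnil Y)
    (fun t => K (hcons (hthom d1 (hid Y)) t)))); last first.
    by move=> *; rewrite shuffleE.
  rewrite /= !addr0 !scaler0 !addr0; congr (_ *: _ - _).
  case: d d1 K {IHd HK} => [W|Z2 Z3 W d2 d] d1 K //=.
  by rewrite shuffleE.
under shuffle_congr => t _ _ do rewrite sfaces_cons.
under [X in _ + _ *: X]shuffle_congr => t _ _ do rewrite sfaces_cons.
rewrite !shuffleD !shuffleN !shuffleZ.
rewrite (IHd _ _ _ _ (multilinear_cons _ HK)) (IHc _ (multilinear_cons _ HK)).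
rewrite shuffle_merge_l (shuffle_merge_r _ _ _ HK) !sfaces_cons.
rewrite (@sfaces_congr _ _ _ _ _ d (fun d' => shuffle_sum (hcons d1 d') (hcons c1 c) K)
  (fun d' => shuffle_sum d' (hcons c1 c) (fun t => K (hcons (hthom d1 (hid Y)) t))
   + sgn k ((hdg c1 - 1) * (sdeg (hcons d1 d) + 1)) *: shuffle_sum (hcons d1 d') c
       (fun t => K (hcons (hthom (hid Z) c1) t)))); last first.
  move=> d' es ed; rewrite shuffle_cons_cons /= !sdegE -es ed -addn1 PoszD.
  by congr (_ + sgn k _ *: _); ring.
rewrite (@sfaces_congr _ _ _ _ _ c (fun c' => shuffle_sum (hcons d1 d) (hcons c1 c') K)
  (fun c' => shuffle_sum d (hcons c1 c') (fun t => K (hcons (hthom d1 (hid Y)) t))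
   + sgn k ((hdg c1 - 1) * sdeg (hcons d1 d)) *: shuffle_sum (hcons d1 d) c'
       (fun t => K (hcons (hthom (hid Z) c1) t)))); last first.
  by move=> *; rewrite shuffle_cons_cons.
rewrite !sfacesD !sfacesZ merge_shuffle1 merge_shuffle2.
rewrite [head_elim 0 (hcons _ _) _]/= [head_elim 0 (hcons _ _) _]/=.
have -> : head_elim 0 c (fun W c2 c' => sgn k ((hdg c2 - 1) * sdeg (hcons d1 d)) *:
      shuffle_sum (hcons d1 d) c'
        (fun t => K (hcons (hthom (hid Z) (hcomp c1 c2)) t)))
  = sgn k (hdg c1 * sdeg (hcons d1 d)) *: head_elim 0 c (fun W c2 c' =>
        sgn k ((hdg c1 + hdg c2 - 1) * sdeg (hcons d1 d)) *:
        shuffle_sum (hcons d1 d) c'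
          (fun t => K (hcons (hthom (hid Z) (hcomp c1 c2)) t))).
  rewrite -head_elimZ; apply: head_elim_congr => W c2 c' _.
  by rewrite sgn_sgn; congr (_ *: _); parity.
(* The two mixed faces on the left, with opposite signs, are added to the right
   as a zero so that all terms match up. *)
rewrite -[RHS]addr0 (sgn_pair (1 + hdg d1 + (hdg c1 - 1) * sdeg d)
  (shuffle_sum d c (fun t => K (hcons (hthom d1 c1) t)))).
sgn_match.
Qed.

Lemma shuffle_head (V : lmodType k) Z Z' (d : hc Z Z') Y Y' (c : hc Y Y')
    (L : forall W, hh W (Z ⋆ Y) -> hc W (Z' ⋆ Y') -> V) :
  shuffle_sum d c (fun t => head_elim 0 t L)
  = head_elim 0 d (fun W d1 d' =>
      shuffle_sum d' c (fun t => L _ (hthom d1 (hid Y)) t))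
    + head_elim 0 c (fun W c1 c' => sgn k ((hdg c1 - 1) * sdeg d) *:
      shuffle_sum d c' (fun t => L _ (hthom (hid Z) c1) t)).
Proof.
case: d L => [X|Z1 Z2 X d1 d] L; case: c L => [W|Y1 Y2 W c1 c] L;
  rewrite !shuffleE /= ?addr0 ?add0r //.
by rewrite mulr0 sgn0 scale1r.
Qed.

Lemma last_elim_cons (V : Type) (v0 : V) Y Z X (f : hh Z Y) (c : hc Z X)
    (L : forall W, hc Y W -> hh X W -> V) : (0 < csize c)%N ->
  last_elim v0 (hcons f c) L = last_elim v0 c (fun W c0 g => L W (hcons f c0) g).
Proof. by case: c f L. Qed.

Lemma last_elim_cons_snoc (V : Type) (v0 : V) Y Z W X (f : hh Z Y) (c : hc Z W)
    (g : hh X W) (L : forall W, hc Y W -> hh X W -> V) :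
  last_elim v0 (hcons f (crcons c g)) L = L W (hcons f c) g.
Proof. exact: (last_elim_snoc v0 (hcons f c) g L). Qed.

(** Shuffles are defined by recursion on their first entry; this is the recursion
    on the last one.  If the last entry is d_s * Id, it has passed all of [c]. *)
Lemma shuffle_last (V : lmodType k) Z Z' (d : hc Z Z') Y Y' (c : hc Y Y')
    (L : forall W, hc (Z ⋆ Y) W -> hh (Z' ⋆ Y') W -> V) :
  shuffle_sum d c (fun t => last_elim 0 t L)
  = last_elim 0 d (fun W d0 ds => sgn k ((hdg ds - 1) * sdeg c) *:
      shuffle_sum d0 c (fun t => L _ t (hthom ds (hid Y'))))
    + last_elim 0 c (fun W c0 cr =>
      shuffle_sum d c0 (fun t => L _ t (hthom (hid Z') cr))).
Proof.
elim: d Y Y' c L => [{}Z|{}Z Z1 {}Z' d1 d IHd] Y Y' c.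
  elim: c => [{}Y|{}Y Y1 {}Y' c1 c IHc] L; rewrite !shuffleE.
    by rewrite /= addr0.
  case: (snocP c) c1 L IHc => [X|Y2 Y3 X c' cr] c1 L IHc.
    by rewrite !shuffleE /= add0r shuffleE.
  rewrite last_elim_cons_snoc /= add0r shuffleE.
  rewrite (@shuffle_congr _ _ _ _ _ (hnil Z) _ _ (crcons c' cr) _ (fun t => last_elim 0 t (fun W t0 g =>
    L W (hcons (hthom (hid Z) c1) t0) g))); last first.
    by move=> t es _; apply: last_elim_cons; rewrite es csize_snoc.
  by rewrite IHc last_elim_snoc /= add0r.
elim: c => [{}Y|{}Y Y1 {}Y' c1 c IHc] L; rewrite !shuffleE.
  case: (snocP d) d1 L IHd => [X|Y2 Y3 X d' ds] d1 L IHd.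
    by rewrite !shuffleE /= mulr0 sgn0 scale1r addr0 shuffleE.
  rewrite last_elim_cons_snoc /= addr0 shuffleE mulr0 sgn0 scale1r.
  rewrite (@shuffle_congr _ _ _ _ _ (crcons d' ds) _ _ (hnil Y) _ (fun t => last_elim 0 t (fun W t0 g =>
    L W (hcons (hthom d1 (hid Y)) t0) g))); last first.
    by move=> t es _; apply: last_elim_cons; rewrite es csize_snoc.
  by rewrite IHd last_elim_snoc /= addr0 mulr0 sgn0 scale1r.
rewrite (@shuffle_congr _ _ _ _ _ d _ _ (hcons c1 c) _ (fun t => last_elim 0 t (fun W t0 g =>
    L W (hcons (hthom d1 (hid Y)) t0) g))); last first.
  by move=> t es _; rewrite last_elim_cons // es addnS.
rewrite (@shuffle_congr _ _ _ _ _ (hcons d1 d) _ _ c _ (fun t => last_elim 0 t (fun W t0 g =>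
    L W (hcons (hthom (hid Z) c1) t0) g))); last first.
  by move=> t es _; rewrite last_elim_cons // es.
rewrite IHd IHc.
case: (snocP d) d1 L {IHd IHc} => [X|Y2 Y3 X d' ds] d1 L;
  case: (snocP c) c1 L => [W|Z2 Z3 W c' cr] c1 L;
  rewrite ?last_elim_cons_snoc ?last_elim_snoc ?[last_elim _ (hnil _) _]/=
    ?[last_elim _ (hcons _ (hnil _)) _]/= ?shuffleE ?sdeg_cons
    ?sdeg_snoc; sgn_match.
Qed.
End ShuffleFaces.

(** * Equality across the strict associator *)

Section Total.
Variables (O : Type) (A : O -> O -> Type).

(** Total-space points forget which propositionally equal name an object has;
    [tot f = tot g] is heterogeneous equality, but unlike equality of types it
    recovers the equality of end points. *)
Definition tot X Y (f : A X Y) : {XY : O * O & A XY.1 XY.2} :=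
  existT (fun XY => A XY.1 XY.2) (X, Y) f.

Lemma tot_inj X Y (f g : A X Y) : tot f = tot g -> f = g.
Proof. exact: inj_pair2. Qed.

Lemma tot_ends X Y X' Y' (f : A X Y) (g : A X' Y') :
  tot f = tot g -> X = X' /\ Y = Y'.
Proof. by move=> /(congr1 (@projT1 _ _)) [-> ->]. Qed.
End Total.
Arguments tot {O A X Y} f.

Notation totH f := (@tot _ (fun X Y => car (dghom X Y)) _ _ f).
Notation totC c := (@tot _ (@hchain _ _) _ _ c).

Section CastFacts.
Variables (k : comPzRingType) (D : dgcat k).
Local Notation hom := (@dghom k D).

Lemma tot_castH X X' Y Y' (eX : X = X') (eY : Y = Y') (f : hom X Y) :
  totH (castH eX eY f) = totH f.
Proof. by subst. Qed.

Lemma castH_lin X X' Y Y' (eX : X = X') (eY : Y = Y') :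
  linear_map (castH eX eY : hom X Y -> hom X' Y').
Proof. by subst. Qed.

Lemma castH_hdeg X X' Y Y' (eX : X = X') (eY : Y = Y') (f : hom X Y) n :
  hdeg n f -> hdeg n (castH eX eY f).
Proof. by subst. Qed.

Lemma castH_diff X X' Y Y' (eX : X = X') (eY : Y = Y') (f : hom X Y) :
  cdiff (castH eX eY f) = castH eX eY (cdiff f).
Proof. by subst. Qed.

Lemma castH_comp X X' Y Y' Z Z' (eX : X = X') (eY : Y = Y') (eZ : Z = Z')
    (f : hom Y Z) (g : hom X Y) :
  castH eX eZ (f ∘ g) = castH eY eZ f ∘ castH eX eY g.
Proof. by subst. Qed.

Lemma tot_comp X Y Z X' Y' Z' (f : hom Y Z) (g : hom X Y) (f' : hom Y' Z')
    (g' : hom X' Y') : totH f = totH f' -> totH g = totH g' ->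
  totH (f ∘ g) = totH (f' ∘ g').
Proof.
move=> ef eg; have [e1 e2] := tot_ends ef; have [e3 e4] := tot_ends eg.
by subst; rewrite (tot_inj ef) (tot_inj eg).
Qed.

Lemma tot_hcons Y Z X Y' Z' X' (f : helt (hom Z Y)) (f' : helt (hom Z' Y'))
    (c : hchain Z X) (c' : hchain Z' X') :
  totH (hval f) = totH (hval f') -> hdg f = hdg f' -> totC c = totC c' ->
  totC (hcons f c) = totC (hcons f' c').
Proof.
move=> ef ed ec; have [e1 e2] := tot_ends ef; have [e3 e4] := tot_ends ec.
by subst; rewrite (tot_inj ec) (helt_eq (tot_inj ef) ed).
Qed.
End CastFacts.

Section TensorFacts.
Variables (k : comPzRingType) (C : smdgcat k).
Local Notation hom := (@dghom k C).
Local Notation hc := (hchain (C := C)).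
Local Notation hh X Y := (helt (@dghom k C X Y)).

Lemma tot_thomA X X' Y Y' Z Z' (f : hom X X') (g : hom Y Y') (h : hom Z Z') :
  totH (f ⋆⋆ (g ⋆⋆ h)) = totH (f ⋆⋆ g ⋆⋆ h).
Proof. by rewrite -thomA tot_castH. Qed.

Lemma tot_thom1l X X' (f : hom X X') : totH (dgid (tone C) ⋆⋆ f) = totH f.
Proof. by rewrite -[in RHS](thom1l f) tot_castH. Qed.

Lemma tot_thom1r X X' (f : hom X X') : totH (f ⋆⋆ dgid (tone C)) = totH f.
Proof. by rewrite -[in RHS](thom1r f) tot_castH. Qed.

Lemma tot_thom X1 X1' Y1 Y1' X2 X2' Y2 Y2' (f : hom X1 X1') (g : hom Y1 Y1')
    (f' : hom X2 X2') (g' : hom Y2 Y2') :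
  totH f = totH f' -> totH g = totH g' -> totH (f ⋆⋆ g) = totH (f' ⋆⋆ g').
Proof.
move=> ef eg; have [e1 e2] := tot_ends ef; have [e3 e4] := tot_ends eg.
by subst; rewrite (tot_inj ef) (tot_inj eg).
Qed.

Lemma tot_id X X' : X = X' -> totH (dgid X : hom X X) = totH (dgid X' : hom X' X').
Proof. by move=> ->. Qed.

Lemma tot_hnil X X' : X = X' -> totC (hnil X : hc X X) = totC (hnil X' : hc X' X').
Proof. by move=> ->. Qed.

(** ** Associativity and units of the shuffle product *)

Lemma shuffle_unit_r (V : lmodType k) Z Z' (d : hc Z Z')
    (K : hc (Z ⋆ tone C) (Z' ⋆ tone C) -> V) v :
  (forall t, totC t = totC d -> K t = v) -> shuffle_sum d (hnil (tone C)) K = v.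
Proof.
elim: d K => [X|{}Z Z1 {}Z' d1 d IH] K H; rewrite shuffleE.
  by apply: H; apply: tot_hnil; exact: tob1r.
apply: IH => t et; apply: H; apply: tot_hcons => //=; last by rewrite addr0.
exact: tot_thom1r.
Qed.

Lemma shuffle_unit_l (V : lmodType k) Z Z' (d : hc Z Z')
    (K : hc (tone C ⋆ Z) (tone C ⋆ Z') -> V) v :
  (forall t, totC t = totC d -> K t = v) -> shuffle_sum (hnil (tone C)) d K = v.
Proof.
elim: d K => [X|{}Z Z1 {}Z' d1 d IH] K H; rewrite shuffleE.
  by apply: H; apply: tot_hnil; exact: tob1l.
apply: IH => t et; apply: H; apply: tot_hcons => //=; last by rewrite add0r.
exact: tot_thom1l.
Qed.

Lemma shuffle_congr_sdeg (V : lmodType k) Z Z' (d : hc Z Z') Y Y' (c : hc Y Y')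
    (K K' : hc (Z ⋆ Y) (Z' ⋆ Y') -> V) :
  (forall t, sdeg t = sdeg d + sdeg c -> K t = K' t) ->
  shuffle_sum d c K = shuffle_sum d c K'.
Proof.
move=> H; apply: shuffle_congr => t es ed; apply: H.
by rewrite !sdegE es ed PoszD; ring.
Qed.

(** Both sides are sums over shuffles of three strings.  The induction compares
    them according to which string contributes the first entry. *)
Lemma shuffle_assoc (V : lmodType k) W W' (e : hc W W') Z Z' (d : hc Z Z')
    Y Y' (c : hc Y Y') (K1 : hc (W ⋆ (Z ⋆ Y)) (W' ⋆ (Z' ⋆ Y')) -> V)
    (K2 : hc (W ⋆ Z ⋆ Y) (W' ⋆ Z' ⋆ Y') -> V) :
  (forall t1 t2, totC t1 = totC t2 -> K1 t1 = K2 t2) ->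
  shuffle_sum d c (fun t => shuffle_sum e t K1)
  = shuffle_sum e d (fun t => shuffle_sum t c K2).
Proof.
have H1 W0 W1 Z0 Y0 X X' (e1 : hh W1 W0) V1 (K1' : hc (W0 ⋆ (Z0 ⋆ Y0)) X -> V1)
   (K2' : hc (W0 ⋆ Z0 ⋆ Y0) X' -> V1) :
   (forall t1 t2, totC t1 = totC t2 -> K1' t1 = K2' t2) ->
   forall t1 t2, totC t1 = totC t2 ->
   K1' (hcons (hthom e1 (hid (Z0 ⋆ Y0))) t1)
   = K2' (hcons (hthom (hthom e1 (hid Z0)) (hid Y0)) t2).
  move=> H t1 t2 et; apply: H; apply: tot_hcons => //=; last by rewrite !addr0.
  by rewrite -tot_thomA thom_id.
have H2 W0 Z0 Z1 Y0 X X' (d1 : hh Z1 Z0) V1 (K1' : hc (W0 ⋆ (Z0 ⋆ Y0)) X -> V1)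
   (K2' : hc (W0 ⋆ Z0 ⋆ Y0) X' -> V1) :
   (forall t1 t2, totC t1 = totC t2 -> K1' t1 = K2' t2) ->
   forall t1 t2, totC t1 = totC t2 ->
   K1' (hcons (hthom (hid W0) (hthom d1 (hid Y0))) t1)
   = K2' (hcons (hthom (hthom (hid W0) d1) (hid Y0)) t2).
  move=> H t1 t2 et; apply: H; apply: tot_hcons => //=; last by rewrite !addr0 !add0r.
  exact: tot_thomA.
have H3 W0 Z0 Y1 Y0 X X' (c1 : hh Y1 Y0) V1 (K1' : hc (W0 ⋆ (Z0 ⋆ Y0)) X -> V1)
   (K2' : hc (W0 ⋆ Z0 ⋆ Y0) X' -> V1) :
   (forall t1 t2, totC t1 = totC t2 -> K1' t1 = K2' t2) ->
   forall t1 t2, totC t1 = totC t2 ->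
   K1' (hcons (hthom (hid W0) (hthom (hid Z0) c1)) t1)
   = K2' (hcons (hthom (hid (W0 ⋆ Z0)) c1) t2).
  move=> H t1 t2 et; apply: H; apply: tot_hcons => //=; last by rewrite !add0r.
  by rewrite tot_thomA thom_id.
elim: e Z Z' d Y Y' c K1 K2 => [{}W|{}W W1 {}W' e1 e IHe] Z Z' d;
  elim: d => [{}Z|{}Z Z1 {}Z' d1 d IHd] Y Y' c;
  elim: c => [{}Y|{}Y Y1 {}Y' c1 c IHc] K1 K2 H; rewrite !shuffleE.
- by apply: H; apply: tot_hnil; exact: tobA.
- under shuffle_congr => t _ _ do rewrite shuffleE.
  have := IHc _ _ (H3 _ _ _ _ _ _ c1 _ _ _ H).
  by rewrite !shuffleE.
- under shuffle_congr => t _ _ do rewrite shuffleE.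
  under [RHS]shuffle_congr => t _ _ do rewrite shuffleE.
  exact: IHd _ _ (hnil Y) _ _ (H2 _ _ _ _ _ _ d1 _ _ _ H).
- under shuffle_congr => t _ _ do rewrite shuffleE.
  under [X in _ + _ *: X]shuffle_congr => t _ _ do rewrite shuffleE.
  under [RHS]shuffle_congr_sdeg => t et do rewrite shuffleE sdeg_cons et.
  rewrite shuffleD shuffleZ (IHd _ _ _ _ _ (H2 _ _ _ _ _ _ d1 _ _ _ H)).
  by rewrite (IHc _ _ (H3 _ _ _ _ _ _ c1 _ _ _ H)) shuffleE; congr (_ + _ *: _); parity.
- under [RHS]shuffle_congr => t _ _ do rewrite shuffleE.
  have := IHe _ _ (hnil Z) _ _ (hnil Y) _ _ (H1 _ _ _ _ _ _ e1 _ _ _ H).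
  by rewrite !shuffleE.
- under shuffle_congr => t _ _ do rewrite shuffleE.
  under [RHS]shuffle_congr_sdeg => t et do rewrite shuffleE sdeg_cons et.
  rewrite !shuffleD !shuffleZ.
  have := IHe _ _ (hnil Z) _ _ (hcons c1 c) _ _ (H1 _ _ _ _ _ _ e1 _ _ _ H).
  rewrite shuffleE => ->; congr (_ + _).
  rewrite (IHc _ _ (H3 _ _ _ _ _ _ c1 _ _ _ H)) shuffleE.
  by congr (_ *: _); parity.
- under shuffle_congr => t _ _ do rewrite shuffleE.
  under [X in _ = X + _]shuffle_congr => t _ _ do rewrite shuffleE.
  under [X in _ = _ + _ *: X]shuffle_congr => t _ _ do rewrite shuffleE.
  rewrite !shuffleD !shuffleZ.
  have := IHe _ _ (hcons d1 d) _ _ (hnil Y) _ _ (H1 _ _ _ _ _ _ e1 _ _ _ H).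
  rewrite shuffleE => ->; congr (_ + _).
  rewrite (IHd _ _ (hnil Y) _ _ (H2 _ _ _ _ _ _ d1 _ _ _ H)).
  by congr (_ *: _); parity.
under shuffle_congr => t _ _ do rewrite shuffleE.
under [X in _ + _ *: X]shuffle_congr => t _ _ do rewrite shuffleE.
under [X in _ = X + _]shuffle_congr_sdeg => t et do rewrite shuffleE sdeg_cons et.
under [X in _ = _ + _ *: X]shuffle_congr_sdeg => t et do
  rewrite shuffleE sdeg_cons et.
rewrite !shuffleD !shuffleZ scalerDr addrACA.
have := IHe _ _ (hcons d1 d) _ _ (hcons c1 c) _ _ (H1 _ _ _ _ _ _ e1 _ _ _ H).
rewrite shuffleE => ->.
rewrite (IHd _ _ _ _ _ (H2 _ _ _ _ _ _ d1 _ _ _ H)).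
rewrite (IHc _ _ (H3 _ _ _ _ _ _ c1 _ _ _ H)) shuffleE.
sgn_match.
Qed.
End TensorFacts.

(** * Gluing *)

Section Glue.
Variables (k : comPzRingType) (C : smdgcat k).
Local Notation hom := (@dghom k C).
Local Notation hc := (hchain (C := C)).
Local Notation hh X Y := (helt (@dghom k C X Y)).
Let P := dgP C.

Lemma id_hdeg X : hdeg 0 (dgid X : hom X X).
Proof. exact: (dg_id_hdeg P). Qed.

Lemma thom_hdeg_l X X' Y p (f : hom X X') : hdeg p f -> hdeg p (f ⋆⋆ dgid Y).
Proof. by move=> h; have := thom_hdeg h (id_hdeg Y); rewrite addr0. Qed.

Lemma thom_hdeg_r X X' Y p (f : hom X X') : hdeg p f -> hdeg p (dgid Y ⋆⋆ f).
Proof. by move=> h; have := thom_hdeg (id_hdeg Y) h; rewrite add0r. Qed.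

Lemma homog_hom_ind X Y (Q : hom X Y -> Prop) :
  Q 0 -> (forall a f g, Q f -> Q g -> Q (a *: f + g)) ->
  (forall p f, hdeg p f -> Q f) -> forall f, Q f.
Proof. exact: (homog_ind (dg_cplx P X Y)). Qed.

Lemma comp_linl X Y Z (g : hom X Y) : linear_map (fun f : hom Y Z => f ∘ g).
Proof. by move=> a x y; exact: (dg_compLl P). Qed.

Lemma comp_linr X Y Z (f : hom Y Z) : linear_map (fun g : hom X Y => f ∘ g).
Proof. by move=> a x y; exact: (dg_compLr P). Qed.

Lemma thom_comp_l X X' X'' Y (f : hom X' X'') (g : hom X X') :
  (f ∘ g) ⋆⋆ dgid Y = (f ⋆⋆ dgid Y) ∘ (g ⋆⋆ dgid Y).
Proof.
move: g; apply: homog_hom_ind => [|a x y ex ey|p g hg].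
- by rewrite (lin0 (comp_linr _)) !thom0l (lin0 (comp_linr _)).
- by rewrite (dg_compLr P) !thomLl (dg_compLr P) ex ey.
by rewrite (thom_comp _ _ hg (id_hdeg Y)) mul0r sgn0 scale1r (dg_comp1l P).
Qed.

Lemma thom_comp_r X X' X'' Y (f : hom X' X'') (g : hom X X') :
  dgid Y ⋆⋆ (f ∘ g) = (dgid Y ⋆⋆ f) ∘ (dgid Y ⋆⋆ g).
Proof.
move: f; apply: homog_hom_ind => [|a x y ex ey|p f hf].
- by rewrite (lin0 (comp_linl _)) !thom0r (lin0 (comp_linl _)).
- by rewrite (dg_compLl P) !thomLr (dg_compLl P) ex ey.
by rewrite (thom_comp _ _ (id_hdeg Y) hf) mulr0 sgn0 scale1r (dg_comp1l P).
Qed.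

Lemma thom_comp_lr X X' Y Y' (f : hom X X') (g : hom Y Y') :
  (f ⋆⋆ dgid Y') ∘ (dgid X ⋆⋆ g) = f ⋆⋆ g.
Proof.
rewrite (thom_comp _ _ (id_hdeg X) (id_hdeg Y')) mulr0 sgn0 scale1r.
by rewrite (dg_comp1l P) (dg_comp1r P).
Qed.

Lemma thom_comp_rl X X' Y Y' (f : hom X X') (g : hom Y Y') p q :
  hdeg p f -> hdeg q g ->
  (dgid X' ⋆⋆ g) ∘ (f ⋆⋆ dgid Y) = sgn k (q * p) *: (f ⋆⋆ g).
Proof.
move=> hf hg.
by rewrite (thom_comp _ _ hf hg) (dg_comp1l P) (dg_comp1r P).
Qed.

Lemma thomA_sym X X' Y Y' Z Z' (f : hom X X') (g : hom Y Y') (h : hom Z Z')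
    (e : X ⋆ Y ⋆ Z = X ⋆ (Y ⋆ Z)) (e' : X' ⋆ Y' ⋆ Z' = X' ⋆ (Y' ⋆ Z')) :
  castH e e' (f ⋆⋆ g ⋆⋆ h) = f ⋆⋆ (g ⋆⋆ h).
Proof.
by apply: (@tot_inj _ (fun X Y => car (hom X Y))); rewrite tot_castH -tot_thomA.
Qed.

Section Laws.
Variables (X X' X'' Y Y' Z Z' : ob C).
Implicit Types (f : hom (X' ⋆ Y) (Y' ⋆ X'')) (g : hom (X ⋆ Z) (Z' ⋆ X')).

Lemma trglue_linl g : linear_map (fun f => trglue f g).
Proof.
by move=> a f f'; rewrite /trglue thomLr castH_lin (dg_compLl P).
Qed.

Lemma trglue_linr f : linear_map (fun g => trglue f g).
Proof.
by move=> a g g'; rewrite /trglue thomLl castH_lin (dg_compLr P).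
Qed.

Lemma trglue_hdeg f g p q : hdeg p f -> hdeg q g -> hdeg (p + q) (trglue f g).
Proof.
move=> hf hg; apply: (dg_comp_hdeg P); apply: castH_hdeg.
  exact: thom_hdeg_r.
exact: thom_hdeg_l.
Qed.

Lemma trglue_diff f g p : hdeg p f ->
  cdiff (trglue f g) = trglue (cdiff f) g + sgn k p *: trglue f (cdiff g).
Proof.
move=> hf; rewrite /trglue (dg_comp_diff P _ (castH_hdeg _ _ (thom_hdeg_r _ hf))).
have -> : cdiff (castH erefl (tobA Z' Y' X'') (dgid Z' ⋆⋆ f))
        = castH erefl (tobA Z' Y' X'') (dgid Z' ⋆⋆ cdiff f).
  rewrite castH_diff (thom_diff _ (id_hdeg Z')) (dg_id_diff P) thom0l add0r.
  by rewrite sgn0 scale1r.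
congr (_ + _ *: (_ ∘ _)); rewrite castH_diff; congr castH.
move: g; apply: homog_hom_ind => [|a x y ex ey|q g hg].
- rewrite (lin0 (cdiff_lin (dg_cplx P _ _))) !thom0l.
  by rewrite (lin0 (cdiff_lin (dg_cplx P _ _))).
- by rewrite thomLl !(cx_diffL (dg_cplx P _ _)) thomLl ex ey.
by rewrite (thom_diff _ hg) (dg_id_diff P) thom0r scaler0 addr0.
Qed.

(** The four outer actions on a glued morphism.  An action next to its own factor
    is absorbed; otherwise it first passes the other factor, which gives the
    sign. *)
Lemma trglue_lact_c Y1 (a : hom Y' Y1) f g :
  (dgid Z' ⋆⋆ a ⋆⋆ dgid X'') ∘ trglue f g = trglue ((a ⋆⋆ dgid X'') ∘ f) g.
Proof.
rewrite /trglue (dg_compA P) -thomA.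
by rewrite -castH_comp -thom_comp_r.
Qed.

Lemma trglue_lact_d Z1 (a : hom Z' Z1) f g p q : hdeg p a -> hdeg q f ->
  (a ⋆⋆ dgid Y' ⋆⋆ dgid X'') ∘ trglue f g
  = sgn k (p * q) *: trglue f ((a ⋆⋆ dgid X') ∘ g).
Proof.
move=> ha hf; rewrite /trglue (dg_compA P) -thomA thom_id -castH_comp.
rewrite thom_comp_lr thom_comp_l.
rewrite (castH_comp (esym (tobA X Z Y)) (esym (tobA Z' X' Y))).
rewrite (dg_compA P) thomA_sym thom_id.
rewrite -[a ⋆⋆ dgid (X' ⋆ Y)]/(castH erefl erefl (a ⋆⋆ dgid (X' ⋆ Y))).
rewrite -castH_comp (thom_comp_rl ha hf) (linZ (castH_lin _ _)).
rewrite (linZ (comp_linl _)) sgn_sgn.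
have -> : sgn k (p * q + q * p) = sgn k 0 by parity.
by rewrite sgn0 scale1r.
Qed.

Lemma trglue_ract_d Z1 (b : hom Z1 Z) f g :
  trglue f g ∘ (dgid X ⋆⋆ (b ⋆⋆ dgid Y)) = trglue f (g ∘ (dgid X ⋆⋆ b)).
Proof.
rewrite /trglue -(dg_compA P) -(thomA_sym _ _ _ (esym (tobA X Z1 Y)) (esym (tobA X Z Y))).
by rewrite -castH_comp -thom_comp_l.
Qed.

Lemma trglue_ract_c Y1 (b : hom Y1 Y) f g p q : hdeg p b -> hdeg q g ->
  trglue f g ∘ (dgid X ⋆⋆ (dgid Z ⋆⋆ b))
  = sgn k (p * q) *: trglue (f ∘ (dgid X' ⋆⋆ b)) g.
Proof.
move=> hb hg; rewrite /trglue -(dg_compA P).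
rewrite -(thomA_sym _ _ _ (esym (tobA X Z Y1)) (esym (tobA X Z Y))).
rewrite -castH_comp thom_id thom_comp_lr thom_comp_r.
rewrite (castH_comp erefl erefl) -(dg_compA P) [castH erefl erefl _]/=.
rewrite -(thomA_sym _ _ _ (esym (tobA Z' X' Y1)) (esym (tobA Z' X' Y))).
rewrite -castH_comp thom_id (thom_comp_rl hg hb) (linZ (castH_lin _ _)).
rewrite (linZ (comp_linr _)) sgn_sgn.
have -> : sgn k (p * q + p * q) = sgn k 0 by parity.
by rewrite sgn0 scale1r.
Qed.

End Laws.

(** Both sides are the composite of the same three morphisms tensored with
    identities. *)
Lemma trglue_assoc X0 X1 X2 X3 Y Y' Z Z' W W' (f : hom (X2 ⋆ Y) (Y' ⋆ X3))
    (g : hom (X1 ⋆ Z) (Z' ⋆ X2)) (h : hom (X0 ⋆ W) (W' ⋆ X1)) :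
  totH (trglue f (trglue g h)) = totH (trglue (trglue f g) h).
Proof.
rewrite /trglue thom_comp_l thom_comp_r.
rewrite (castH_comp _ (f_equal (fun U => U ⋆ Y) (tobA W' X1 Z))).
rewrite (castH_comp erefl erefl) (dg_compA P).
apply: tot_comp; last first.
  rewrite !tot_castH -thom_id tot_thomA; apply: tot_thom => //.
  by rewrite tot_castH.
apply: tot_comp; rewrite !tot_castH.
  rewrite -thom_id -tot_thomA; apply: tot_thom => //.
  by rewrite tot_castH.
transitivity (totH (dgid W' ⋆⋆ g ⋆⋆ dgid Y)).
  by apply: tot_thom => //; rewrite tot_castH.
by rewrite -tot_thomA; apply: tot_thom => //; rewrite tot_castH.
Qed.

Lemma tot_trglue_trmor_l X X' X'' Z Z' (f : hom X' X'') (g : hom (X ⋆ Z) (Z' ⋆ X')) :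
  totH (trglue (castH (esym (tob1r X')) (esym (tob1l X'')) f) g)
  = totH ((dgid Z' ⋆⋆ f) ∘ g).
Proof.
apply: tot_comp; rewrite tot_castH; last exact: tot_thom1r.
by apply: tot_thom => //; rewrite tot_castH.
Qed.

Lemma tot_trglue_trmor_r X X' X'' Y Y' (f : hom (X' ⋆ Y) (Y' ⋆ X'')) (g : hom X X') :
  totH (trglue f (castH (esym (tob1r X)) (esym (tob1l X')) g))
  = totH (f ∘ (g ⋆⋆ dgid Y)).
Proof.
apply: tot_comp; rewrite tot_castH; first exact: tot_thom1l.
by apply: tot_thom => //; rewrite tot_castH.
Qed.
End Glue.

(** * Composition in the trace *)

Section ElimMaps.
Variables (k : comPzRingType) (C : dgcat k).
Local Notation hc := (hchain (C := C)).
Local Notation hh X Y := (helt (@dghom k C X Y)).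

Lemma sdint_map (V W : lmodType k) (F : V -> W) : linear_map F ->
  forall Y X (c : hc Y X) K, F (sdint c K) = sdint c (fun c' => F (K c')).
Proof.
move=> HF Y X c; elim: c => [?|{}Y Z {}X f c IH] K /=; first exact: (lin0 HF).
by rewrite (linD HF) !(linN HF) (linZ HF) IH.
Qed.

Lemma sfaces_map (V W : lmodType k) (F : V -> W) : linear_map F ->
  forall Y X (c : hc Y X) K, F (sfaces c K) = sfaces c (fun c' => F (K c')).
Proof.
move=> HF Y X c; elim: c => [?|{}Y Z {}X f c IH] K /=; first exact: (lin0 HF).
rewrite (linD HF) (linN HF) !(linZ HF) IH; congr (_ *: _ - _).
by case: c f K {IH} => [?|Y1 Y2 Y3 g c] f K //=; exact: (lin0 HF).
Qed.

Lemma head_elim_map (V W : lmodType k) (F : V -> W) : linear_map F ->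
  forall Y X (c : hc Y X) L,
  F (head_elim 0 c L) = head_elim 0 c (fun Z f c' => F (L Z f c')).
Proof. by move=> HF Y X [?|? ? ? f c] L //=; exact: (lin0 HF). Qed.

Lemma last_elim_map (V W : lmodType k) (F : V -> W) : linear_map F ->
  forall Y X (c : hc Y X) L,
  F (last_elim 0 c L) = last_elim 0 c (fun Z c' f => F (L Z c' f)).
Proof.
move=> HF Y X c L; case: (snocP c) L => [?|? ? ? d f] L; first exact: (lin0 HF).
by rewrite !last_elim_snoc.
Qed.

Lemma last_elimZ (V : lmodType k) Y X (c : hc Y X) a
    (L : forall Z, hc Y Z -> hh X Z -> V) :
  last_elim 0 c (fun Z c' f => a *: L Z c' f) = a *: last_elim 0 c L.
Proof.
case: (snocP c) L => [?|? ? ? d f] L; first by rewrite /= scaler0.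
by rewrite !last_elim_snoc.
Qed.

Lemma sdint_congr_sdeg (V : lmodType k) Y X (c : hc Y X) (K K' : hc Y X -> V) :
  (forall c', sdeg c' = sdeg c + 1 -> K c' = K' c') -> sdint c K = sdint c K'.
Proof.
move=> H; apply: sdint_congr => c' es ed; apply: H.
by rewrite !sdegE es ed; ring.
Qed.

Lemma sfaces_congr_sdeg (V : lmodType k) Y X (c : hc Y X) (K K' : hc Y X -> V) :
  (forall c', sdeg c' = sdeg c + 1 -> K c' = K' c') -> sfaces c K = sfaces c K'.
Proof.
move=> H; apply: sfaces_congr => c' es ed; apply: H.
by rewrite !sdegE -es ed -addn1 PoszD; ring.
Qed.

End ElimMaps.

Section TraceComposition.
Variables (k : comPzRingType) (C : smdgcat k).
Local Notation hom := (@dghom k C).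
Local Notation hc := (hchain (C := C)).
Local Notation hh X Y := (helt (@dghom k C X Y)).
Let HX X' X := @X12_bimodP k C X' X.
Let P := dgP C.

Lemma strelt_lin X X' Y Y' (c : hc Y Y') : linear_map (@strelt k C X X' Y Y' c).
Proof. exact: (scyc_elt_lin (M := X12 X' X)). Qed.

Section Exists.
Variables X X' X'' : ob C.

(** The prescribed value of a composition on unsuspended symbols; the sign
    (-1)^(|d||f|), with |d| the suspended degree of the string, is expressed by
    [twist] to make the formula linear in f. *)
Definition trcomp_sym Y Y' (c : hc Y Y') (f : bm (X12 X'' X') Y' Y)
    Z Z' (d : hc Z Z') (g : bm (X12 X' X) Z' Z) : trhom X X'' :=
  sgn k (shift_exp c + shift_exp d + sdeg d * sdeg c) *:
  shuffle_sum d c (fun t =>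
    strelt t (trglue (twist (bi_cplx (HX X'' X') Y' Y) (sdeg d) f) g)).

Lemma trcomp_sym_chain2 Y Y' (c : hc Y Y') f Z Z' (g : bm (X12 X' X) Z' Z) :
  multilinear (fun d : hc Z Z' => trcomp_sym c f d g).
Proof.
move=> a d d1 d2 H; rewrite /trcomp_sym !sdegE.
have [-> -> -> ->] := chain_lin_shape H; have [-> ->] := chain_lin_shift H.
rewrite -!sdegE sgn_scaleC -scalerDr; congr (_ *: _).
exact: (shuffle_lin1 c (scyc_elt_multilinear (M := X12 X'' X) (trglue _ _)) H).
Qed.

Lemma trcomp_sym_chain1 Y Y' f Z Z' (d : hc Z Z') (g : bm (X12 X' X) Z' Z) :
  multilinear (fun c : hc Y Y' => trcomp_sym c f d g).
Proof.
move=> a c c1 c2 H; rewrite /trcomp_sym !sdegE.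
have [-> -> -> ->] := chain_lin_shape H; have [-> ->] := chain_lin_shift H.
rewrite -!sdegE sgn_scaleC -scalerDr; congr (_ *: _).
exact: (shuffle_lin2 d (scyc_elt_multilinear (M := X12 X'' X) (trglue _ _)) H).
Qed.

Lemma trcomp_sym_mod2 Y Y' (c : hc Y Y') f Z Z' (d : hc Z Z') :
  linear_map (trcomp_sym c f d).
Proof.
move=> a g g'; rewrite /trcomp_sym sgn_scaleC -scalerDr -shuffleL.
congr (_ *: _); apply: shuffle_congr => t _ _.
by rewrite trglue_linr; exact: scyc_elt_lin.
Qed.

Lemma trcomp_sym_mod1 Y Y' (c : hc Y Y') Z Z' (d : hc Z Z') g :
  linear_map (fun f => trcomp_sym c f d g).
Proof.
move=> a f f'; rewrite /trcomp_sym sgn_scaleC -scalerDr -shuffleL.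
congr (_ *: _); apply: shuffle_congr => t _ _.
by rewrite twist_lin trglue_linl; exact: scyc_elt_lin.
Qed.

Definition trcomp_left Y Y' (c : hc Y Y') (f : bm (X12 X'' X') Y' Y) :
    trhom X X' -> trhom X X'' :=
  cyc_rec (HX X' X) (trcomp_sym c f).

Lemma trcomp_left_lin Y Y' (c : hc Y Y') f : linear_map (trcomp_left c f).
Proof.
apply: cyc_rec_lin => [Z Z' g|Z Z' d].
  exact: trcomp_sym_chain2.
exact: trcomp_sym_mod2.
Qed.

Lemma trcomp_left_elt Y Y' (c : hc Y Y') f Z Z' (d : hc Z Z') g :
  trcomp_left c f (cyc_elt d g) = trcomp_sym c f d g.
Proof.
rewrite /trcomp_left cyc_rec_elt // => [W W' h|W W' e].
  exact: trcomp_sym_chain2.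
exact: trcomp_sym_mod2.
Qed.

Lemma trcomp_left_ext (V : lmodType k) (F G : trhom X X' -> V) :
  linear_map F -> linear_map G ->
  (forall Z Z' (d : hc Z Z') g, F (cyc_elt d g) = G (cyc_elt d g)) -> F =1 G.
Proof.
move=> HF HG H; apply: (cyc_ext (HX X' X) HF HG) => Z Z' d g p _.
by rewrite /scyc_elt (linZ HF) (linZ HG) H.
Qed.

Lemma linear_comb (U V : lmodType k) a (F G : U -> V) :
  linear_map F -> linear_map G -> linear_map (fun x => a *: F x + G x).
Proof.
move=> HF HG b x y; rewrite HF HG !scalerDr !scalerA [a * b]mulrC.
by rewrite addrACA.
Qed.

Lemma trcomp_left_chain Y Y' f y :
  multilinear (fun c : hc Y Y' => trcomp_left c f y).
Proof.
move=> a c c1 c2 H; move: y; apply: trcomp_left_ext.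
- exact: trcomp_left_lin.
- by apply: linear_comb; exact: trcomp_left_lin.
move=> Z Z' d g; rewrite !trcomp_left_elt; exact: (trcomp_sym_chain1 _ _ _ H).
Qed.

Lemma trcomp_left_mod Y Y' (c : hc Y Y') y :
  linear_map (fun f => trcomp_left c f y).
Proof.
move=> a f f'; move: y; apply: trcomp_left_ext.
- exact: trcomp_left_lin.
- by apply: linear_comb; exact: trcomp_left_lin.
move=> Z Z' d g; rewrite !trcomp_left_elt; exact: trcomp_sym_mod1.
Qed.

Definition trcomp_op (x : trhom X' X'') (y : trhom X X') : trhom X X'' :=
  cyc_rec (HX X'' X') (fun Y Y' c f => trcomp_left c f y) x.

Lemma trcomp_op_lin1 y : linear_map (trcomp_op^~ y).
Proof.
apply: cyc_rec_lin => [Y Y' f|Y Y' c].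
  exact: trcomp_left_chain.
exact: trcomp_left_mod.
Qed.

Lemma trcomp_op_elt Y Y' (c : hc Y Y') f y :
  trcomp_op (cyc_elt c f) y = trcomp_left c f y.
Proof.
rewrite /trcomp_op cyc_rec_elt // => [Z Z' g|Z Z' d].
  exact: trcomp_left_chain.
exact: trcomp_left_mod.
Qed.

Lemma trcomp_op_lin2 x : linear_map (trcomp_op x).
Proof.
move=> a y y'; move: x; apply: (cyc_ext (HX X'' X')).
- exact: trcomp_op_lin1.
- by apply: linear_comb; exact: trcomp_op_lin1.
move=> Y Y' c f p _; rewrite /scyc_elt !(linZ (trcomp_op_lin1 _)).
by rewrite !trcomp_op_elt trcomp_left_lin scalerDr sgn_scaleC.
Qed.

Lemma trcomp_op_scyc Y Y' (c : hc Y Y') (f : hom (X' ⋆ Y) (Y' ⋆ X'')) p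
    Z Z' (d : hc Z Z') (g : hom (X ⋆ Z) (Z' ⋆ X')) : hdeg p f ->
  trcomp_op (strelt c f) (strelt d g)
  = sgn k (sdeg d * (sdeg c + p)) *:
    shuffle_sum d c (fun t => strelt t (trglue f g)).
Proof.
move=> hf; rewrite {1 2}/strelt /scyc_elt (linZ (trcomp_op_lin1 _)).
rewrite (linZ (trcomp_op_lin2 _)) trcomp_op_elt trcomp_left_elt /trcomp_sym.
rewrite (twist_homog (bi_cplx (HX X'' X') _ _) _ hf) !sgn_sgn.
rewrite -shuffleZ -[RHS]shuffleZ; apply: shuffle_congr => t _ _.
rewrite (linZ (trglue_linl _)) (linZ (strelt_lin _)) sgn_sgn.
by congr (_ *: _); parity.
Qed.

End Exists.

Lemma trcompP : is_trcomp (@trcomp k C).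
Proof.
apply: epsilon_spec; exists trcomp_op; split.
- by move=> X X' X'' a x x' y; exact: trcomp_op_lin1.
- by move=> X X' X'' a x y y'; exact: trcomp_op_lin2.
by move=> X X' X'' Y Y' Z Z' c d f g; exact: (trcomp_op_scyc _ _ _ (hvalP f)).
Qed.

Local Notation trc := (@trcomp k C _ _ _).

Lemma trcomp_lin1 X X' X'' (y : trhom X X') :
  linear_map (fun x : trhom X' X'' => trc x y).
Proof. by have [H _ _] := trcompP; move=> a x x'; exact: H. Qed.

Lemma trcomp_lin2 X X' X'' (x : trhom X' X'') :
  linear_map (fun y : trhom X X' => trc x y).
Proof. by have [_ H _] := trcompP; move=> a y y'; exact: H. Qed.

Lemma trcompE X X' X'' Y Y' (c : hc Y Y') (f : hom (X' ⋆ Y) (Y' ⋆ X'')) p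
    Z Z' (d : hc Z Z') (g : hom (X ⋆ Z) (Z' ⋆ X')) : hdeg p f ->
  trc (strelt c f) (strelt d g)
  = sgn k (sdeg d * (sdeg c + p)) *:
    shuffle_sum d c (fun t => strelt t (trglue f g)).
Proof. by move=> hf; have [_ _ H] := trcompP; rewrite (H _ _ _ _ _ _ _ c d (Helt hf)). Qed.

Lemma strelt_tot X X' Y Y' Z Z' (c : hc Y Y') (d : hc Z Z')
    (f : hom (X ⋆ Y) (Y' ⋆ X')) (g : hom (X ⋆ Z) (Z' ⋆ X')) :
  totC c = totC d -> totH f = totH g -> strelt c f = strelt d g.
Proof.
move=> ec ef; have [e1 e2] := tot_ends ec; subst.
by rewrite (tot_inj ec) (tot_inj ef).
Qed.

(** On symbols <c|f>, <d|g>, <e|h> both sides are a signed sum over shuffles of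
    e, d, c, so the claim reduces to the associativity of shuffles and of
    gluing. *)
Lemma trcompA W X Y Z (x : trhom Y Z) (y : trhom X Y) (z : trhom W X) :
  trc x (trc y z) = trc (trc x y) z.
Proof.
have L1 := trcomp_lin1; have L2 := trcomp_lin2.
move: x; apply: (cyc_ext (HX Z Y)) => [a u v|a u v|A A' c f p hf].
- exact: L1.
- by rewrite !L1.
move: y; apply: (cyc_ext (HX Y X)) => [a u v|a u v|B B' d g q hg].
- by rewrite !(L1, L2).
- by rewrite !(L1, L2).
move: z; apply: (cyc_ext (HX X W)) => [a u v|a u v|E E' e h r hh].
- by rewrite !(L1, L2).
- by rewrite !(L1, L2).
rewrite (trcompE d e h hg) (trcompE c d g hf).
rewrite (linZ (L2 _ _ _ _) (sgn k (sdeg e * (sdeg d + q)))).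
rewrite (linZ (L1 _ _ _ _) (sgn k (sdeg d * (sdeg c + p)))).
rewrite (shuffle_map (L2 _ _ _ _)) (shuffle_map (L1 _ _ _ _)).
under shuffle_congr_sdeg => t et do rewrite (trcompE _ _ _ hf) et.
under [in RHS]shuffle_congr_sdeg => t et do
  rewrite (trcompE _ _ _ (trglue_hdeg hf hg)) et.
rewrite !shuffleZ !sgn_sgn.
rewrite (@shuffle_assoc k C _ _ _ e _ _ d _ _ c _
  (fun t => strelt t (trglue f (trglue g h)))).
  by congr (_ *: _); parity.
by move=> t1 t2 et; apply: strelt_tot => //; rewrite trglue_assoc.
Qed.

End TraceComposition.

(** * The trace is a dg category *)

Section TraceCategory.
Variables (k : comPzRingType) (C : smdgcat k).
Local Notation hom := (@dghom k C).
Local Notation hc := (hchain (C := C)).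
Local Notation hh X Y := (helt (@dghom k C X Y)).
Let HX X' X := @X12_bimodP k C X' X.
Let P := dgP C.
Local Notation trc := (@trcomp k C _ _ _).

Lemma trhom_complex X X' : is_complex (@trhom k C X X').
Proof. exact: cyc_complex. Qed.

Lemma cdiff_strelt X X' Y Y' (c : hc Y Y') (f : hom (X ⋆ Y) (Y' ⋆ X')) p :
  hdeg p f ->
  cdiff (strelt c f)
  = sdint c (fun c' => strelt c' f) + sfaces c (fun c' => strelt c' f)
    + head_elim 0 c (fun W a c' => sgn k (hdg a * (sdeg c' + p)) *:
        strelt c' (f ∘ (dgid X ⋆⋆ hval a)))
    - last_elim 0 c (fun W c' a => sgn k (sdeg c') *:
        strelt c' ((hval a ⋆⋆ dgid X') ∘ f))
    + sgn k (sdeg c) *: strelt c (cdiff f).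
Proof. exact: (cdiff_scyc (HX X' X)). Qed.

(** The three terms of the Leibniz rule are expanded in the same ten sums: the
    internal differential, inner faces, first and last face for each of the two
    strings, and the differentials of f and of g. *)
Section Leibniz.
Variables (X X' X'' Y Y' Z Z' : ob C) (c : hc Y Y') (d : hc Z Z').
Variables (f : hom (X' ⋆ Y) (Y' ⋆ X'')) (g : hom (X ⋆ Z) (Z' ⋆ X')).
Variables (p q : int).
Hypotheses (hf : hdeg p f) (hg : hdeg q g).

Let A1 := sdint d (fun d' => shuffle_sum d' c (fun t => strelt t (trglue f g))).
Let A2 := sdint c (fun c' => shuffle_sum d c' (fun t => strelt t (trglue f g))).
Let B1 := sfaces d (fun d' => shuffle_sum d' c (fun t => strelt t (trglue f g))).
Let B2 := sfaces c (fun c' => shuffle_sum d c' (fun t => strelt t (trglue f g))).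
Let H1 := head_elim 0 d (fun W b d' =>
  sgn k (hdg b * (sdeg d' + sdeg c + (p + q))) *:
  shuffle_sum d' c (fun t => strelt t (trglue f (g ∘ (dgid X ⋆⋆ hval b))))).
Let H2 := head_elim 0 c (fun W b c' =>
  sgn k ((hdg b - 1) * sdeg d + hdg b * (sdeg d + sdeg c' + (p + q)) + hdg b * q) *:
  shuffle_sum d c' (fun t => strelt t (trglue (f ∘ (dgid X' ⋆⋆ hval b)) g))).
Let L1 := last_elim 0 d (fun W d' a =>
  sgn k ((hdg a - 1) * sdeg c + (sdeg d' + sdeg c) + hdg a * p) *:
  shuffle_sum d' c (fun t => strelt t (trglue f ((hval a ⋆⋆ dgid X') ∘ g)))).
Let L2 := last_elim 0 c (fun W c' a =>
  sgn k (sdeg d + sdeg c') *: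
  shuffle_sum d c' (fun t => strelt t (trglue ((hval a ⋆⋆ dgid X'') ∘ f) g))).
Let G1 := shuffle_sum d c (fun t => strelt t (trglue (cdiff f) g)).
Let G2 := shuffle_sum d c (fun t => strelt t (trglue f (cdiff g))).
Let s := sdeg d * (sdeg c + p).

Lemma cdiff_shuffle :
  cdiff (shuffle_sum d c (fun t => strelt t (trglue f g)))
  = (A1 + sgn k (sdeg d) *: A2) + (B1 + sgn k (sdeg d) *: B2) + (H1 + H2)
    - (L1 + L2) + sgn k (sdeg d + sdeg c) *: (G1 + sgn k p *: G2).
Proof.
have DL := cdiff_lin (trhom_complex X X'').
rewrite (shuffle_map DL).
under shuffle_congr_sdeg => t et do
  rewrite (cdiff_strelt _ (trglue_hdeg hf hg)) et.
rewrite !shuffleD shuffleN shuffleZ shuffle_sdint shuffle_sfaces; last first.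
  exact: (scyc_elt_multilinear (M := X12 X'' X)).
rewrite shuffle_head shuffle_last.
congr (_ + (_ + _) - (_ + _) + _ *: _).
- apply: head_elim_congr => W b d' _; rewrite -shuffleZ.
  apply: shuffle_congr_sdeg => t et.
  by rewrite trglue_ract_d et; congr (_ *: _); parity.
- apply: head_elim_congr => W b c' _; rewrite -!shuffleZ.
  apply: shuffle_congr_sdeg => t et.
  rewrite (trglue_ract_c _ (hvalP b) hg) (linZ (strelt_lin _)) !sgn_sgn et.
  by congr (_ *: _); parity.
- apply: last_elim_congr => W d' a _; rewrite -!shuffleZ.
  apply: shuffle_congr_sdeg => t et.
  rewrite (trglue_lact_d _ (hvalP a) hf) (linZ (strelt_lin _)) !sgn_sgn et.
  by congr (_ *: _); parity.
- apply: last_elim_congr => W c' a _; rewrite -!shuffleZ.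
  apply: shuffle_congr_sdeg => t et.
  by rewrite trglue_lact_c et.
rewrite /G1 /G2 -shuffleZ -shuffleD; apply: shuffle_congr => t _ _.
by rewrite (trglue_diff _ hf) (linD (strelt_lin _)) (linZ (strelt_lin _)).
Qed.

Lemma trcomp_cdiff_l :
  trc (cdiff (strelt c f)) (strelt d g)
  = sgn k (s + sdeg d) *: A2 + sgn k (s + sdeg d) *: B2 + sgn k s *: H2
    - sgn k s *: L2 + sgn k (s + sdeg c + sdeg d) *: G1.
Proof.
have TL := trcomp_lin1 (X'' := X'') (strelt d g).
rewrite (cdiff_strelt c hf) !(linD TL) (linN TL) (linZ TL).
rewrite (sdint_map TL) (sfaces_map TL) (head_elim_map TL) (last_elim_map TL).
congr (_ + _ + _ - _ + _).
- rewrite -sdintZ; apply: sdint_congr_sdeg => c' ec.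
  by rewrite (trcompE c' d g hf) ec; congr (_ *: _); parity.
- rewrite -sfacesZ; apply: sfaces_congr_sdeg => c' ec.
  by rewrite (trcompE c' d g hf) ec; congr (_ *: _); parity.
- rewrite -head_elimZ; apply: head_elim_congr => W b c' ec.
  have hb : hdeg (p + hdg b) (f ∘ (dgid X' ⋆⋆ hval b)).
    by apply: (dg_comp_hdeg P) => //; exact: thom_hdeg_r (hvalP b).
  rewrite (linZ TL) (trcompE c' d g hb) !sgn_sgn.
  by congr (_ *: _); rewrite /s ec; parity.
- rewrite -last_elimZ; apply: last_elim_congr => W c' a ec.
  have ha : hdeg (hdg a + p) ((hval a ⋆⋆ dgid X'') ∘ f).
    by apply: (dg_comp_hdeg P) => //; exact: thom_hdeg_l (hvalP a).
  rewrite (linZ TL) (trcompE c' d g ha) !sgn_sgn.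
  by congr (_ *: _); rewrite /s ec; parity.
rewrite (trcompE c d g (cx_diff_hdeg (dg_cplx P _ _) hf)) sgn_sgn.
by congr (_ *: _); parity.
Qed.

Lemma trcomp_cdiff_r :
  trc (strelt c f) (cdiff (strelt d g))
  = sgn k (s + sdeg c + p) *: A1 + sgn k (s + sdeg c + p) *: B1
    + sgn k (s + sdeg c + p) *: H1 - sgn k (s + sdeg c + p) *: L1
    + sgn k (s + sdeg d) *: G2.
Proof.
have TL := trcomp_lin2 (X := X) (strelt c f).
rewrite (cdiff_strelt d hg) !(linD TL) (linN TL) (linZ TL).
rewrite (sdint_map TL) (sfaces_map TL) (head_elim_map TL) (last_elim_map TL).
congr (_ + _ + _ - _ + _).
- rewrite -sdintZ; apply: sdint_congr_sdeg => d' ed.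
  by rewrite (trcompE c d' g hf) ed; congr (_ *: _); parity.
- rewrite -sfacesZ; apply: sfaces_congr_sdeg => d' ed.
  by rewrite (trcompE c d' g hf) ed; congr (_ *: _); parity.
- rewrite -head_elimZ; apply: head_elim_congr => W b d' ed.
  rewrite (linZ TL) (trcompE c d' _ hf) !sgn_sgn.
  by congr (_ *: _); rewrite /s ed; parity.
- rewrite -last_elimZ; apply: last_elim_congr => W d' a ed.
  rewrite (linZ TL) (trcompE c d' _ hf) !sgn_sgn.
  by congr (_ *: _); rewrite /s ed; parity.
rewrite (trcompE c d _ hf) sgn_sgn.
by congr (_ *: _); parity.
Qed.

Lemma trcomp_diff_elt :
  cdiff (trc (strelt c f) (strelt d g))
  = trc (cdiff (strelt c f)) (strelt d g)
    + sgn k (sdeg c + p) *: trc (strelt c f) (cdiff (strelt d g)).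
Proof.
have DL := cdiff_lin (trhom_complex X X'').
rewrite (trcompE c d g hf) (linZ DL) cdiff_shuffle.
rewrite trcomp_cdiff_l trcomp_cdiff_r -/s.
move: A1 A2 B1 B2 H1 H2 L1 L2 G1 G2 => a1 a2 b1 b2 h1 h2 l1 l2 g1 g2.
rewrite /s; sgn_match.
Qed.

End Leibniz.
End TraceCategory.

Section TraceFunctor.
Variables (k : comPzRingType) (C : smdgcat k).
Local Notation hom := (@dghom k C).
Local Notation hc := (hchain (C := C)).
Local Notation hh X Y := (helt (@dghom k C X Y)).
Let HX X' X := @X12_bimodP k C X' X.
Let P := dgP C.
Local Notation trc := (@trcomp k C _ _ _).

Lemma strelt_hdeg X X' Y Y' (c : hc Y Y') (f : hom (X ⋆ Y) (Y' ⋆ X')) p :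
  hdeg p f -> hdeg (sdeg c + p) (strelt c f).
Proof. exact: (scyc_elt_hdeg (HX X' X)). Qed.

Lemma shuffle_mem (V : lmodType k) (Q : V -> Prop) Z Z' (d : hc Z Z') Y Y'
    (c : hc Y Y') (K : hc (Z ⋆ Y) (Z' ⋆ Y') -> V) :
  Q 0 -> (forall a x y, Q x -> Q y -> Q (a *: x + y)) ->
  (forall t, sdeg t = sdeg d + sdeg c -> Q (K t)) -> Q (shuffle_sum d c K).
Proof.
move=> Q0 QL; elim: d Y Y' c K => [{}Z|{}Z Z1 {}Z' d1 d IHd] Y Y' c.
  elim: c => [{}Y|{}Y Y1 {}Y' c1 c IHc] K H; rewrite shuffleE; first exact: H.
  by apply: IHc => t et; apply: H; rewrite !sdeg_cons et /=; ring.
elim: c => [{}Y|{}Y Y1 {}Y' c1 c IHc] K H; rewrite shuffleE.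
  by apply: IHd => t et; apply: H; rewrite !sdeg_cons et /=; ring.
rewrite addrC; apply: QL.
  by apply: IHc => t et; apply: H; rewrite !sdeg_cons et /=; ring.
by apply: IHd => t et; apply: H; rewrite !sdeg_cons et /=; ring.
Qed.

Lemma trcomp_hdeg X X' X'' p q (x : trhom X' X'') (y : trhom X X') :
  hdeg p x -> hdeg q y -> hdeg (p + q) (trc x y).
Proof.
move=> hx hy; have HC := trhom_complex (C := C) X X''.
move: x hx; apply: (cyc_hdeg_ind (HX X'' X')) => [|a x x' h h'|Y Y' c f m hf ef].
- by rewrite (lin0 (trcomp_lin1 _)); exact: (cx_hdeg0 HC).
- by rewrite trcomp_lin1; exact: (cx_hdegL HC).
move: y hy; apply: (cyc_hdeg_ind (HX X' X)) => [|a y y' h h'|Z Z' d g n hg eg].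
- by rewrite (lin0 (trcomp_lin2 _)); exact: (cx_hdeg0 HC).
- by rewrite trcomp_lin2; exact: (cx_hdegL HC).
rewrite (trcompE c d g hf); apply: (hdegZ HC).
apply: (shuffle_mem (cx_hdeg0 HC _) (@cx_hdegL _ _ HC _)) => t et.
have := strelt_hdeg t (trglue_hdeg hf hg); rewrite et -ef -eg.
by rewrite (_ : _ + (m + n) = sdeg c + m + (sdeg d + n)) //; ring.
Qed.

Lemma trcomp_diff X X' X'' p (x : trhom X' X'') (y : trhom X X') : hdeg p x ->
  cdiff (trc x y) = trc (cdiff x) y + sgn k p *: trc x (cdiff y).
Proof.
have L1 := @trcomp_lin1 k C; have L2 := @trcomp_lin2 k C.
have D1 := cdiff_lin (trhom_complex (C := C) X X'').
have D2 := cdiff_lin (trhom_complex (C := C) X' X'').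
have D3 := cdiff_lin (trhom_complex (C := C) X X').
move=> hx; move: x hx; apply: (cyc_hdeg_ind (HX X'' X')).
- by rewrite (lin0 (L1 _ _ _ _)) (lin0 D1) (lin0 D2) !(lin0 (L1 _ _ _ _)) scaler0 addr0.
- move=> a x x' ex ex'; rewrite L1 D1 ex ex' D2 !L1 !scalerDr addrACA.
  by rewrite sgn_scaleC.
move=> Y Y' c f m hf <-; move: y; apply: (cyc_ext (HX X' X)).
- by move=> a y y'; rewrite L2 D1.
- move=> a y y'; rewrite D3 !L2 !scalerDr addrACA -!scalerDr.
  by rewrite [in RHS]scalerDr sgn_scaleC.
by move=> Z Z' d g n hg; exact: trcomp_diff_elt hf hg.
Qed.

Lemma trmorE X X' (f : hom X X') :
  trmor f = strelt (hnil (tone C)) (castH (esym (tob1r X)) (esym (tob1l X')) f).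
Proof. by rewrite /strelt /scyc_elt /= sgn0 scale1r. Qed.

Lemma trmor_lin X X' : linear_map (@trmor k C X X').
Proof. by move=> a f g; rewrite !trmorE castH_lin; exact: strelt_lin. Qed.

Lemma trcomp_trmor_l X X' X'' (f : hom X' X'') p Z Z' (d : hc Z Z')
    (g : hom (X ⋆ Z) (Z' ⋆ X')) : hdeg p f ->
  trc (trmor f) (strelt d g)
  = sgn k (sdeg d * p) *: strelt d ((dgid Z' ⋆⋆ f) ∘ g).
Proof.
move=> hf; rewrite trmorE (trcompE _ _ _ (castH_hdeg _ _ hf)) add0r.
congr (_ *: _); apply: shuffle_unit_r => t et; apply: strelt_tot => //.
exact: tot_trglue_trmor_l.
Qed.

Lemma trcomp_trmor_r X X' X'' Y Y' (c : hc Y Y') (f : hom (X' ⋆ Y) (Y' ⋆ X''))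
    (g : hom X X') :
  trc (strelt c f) (trmor g) = strelt c (f ∘ (g ⋆⋆ dgid Y)).
Proof.
have L1 := @trcomp_lin1 k C.
move: f; apply: homog_hom_ind => [|a f f' ef ef'|p f hf].
- rewrite (lin0 (strelt_lin _)) (lin0 (L1 _ _ _ _)) (lin0 (comp_linl _)).
  by rewrite (lin0 (strelt_lin _)).
- by rewrite strelt_lin L1 ef ef' (dg_compLl P) strelt_lin.
rewrite trmorE (trcompE _ _ _ hf) mul0r sgn0 scale1r.
by apply: shuffle_unit_l => t et; apply: strelt_tot => //; exact: tot_trglue_trmor_r.
Qed.

Lemma trmor_comp X Y Z (f : hom Y Z) (g : hom X Y) :
  trmor (f ∘ g) = trc (trmor f) (trmor g).
Proof.
rewrite [trmor f]trmorE trcomp_trmor_r trmorE; apply: strelt_tot => //.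
rewrite tot_castH; apply: tot_comp; first by rewrite tot_castH.
by rewrite tot_thom1r.
Qed.

Lemma trcomp1l X X' (x : trhom X X') : trc (trmor (dgid X')) x = x.
Proof.
move: x; apply: (cyc_ext (HX X' X)) => [a x y|//|Z Z' d g p hg].
  exact: trcomp_lin2.
rewrite (trcomp_trmor_l _ _ (id_hdeg X')) mulr0 sgn0 scale1r.
by rewrite thom_id (dg_comp1l P).
Qed.

Lemma trcomp1r X X' (x : trhom X X') : trc x (trmor (dgid X)) = x.
Proof.
move: x; apply: (cyc_ext (HX X' X)) => [a x y|//|Z Z' d g p hg].
  exact: trcomp_lin1.
by rewrite trcomp_trmor_r thom_id (dg_comp1r P).
Qed.

Lemma trmor_hdeg X X' n (f : hom X X') : hdeg n f -> hdeg n (trmor f).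
Proof.
by move=> hf; have := strelt_hdeg (hnil (tone C)) (castH_hdeg (esym (tob1r X))
  (esym (tob1l X')) hf); rewrite trmorE add0r.
Qed.

Lemma strelt_nil_diff X X' Y (f : hom (X ⋆ Y) (Y ⋆ X')) :
  cdiff (strelt (hnil Y) f) = strelt (hnil Y) (cdiff f).
Proof.
have DL := cdiff_lin (trhom_complex (C := C) X X').
move: f; apply: (homog_ext (dg_cplx P _ _)) => [a f g|a f g|p f hf].
- by rewrite strelt_lin DL.
- by rewrite (cx_diffL (dg_cplx P _ _)) strelt_lin.
by rewrite (cdiff_strelt _ hf) /= !add0r oppr0 add0r sgn0 scale1r.
Qed.

Lemma trmor_diff X X' (f : hom X X') : trmor (cdiff f) = cdiff (trmor f).
Proof. by rewrite !trmorE strelt_nil_diff castH_diff. Qed.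

Lemma Tr_dgcat : is_dgcat (Tr C).
Proof.
split => /=.
- exact: trhom_complex.
- by move=> X Y Z a f f' g; exact: trcomp_lin1.
- by move=> X Y Z a f g g'; exact: trcomp_lin2.
- by move=> X Y Z p q f g; exact: trcomp_hdeg.
- by move=> X Y Z p f g; exact: trcomp_diff.
- by move=> W X Y Z f g h; exact: trcompA.
- exact: trcomp1l.
- exact: trcomp1r.
- by move=> X; apply: trmor_hdeg; exact: id_hdeg.
- move=> X; have := trmor_diff (dgid X).
  by rewrite (dg_id_diff P) (lin0 (@trmor_lin X X)).
Qed.

Lemma trmor_dgfunctor : @is_dgfunctor k C (Tr C) id (@trmor k C).
Proof.
split=> //=; last by move=> X Y Z f g; exact: trmor_comp.
move=> X Y; split; first exact: trmor_lin.
  by move=> n f; exact: trmor_hdeg.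
exact: trmor_diff.
Qed.

(** * The trace-like structure *)

Lemma trswapE (X Y : ob C) : trswap X Y =
  strelt (hnil X) (castH erefl (esym (tobA X Y X)) (dgid (X ⋆ Y ⋆ X))).
Proof. by rewrite /strelt /scyc_elt /= sgn0 scale1r. Qed.

(** For b in the bar complex from X to X', the identity of X * Y * X' is an
    element of X12(Y * X', X * Y) from X' to X, so b (x) Id is a closed element of
    the trace whenever b is closed.  Left and right multiplication on b correspond
    to composition with Tr because they can be moved through this identity
    ([swap_mid_natural_l], [swap_mid_natural_r]). *)
Section Coherence.
Variable Y : ob C.

Definition swap_mid (X' X : ob C) : hom (X ⋆ Y ⋆ X') (X ⋆ (Y ⋆ X')) :=
  castH erefl (esym (tobA X Y X')) (dgid (X ⋆ Y ⋆ X')).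

Definition coherence X' X (x : bar_mod X' X) : trhom (X ⋆ Y) (Y ⋆ X') :=
  plift (fun c => cyc_sym (M := X12 (Y ⋆ X') (X ⋆ Y)) c (swap_mid X' X) : trhom _ _) x.

Lemma bar_kills (V : lmodType k) X' X (F : hc X' X -> V) :
  multilinear F -> (forall c, (csize c < 2)%N -> F c = 0) ->
  kills (@bar_rel k C X' X) F.
Proof.
move=> HF H0 r; case=> {r} [a c c1 c2 H|c H].
  rewrite /lincomb !big_cons big_nil addr0 /= scale1r scaleN1r (HF _ _ _ _ H).
  by rewrite scaleNr -opprD subrr.
by rewrite /lincomb big_seq1 H0 // scaler0.
Qed.

Lemma coherence_kills X' X : kills (@bar_rel k C X' X)
  (fun c => cyc_sym (M := X12 (Y ⋆ X') (X ⋆ Y)) c (swap_mid X' X) : trhom _ _).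
Proof.
have R := cyc_sym_respects (X12 (Y ⋆ X') (X ⋆ Y)).
by apply: bar_kills => [|c]; [exact: (rc_chain R)|exact: (rc_short R)].
Qed.

Lemma coherence_lin X' X : linear_map (@coherence X' X).
Proof. exact: (plift_linear (@coherence_kills X' X)). Qed.

Lemma coherence_sym X' X (c : hc X' X) :
  coherence (bar_sym c)
  = cyc_sym (M := X12 (Y ⋆ X') (X ⋆ Y)) c (swap_mid X' X) :> trhom _ _.
Proof. exact: (plift_gen (@coherence_kills X' X)). Qed.

Lemma swap_mid_hdeg X' X : hdeg 0 (swap_mid X' X).
Proof. by apply: castH_hdeg; exact: id_hdeg. Qed.

Lemma swap_mid_diff X' X : cdiff (swap_mid X' X) = 0.
Proof. by rewrite castH_diff (dg_id_diff P) (lin0 (castH_lin _ _)). Qed.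

Lemma tot_swap_mid_l X' X W W' (f : hom W (X ⋆ Y ⋆ X')) (g : hom W' (X ⋆ (Y ⋆ X'))) :
  totH f = totH g -> totH (swap_mid X' X ∘ f) = totH g.
Proof.
move=> e; rewrite -[in RHS](dg_comp1l P g); apply: tot_comp => //.
by rewrite tot_castH; apply: tot_id; rewrite tobA.
Qed.

Lemma tot_swap_mid_r X' X W W' (f : hom (X ⋆ (Y ⋆ X')) W) (g : hom (X ⋆ Y ⋆ X') W') :
  totH f = totH g -> totH (f ∘ swap_mid X' X) = totH g.
Proof.
move=> e; rewrite -[in RHS](dg_comp1r P g); apply: tot_comp => //.
by rewrite tot_castH.
Qed.

Lemma swap_mid_natural_r X X' X'' (g : hom X' X'') :
  (dgid X ⋆⋆ (dgid Y ⋆⋆ g)) ∘ swap_mid X' X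
  = swap_mid X'' X ∘ (dgid (X ⋆ Y) ⋆⋆ g).
Proof.
apply: (@tot_inj _ (fun X Y => car (hom X Y))).
rewrite (tot_swap_mid_r (g := dgid X ⋆⋆ dgid Y ⋆⋆ g)); last exact: tot_thomA.
rewrite (tot_swap_mid_l (g := dgid X ⋆⋆ (dgid Y ⋆⋆ g))) ?tot_thomA //.
by rewrite thom_id.
Qed.

Lemma swap_mid_natural_l X X' X'' (g : hom X'' X) :
  swap_mid X' X ∘ (g ⋆⋆ dgid Y ⋆⋆ dgid X') = (g ⋆⋆ dgid (Y ⋆ X')) ∘ swap_mid X' X''.
Proof.
apply: (@tot_inj _ (fun X Y => car (hom X Y))).
rewrite (tot_swap_mid_l (g := g ⋆⋆ (dgid Y ⋆⋆ dgid X'))); last by rewrite tot_thomA.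
rewrite (tot_swap_mid_r (g := g ⋆⋆ dgid Y ⋆⋆ dgid X')) ?tot_thomA //.
by rewrite -tot_thomA thom_id.
Qed.

Lemma bar_sym_multilinear X' X : multilinear (@bar_sym k C X' X).
Proof.
move=> a c c1 c2 H; have := @pgen_kills _ _ _ _ (bar_lin H).
rewrite /lincomb !big_cons big_nil addr0 /= scale1r scaleN1r scaleNr -opprD.
by move/eqP; rewrite subr_eq0 => /eqP.
Qed.

Lemma bar_sym_short X' X (c : hc X' X) : (csize c < 2)%N -> bar_sym c = 0.
Proof.
move=> sc; have := @pgen_kills _ _ _ _ (bar_short sc).
by rewrite /lincomb big_seq1 scale1r.
Qed.

Lemma bar_diff_kills X' X : kills (@bar_rel k C X' X)
  (fun c => sgn k (blen c) *: dint c (@bar_sym k C X' X) + faces c (@bar_sym k C X' X)).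
Proof.
apply: bar_kills => [a c c1 c2 H|c sc].
  have [e1 e2 _ _] := chain_lin_shape H; rewrite /blen e1 e2.
  rewrite (dint_multilinear (@bar_sym_multilinear _ _) H).
  rewrite (faces_multilinear (@bar_sym_multilinear _ _) H).
  by rewrite !scalerDr sgn_scaleC addrACA.
rewrite (@dint_congr _ _ _ _ _ _ _ (fun=> 0)) ?dint0 ?scaler0 ?add0r; last first.
  by move=> c' es _; rewrite bar_sym_short ?es.
rewrite (@faces_congr _ _ _ _ _ _ _ (fun=> 0)) ?faces0 //.
by move=> c' es _; rewrite bar_sym_short // (leq_trans _ sc) // -es.
Qed.

Lemma bar_lact_kills X'' X' X (g : hh X' X'') : kills (@bar_rel k C X' X)
  (fun c => sgn k (hdg g * blen c) *: bar_sym (clact g c)).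
Proof.
apply: bar_kills => [a c c1 c2 H|c sc].
  have [e1 e2 _ _] := chain_lin_shape H; rewrite /blen e1 e2.
  rewrite (bar_sym_multilinear (c := clact g c) (c1 := clact g c1) (c2 := clact g c2) (a := a)).
    by rewrite scalerDr sgn_scaleC.
  case: H g => {c c1 c2 e1 e2}.
    move=> Y1 Z1 X1 f f1 f2 c e1 e2 ef g; apply: lin_here; rewrite /= ?e1 ?e2 //.
    by rewrite ef (dg_compLr P).
  by move=> Y1 Z1 X1 f c c1 c2 H g; exact: lin_there.
by rewrite bar_sym_short ?scaler0 //; exact: csize_clact_short.
Qed.

Lemma bar_ract_kills X'' X' X (g : hh X'' X) : kills (@bar_rel k C X' X)
  (fun c => bar_sym (cract c g)).
Proof.
apply: bar_kills => [a c c1 c2 H|c sc]; last first.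
  by rewrite bar_sym_short //; exact: csize_cract_short.
apply: bar_sym_multilinear; elim: H X'' g => {c c1 c2}.
  move=> Y1 Z1 X1 f f1 f2 c e1 e2 ef X'' g.
  case: c f f1 f2 e1 e2 ef X'' g => [W|Y2 Z2 X2 h c] f f1 f2 e1 e2 ef X'' g /=.
    apply: lin_here; rewrite /= ?e1 ?e2 //.
    by rewrite ef (dg_compLl P).
  exact: lin_here.
move=> Y1 Z1 X1 f c c1 c2 H IH X'' g.
have E (d : hc Z1 X1) : (0 < csize d)%N -> cract (hcons f d) g = hcons f (cract d g).
  by case: d f g {H IH}.
have [s1 s2 _ _] := chain_lin_shape H.
have s0 : (0 < csize c)%N by case: H {IH s1 s2 E}.
by rewrite !E ?s1 ?s2 //; apply: lin_there; exact: IH.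
Qed.

Lemma coherence_cons_snoc X' W Z X (f0 : hh W X') (c : hc W Z) (f1 : hh X Z) :
  coherence (bar_sym (hcons f0 (crcons c f1)))
  = sgn k (hdg f0 * (cdeg c + hdg f1) + shift_exp c) *:
    strelt c ((hval f1 ⋆⋆ dgid (Y ⋆ X'))
              ∘ (swap_mid X' X ∘ (dgid (X ⋆ Y) ⋆⋆ hval f0))).
Proof.
have h : @hdeg k (bm (X12 (Y ⋆ X') (X ⋆ Y)) X X') 0 (swap_mid X' X).
  exact: swap_mid_hdeg.
rewrite coherence_sym (sym_cons_snoc f0 c f1 h) cyc_elt_scyc sgn_sgn.
by rewrite addr0.
Qed.

Lemma coherence_short X' X (c : hc X' X) : (csize c < 2)%N ->
  coherence (bar_sym c) = 0.
Proof. by move=> sc; rewrite bar_sym_short // (lin0 (@coherence_lin _ _)). Qed.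

Lemma coherence_lact X'' X' X (g : hh X' X'') (c : hc X' X) :
  coherence (sgn k (hdg g * blen c) *: bar_sym (clact g c))
  = trc (trmor (dgid Y ⋆⋆ hval g)) (coherence (bar_sym c)).
Proof.
rewrite (linZ (@coherence_lin _ _)).
case: (ltnP (csize c) 2) => sc.
  rewrite !coherence_short ?csize_clact_short //.
  by rewrite (lin0 (trcomp_lin2 _)) scaler0.
case: c g sc => [//|X1 W X2 f0 c] g sc.
case: (snocP c) f0 g sc => [//|W1 Z Z1 c0 f1] f0 g _.
rewrite [clact _ _]/= !coherence_cons_snoc (linZ (trcomp_lin2 _) (sgn _ _)).
rewrite (trcomp_trmor_l _ _ (thom_hdeg_r Y (hvalP g))) [LHS]sgn_sgn [RHS]sgn_sgn.
rewrite [in RHS](dg_compA P).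
rewrite (thom_comp_rl (hvalP f1) (thom_hdeg_r Y (hvalP g))).
rewrite (linZ (comp_linl _)) -(thom_comp_lr (hval f1) (dgid Y ⋆⋆ hval g)).
rewrite -(dg_compA P) [(dgid _ ⋆⋆ (dgid Y ⋆⋆ _)) ∘ _](dg_compA P).
rewrite swap_mid_natural_r -(dg_compA P) -thom_comp_r (linZ (strelt_lin _)) [RHS]sgn_sgn.
by congr (_ *: _); rewrite /blen /= csize_snoc sdegE; parity.
Qed.

Lemma coherence_ract X' X X'' (c : hc X' X) (g : hh X'' X) :
  coherence (bar_sym (cract c g))
  = trc (coherence (bar_sym c)) (trmor (hval g ⋆⋆ dgid Y)).
Proof.
case: (ltnP (csize c) 2) => sc.
  by rewrite !coherence_short ?csize_cract_short // (lin0 (trcomp_lin1 _)).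
case: c g sc => [//|X1 W X2 f0 c] g sc.
case: (snocP c) f0 g sc => [//|W1 Z Z1 c0 f1] f0 g _.
rewrite (@cract_snoc _ _ _ _ _ _ (hcons f0 c0)).
rewrite (_ : crcons (hcons f0 c0) _ = hcons f0 (crcons c0 (hcomp f1 g))) //.
rewrite !coherence_cons_snoc (linZ (trcomp_lin1 _) (sgn _ _)) trcomp_trmor_r.
rewrite -!(dg_compA P).
rewrite (thom_comp_rl (thom_hdeg_l Y (hvalP g)) (hvalP f0)).
rewrite -(thom_comp_lr (hval g ⋆⋆ dgid Y) (hval f0)) !(linZ (comp_linr _)) (linZ (strelt_lin _)) [RHS]sgn_sgn.
rewrite [swap_mid _ _ ∘ (_ ∘ _)](dg_compA P) swap_mid_natural_l.
rewrite !(dg_compA P) -thom_comp_l.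
by congr (_ *: _); rewrite /=; parity.
Qed.

Lemma coherence_bimod_map :
  @is_bimod_map k C (bar C) (@hom_bimod k C (Tr C)
      (fun X => X ⋆ Y) (fun X => Y ⋆ X)
      (fun X X' f => trmor (f ⋆⋆ dgid Y)) (fun X X' f => trmor (dgid Y ⋆⋆ f)))
    coherence.
Proof.
have CL X' X := @coherence_lin X' X.
split.
- move=> X' X; split; first exact: coherence_lin.
    move=> n; apply: (lspan_map (@coherence_lin X' X)) => x [c <- ->].
    have h : @hdeg k (bm (X12 (Y ⋆ X') (X ⋆ Y)) X X') 0 (swap_mid X' X).
      exact: swap_mid_hdeg.
    rewrite coherence_sym; apply: (cyc_sym_hdeg h).
    by rewrite addr0.
  have DL := cdiff_lin (trhom_complex (C := C) (X ⋆ Y) (Y ⋆ X')).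
  have BL : linear_map (@cdiff k (bm (bar C) X' X)).
    exact: plift_linear (@bar_diff_kills X' X).
  apply: presented_ind => [|a x y ex ey|c].
  + by rewrite (lin0 BL) !(lin0 (CL _ _)) (lin0 DL).
  + by rewrite BL !CL DL ex ey.
  rewrite /= [bar_diff _](plift_gen (@bar_diff_kills X' X)).
  rewrite (linD (CL _ _)) (linZ (CL _ _)) (dint_map (CL _ _)) (faces_map (CL _ _)).
  rewrite [pgen _ c]/(bar_sym c) coherence_sym (cyc_diff_sym (HX _ _)) /sym_diff.
  rewrite swap_mid_diff (lin0 (rc_mod (cyc_sym_respects _) _)) scaler0 addr0.
  congr (_ *: _ + _).
    by apply: dint_congr => c' _ _; exact: coherence_sym.
  by apply: faces_congr => c' _ _; exact: coherence_sym.
- move=> X'' X' X g.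
  have BL : linear_map (fun x : bm (bar C) X' X => lact g x).
    exact: plift_linear (@bar_lact_kills X'' X' X g).
  apply: presented_ind => [|a x y ex ey|c].
  + by rewrite (lin0 BL) !(lin0 (CL _ _)) /= (lin0 (trcomp_lin2 _)).
  + by rewrite BL !CL ex ey /= (trcomp_lin2 _).
  apply: etrans (coherence_lact g c); congr coherence.
  exact: (plift_gen (@bar_lact_kills X'' X' X g)).
move=> X' X X'' x g; move: x.
have BL : linear_map (fun x : bm (bar C) X' X => ract x g).
  exact: plift_linear (@bar_ract_kills X'' X' X g).
apply: presented_ind => [|a x y ex ey|c].
- by rewrite (lin0 BL) !(lin0 (CL _ _)) /= (lin0 (trcomp_lin1 _)).
- by rewrite BL !CL ex ey /= (trcomp_lin1 _).
apply: etrans (coherence_ract c g); congr coherence.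
exact: (plift_gen (@bar_ract_kills X'' X' X g)).
Qed.

End Coherence.

Lemma trswap_natural (X Y Y' : ob C) (g : hom Y Y') :
  trc (trmor (g ⋆⋆ dgid X)) (trswap X Y) = trc (trswap X Y') (trmor (dgid X ⋆⋆ g)).
Proof.
rewrite !trswapE trcomp_trmor_r -!/(swap_mid _ _ _).
transitivity (strelt (hnil X) ((dgid X ⋆⋆ (g ⋆⋆ dgid X)) ∘ swap_mid Y X X)).
  move: g; apply: homog_hom_ind => [|a g g' e e'|p g hg].
  - rewrite thom0l (lin0 (@trmor_lin _ _)) (lin0 (trcomp_lin1 _)) thom0r.
    by rewrite (lin0 (comp_linl _)) (lin0 (strelt_lin _)).
  - rewrite thomLl trmor_lin trcomp_lin1 e e' thomLr (dg_compLl P).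
    by rewrite strelt_lin.
  by rewrite (trcomp_trmor_l _ _ (thom_hdeg_l X hg)) mul0r sgn0 scale1r.
apply: strelt_tot => //.
rewrite (tot_swap_mid_r (g := dgid X ⋆⋆ g ⋆⋆ dgid X)); last exact: tot_thomA.
by rewrite (tot_swap_mid_l (g := dgid X ⋆⋆ (g ⋆⋆ dgid X))) ?tot_thomA.
Qed.

Lemma trswap_trace_like : homotopy_trace_like (@trswap k C).
Proof.
split.
- move=> X Y; rewrite trswapE.
  have := strelt_hdeg (hnil X) (swap_mid_hdeg Y X X).
  by rewrite add0r.
- by move=> X Y; rewrite trswapE strelt_nil_diff swap_mid_diff (lin0 (strelt_lin _)).
- by move=> X Y Y' g; exact: trswap_natural.
move=> Y; exists (coherence Y); split; first exact: coherence_bimod_map.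
by move=> X; rewrite coherence_sym.
Qed.

End TraceFunctor.

(** * Functoriality in the category and the bimodule *)

Section Functoriality.
Variables (k : comPzRingType) (C D : dgcat k) (F0 : ob C -> ob D).
Variable F1 : forall X Y, dghom X Y -> dghom (F0 X) (F0 Y).
Hypothesis HF : is_dgfunctor F1.
Local Notation hcC := (hchain (C := C)).
Local Notation hcD := (hchain (C := D)).
Local Notation hh X Y := (helt (@dghom k C X Y)).

Definition helt_map X Y (f : hh X Y) : helt (@dghom k D (F0 X) (F0 Y)) :=
  Helt (cm_hdeg (df_cplx HF X Y) (hvalP f)).

Fixpoint chain_map Y X (c : hcC Y X) : hcD (F0 Y) (F0 X) :=
  match c in hchain Y X return hcD (F0 Y) (F0 X) with
  | hnil X => hnil (F0 X)
  | hcons _ _ _ f c' => hcons (helt_map f) (chain_map c')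
  end.

Lemma helt_map_comp X Y Z (f : hh Y Z) (g : hh X Y) :
  helt_map (hcomp f g) = hcomp (helt_map f) (helt_map g).
Proof. by apply: helt_eq => //=; rewrite (df_comp HF). Qed.

Lemma helt_map_id X : helt_map (hid X) = hid (F0 X).
Proof. by apply: helt_eq => //=; rewrite (df_id HF). Qed.

Lemma helt_map_diff X Y (f : hh X Y) : helt_map (hdiff f) = hdiff (helt_map f).
Proof. by apply: helt_eq => //=; rewrite (cm_diff (df_cplx HF X Y)). Qed.

Lemma chain_map_size Y X (c : hcC Y X) : csize (chain_map c) = csize c.
Proof. by elim: c => //= {}Y Z {}X f c ->. Qed.

Lemma chain_map_deg Y X (c : hcC Y X) : cdeg (chain_map c) = cdeg c.
Proof. by elim: c => //= {}Y Z {}X f c ->. Qed.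

Lemma chain_map_snoc Y Z X (c : hcC Y Z) (f : hh X Z) :
  chain_map (crcons c f) = crcons (chain_map c) (helt_map f).
Proof. by elim: c X f => //= {}Y W {}Z g c IH X f; rewrite IH. Qed.

Lemma chain_map_cract Y X X' (c : hcC Y X) (f : hh X' X) :
  chain_map (cract c f) = cract (chain_map c) (helt_map f).
Proof.
case: (snocP c) f => [?|Y1 Z X1 d g] // f.
by rewrite cract_snoc !chain_map_snoc cract_snoc helt_map_comp.
Qed.

Lemma chain_map_clact Y Y' X (c : hcC Y X) (f : hh Y Y') :
  chain_map (clact f c) = clact (helt_map f) (chain_map c).
Proof. by case: c f => [//|? ? ? g c] f /=; rewrite helt_map_comp. Qed.

Lemma chain_map_pad Y X (c : hcC Y X) : chain_map (pad c) = pad (chain_map c).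
Proof. by rewrite /pad /= chain_map_snoc !helt_map_id. Qed.

Lemma chain_map_lin a Y X (c c1 c2 : hcC Y X) :
  chain_lin a c c1 c2 -> chain_lin a (chain_map c) (chain_map c1) (chain_map c2).
Proof.
elim=> [Y1 Z X1 f f1 f2 d e1 e2 ef|Y1 Z X1 f d d1 d2 _ IH].
  by apply: lin_here => //=; rewrite ef (cm_linear (df_cplx HF _ _)).
exact: lin_there.
Qed.

Lemma dint_chain_map (V : lmodType k) Y X (c : hcC Y X)
    (K : hcD (F0 Y) (F0 X) -> V) :
  dint (chain_map c) K = dint c (fun c' => K (chain_map c')).
Proof. by elim: c K => //= {}Y Z {}X f c IH K; rewrite IH helt_map_diff. Qed.

Lemma faces_chain_map (V : lmodType k) Y X (c : hcC Y X)
    (K : hcD (F0 Y) (F0 X) -> V) :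
  faces (chain_map c) K = faces c (fun c' => K (chain_map c')).
Proof.
elim: c K => //= {}Y Z {}X f c IH K; rewrite IH; congr (_ - _).
by case: c f K {IH} => //= ? ? ? g c f K; rewrite helt_map_comp.
Qed.

Variables (M : bimod C) (N : bimod D) (HM : is_bimod M) (HN : is_bimod N).
Variable psi : forall Y X, bm M Y X -> bm N (F0 Y) (F0 X).
Hypothesis psi_map : forall Y X, is_cplx_map (@psi Y X).
Hypothesis psi_lact : forall Y' Y X (f : hh Y Y') (m : bm M Y X),
  psi (lact f m) = lact (helt_map f) (psi m).
Hypothesis psi_ract : forall Y X X' (m : bm M Y X) (f : hh X' X),
  psi (ract m f) = ract (psi m) (helt_map f).

Lemma cyc_map_respects : respects_cyc_rel
  (fun Y Z c (m : bm M Z Y) => cyc_sym (chain_map c) (psi m)).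
Proof.
have R := cyc_sym_respects N.
split.
- by move=> Y Z m a c c1 c2 /chain_map_lin; exact: (rc_chain R).
- by move=> Y Z c a m m'; rewrite (cm_linear (psi_map _ _)); exact: (rc_mod R).
- by move=> Y Z c m sc; apply: (rc_short R); rewrite chain_map_size.
- move=> Y Z Z' c g m sc; rewrite chain_map_cract psi_lact.
  by apply: (rc_bal R); rewrite chain_map_size.
move=> Y Y' Z p f c m hm sc; rewrite chain_map_clact psi_ract.
have hm' := cm_hdeg (psi_map _ _) hm.
have /= := rc_comm R (helt_map f) hm' (c := chain_map c).
by rewrite /bdeg /blen chain_map_size chain_map_deg; exact.
Qed.

(** Functoriality in the pair (C, M), with the same formula on symbols.  The case of
    the identity functor gives maps of coefficients. *)
Definition cyc_map : cyc M -> cyc N :=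
  cyc_lift (fun Y Z c (m : bm M Z Y) => cyc_sym (chain_map c) (psi m)).

Lemma cyc_map_lin : linear_map cyc_map.
Proof. exact: cyc_lift_lin cyc_map_respects. Qed.

Lemma cyc_map_sym Y Z (c : hcC Y Z) (m : bm M Z Y) :
  cyc_map (cyc_sym c m) = cyc_sym (chain_map c) (psi m).
Proof. exact: (cyc_lift_sym cyc_map_respects). Qed.

Lemma cyc_map_elt Y Z (c : hcC Y Z) (m : bm M Z Y) :
  cyc_map (cyc_elt c m) = cyc_elt (chain_map c) (psi m).
Proof. by rewrite /cyc_elt cyc_map_sym chain_map_pad. Qed.

Lemma cyc_map_cplx : is_cplx_map cyc_map.
Proof.
split; first exact: cyc_map_lin.
  move=> n; apply: (lspan_map cyc_map_lin) => x [Y [Z [c [m [p [hm <- ->]]]]]].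
  rewrite cyc_map_sym; apply: (cyc_sym_hdeg (cm_hdeg (psi_map _ _) hm)).
  by rewrite /bdeg /blen chain_map_size chain_map_deg.
apply: cyc_sym_ind => [|a x y ex ey|Y Z c m].
- have DM := cdiff_lin (cyc_complex HM); have DN := cdiff_lin (cyc_complex HN).
  by rewrite (lin0 DM) (lin0 cyc_map_lin) (lin0 DN).
- have DM := cdiff_lin (cyc_complex HM); have DN := cdiff_lin (cyc_complex HN).
  by rewrite DM !cyc_map_lin DN ex ey.
have -> : cdiff (cyc_sym c m : cyc M) = sym_diff c m by exact: cyc_diff_sym.
rewrite cyc_map_sym.
have -> : cdiff (cyc_sym (chain_map c) (psi m) : cyc N)
  = sym_diff (chain_map c) (psi m) by exact: cyc_diff_sym.
rewrite /sym_diff !(linD cyc_map_lin) !(linZ cyc_map_lin) cyc_map_sym.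
rewrite (dint_map cyc_map_lin) (faces_map cyc_map_lin).
rewrite dint_chain_map faces_chain_map (cm_diff (psi_map _ _)).
rewrite /bdeg /blen chain_map_size chain_map_deg; congr (_ *: _ + _ + _).
  by apply: dint_congr => c' _ _; exact: cyc_map_sym.
by apply: faces_congr => c' _ _; exact: cyc_map_sym.
Qed.

End Functoriality.

Section IdentityFunctor.
Variables (k : comPzRingType) (C : dgcat k).

Lemma id_dgfunctor : @is_dgfunctor k C C id (fun X Y f => f).
Proof. by split=> // X Y; split. Qed.

Lemma chain_map_id Y X (c : hchain (C := C) Y X) : chain_map id_dgfunctor c = c.
Proof.
elim: c => //= {}Y Z {}X f c ->; congr hcons.
exact: helt_eq.
Qed.
End IdentityFunctor.

(** * Cohomology *)

Section CohomologyFacts.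
Variables (k : comPzRingType) (A : cplx k).
Hypothesis HA : is_complex A.

Lemma coh_clsE (z : A) (e : cdiff z = 0) :
  coh_cls z = pgen (@coh_rel k A) (exist _ z e).
Proof.
rewrite /coh_cls; case: pselect => // e'.
by rewrite (Prop_irrelevance e e').
Qed.

Lemma coh_cls_lin a (x y : A) : cdiff x = 0 -> cdiff y = 0 ->
  coh_cls (a *: x + y) = a *: coh_cls x + coh_cls y.
Proof.
move=> ex ey; have exy : cdiff (a *: x + y) = 0.
  by rewrite (cx_diffL HA) ex ey scaler0 addr0.
rewrite !coh_clsE; have := @pgen_kills _ _ _ _ (@coh_lin k A a (exist _ _ exy)
  (exist _ _ ex) (exist _ _ ey) erefl).
rewrite /lincomb !big_cons big_nil addr0 /= scale1r scaleN1r scaleNr -opprD.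
by move/eqP; rewrite subr_eq0 => /eqP.
Qed.

Lemma coh_cls_bnd (b : A) : coh_cls (cdiff b) = 0.
Proof.
rewrite (coh_clsE (cx_diffK HA b)).
have := @pgen_kills _ _ _ _ (@coh_bnd k A (exist _ _ (cx_diffK HA b)) b erefl).
by rewrite /lincomb big_seq1 scale1r.
Qed.

Lemma coh_cls0 : coh_cls (0 : A) = 0.
Proof.
have <- : cdiff (0 : A) = 0 by exact: (lin0 (cdiff_lin HA)).
exact: coh_cls_bnd.
Qed.

Lemma coh_cls_surj (x : coh A) : exists2 z : A, cdiff z = 0 & x = coh_cls z.
Proof.
move: x; apply: presented_ind => [|a x y [z ez ->] [w ew ->]|[z ez]].
- by exists 0; rewrite ?coh_cls0 // (lin0 (cdiff_lin HA)).
- exists (a *: z + w); last by rewrite coh_cls_lin.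
  by rewrite (cx_diffL HA) ez ew scaler0 addr0.
by exists z; rewrite // coh_clsE.
Qed.

(** A linear function on cocycles that vanishes on coboundaries descends to
    cohomology. *)
Lemma coh_kills (V : lmodType k) (F : A -> V) :
  (forall a x y, cdiff x = 0 -> cdiff y = 0 -> F (a *: x + y) = a *: F x + F y) ->
  (forall b, F (cdiff b) = 0) -> kills (@coh_rel k A) (fun z => F (sval z)).
Proof.
move=> FL FB r; case=> {r} [a z z1 z2 e|z b e]; last first.
  by rewrite /lincomb big_seq1 /= e FB scaler0.
rewrite /lincomb !big_cons big_nil addr0 /= scale1r scaleN1r scaleNr -opprD.
by rewrite e FL ?subrr //; [exact: (svalP z1)|exact: (svalP z2)].
Qed.

Lemma coh_lift_cls (V : lmodType k) (F : A -> V) :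
  (forall a x y, cdiff x = 0 -> cdiff y = 0 -> F (a *: x + y) = a *: F x + F y) ->
  (forall b, F (cdiff b) = 0) ->
  forall z, cdiff z = 0 ->
  plift (R := @coh_rel k A) (fun z => F (sval z)) (coh_cls z) = F z.
Proof. by move=> FL FB z ez; rewrite coh_clsE (plift_gen (coh_kills FL FB)). Qed.

End CohomologyFacts.

Section CohomologyMap.
Variables (k : comPzRingType) (A B : cplx k).
Hypotheses (HA : is_complex A) (HB : is_complex B).
Variable u : A -> B.
Hypothesis Hu : is_cplx_map u.

Definition coh_map (x : coh A) : coh B := plift (fun z => coh_cls (u (sval z))) x.

Lemma cplx_map_cocycle z : cdiff z = 0 -> cdiff (u z) = 0.
Proof.
have L : linear_map u by exact: (cm_linear Hu).
by move=> ez; rewrite -(cm_diff Hu) ez (lin0 L).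
Qed.

Let FL a x y : cdiff x = 0 -> cdiff y = 0 ->
  coh_cls (u (a *: x + y)) = a *: coh_cls (u x) + coh_cls (u y).
Proof.
by move=> ex ey; rewrite (cm_linear Hu) coh_cls_lin //; exact: cplx_map_cocycle.
Qed.

Let FB b : coh_cls (u (cdiff b)) = 0.
Proof. by rewrite (cm_diff Hu) coh_cls_bnd. Qed.

Lemma coh_map_lin : linear_map coh_map.
Proof. exact: plift_linear (coh_kills FL FB). Qed.

Lemma coh_map_cls z : cdiff z = 0 -> coh_map (coh_cls z) = coh_cls (u z).
Proof. exact: (coh_lift_cls FL FB). Qed.

Lemma coh_map_deg n x : coh_deg n x -> coh_deg n (coh_map x).
Proof.
move=> [z [hz ez ->]]; exists (u z); split.
- exact: (cm_hdeg Hu).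
- exact: cplx_map_cocycle.
by rewrite coh_map_cls.
Qed.
End CohomologyMap.

Section CohomologyProduct.
Variables (k : comPzRingType) (D : dgdata k).
Hypothesis P : is_dgcat D.
Local Notation hom := (@dghom k D).

Lemma comp_diff_cocycle X Y Z (f : hom Y Z) (g : hom X Y) :
  cdiff g = 0 -> cdiff (f ∘ g) = cdiff f ∘ g.
Proof.
move=> eg; have DL U V := cdiff_lin (dg_cplx P U V).
have CL : linear_map (fun f : hom Y Z => f ∘ g).
  by move=> a x y; exact: (dg_compLl P).
have CR (h : hom Y Z) : linear_map (fun g : hom X Y => h ∘ g).
  by move=> a x y; exact: (dg_compLr P).
move: f; apply: (homog_ext (dg_cplx P Y Z)) => [a x y|a x y|p f hf].
- by rewrite CL DL.
- by rewrite DL CL.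
by rewrite (dg_comp_diff P _ hf) eg (lin0 (CR _)) scaler0 addr0.
Qed.

(** For f of degree p this is f db = (-1)^p d(f b); inhomogeneous cocycles need the
    sign to be distributed over components, hence [twist]. *)
Lemma comp_cocycle_diff X Y Z (f : hom Y Z) (b : hom X Y) :
  cdiff f = 0 -> exists b', f ∘ cdiff b = cdiff b'.
Proof.
have DL U V := cdiff_lin (dg_cplx P U V); have A := dg_cplx P Y Z.
have CL (g : hom X Y) : linear_map (fun f : hom Y Z => f ∘ g).
  by move=> a x y; exact: (dg_compLl P).
have TL := twist_lin A 1.
have E : forall h : hom Y Z,
    cdiff (twist A 1 h ∘ b) = - (twist A 1 (cdiff h) ∘ b) + h ∘ cdiff b.
  apply: (homog_ext A) => [a x y|a x y|p h hh].
  - by rewrite TL CL DL.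
  - by rewrite DL TL !CL scalerDr scalerN opprD addrACA.
  rewrite (twist_homog _ _ hh) (twist_homog _ _ (cx_diff_hdeg A hh)).
  rewrite !(linZ (CL _)) (linZ (DL _ _)) (dg_comp_diff P _ hh) scalerDr scalerA.
  rewrite !mul1r -sgnD sgnS scaleNr opprK; congr (_ + _).
  have -> : sgn k (p + p) = sgn k 0 by parity.
  by rewrite sgn0 scale1r.
move=> ef; exists (twist A 1 f ∘ b).
by rewrite E ef (lin0 TL) (lin0 (CL _)) oppr0 add0r.
Qed.

Lemma coh_mul_cls X (x y : hom X X) : cdiff x = 0 -> cdiff y = 0 ->
  coh_mul (@dgcomp k D X X X) (coh_cls x) (coh_cls y) = coh_cls (x ∘ y).
Proof.
have A := dg_cplx P X X; have DL := cdiff_lin A.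
have CL (g : hom X X) : linear_map (fun f : hom X X => f ∘ g).
  by move=> a f f'; exact: (dg_compLl P).
have cc (f g : hom X X) : cdiff f = 0 -> cdiff g = 0 -> cdiff (f ∘ g) = 0.
  by move=> ef eg; rewrite comp_diff_cocycle // ef (lin0 (CL g)).
have inner (f g : hom X X) : cdiff f = 0 -> cdiff g = 0 ->
    plift (R := @coh_rel k _) (fun z => coh_cls (f ∘ sval z)) (coh_cls g)
    = coh_cls (f ∘ g).
  move=> ef; apply: (coh_lift_cls (F := fun z => coh_cls (f ∘ z))) => //.
    by move=> a z w ez ew; rewrite (dg_compLr P) (coh_cls_lin A) //; exact: cc.
  by move=> b; have [b' ->] := comp_cocycle_diff b ef; exact: coh_cls_bnd.
move=> ex ey; rewrite /coh_mul.
rewrite (coh_clsE ex) (@plift_gen _ _ (@coh_rel k _)) /= ?inner //.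
move=> r; case=> {r} [a z z1 z2 e|z b e].
  rewrite /lincomb !big_cons big_nil addr0 /= scale1r scaleN1r scaleNr -opprD.
  have [ez ez1 ez2] := And3 (svalP z) (svalP z1) (svalP z2).
  rewrite !inner // e (dg_compLl P) (coh_cls_lin A) ?subrr //; exact: cc.
rewrite /lincomb big_seq1 /= inner //; last exact: (svalP z).
by rewrite e -comp_diff_cocycle // coh_cls_bnd // scaler0.
Qed.
End CohomologyProduct.

(** * The cyclic bar complex as endomorphisms of the trace of the unit *)

Section CyclicBar.
Variables (k : comPzRingType) (C : smdgcat k).
Local Notation hom := (@dghom k C).
Local Notation hc := (hchain (C := C)).
Local Notation hh X Y := (helt (@dghom k C X Y)).
Local Notation one := (tone C).
Local Notation trc := (@trcomp k C _ _ _).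
Let P := dgP C.
Let HX := @X12_bimodP k C one one.
Let HD := @diag_bimodP k C.

Definition to_unit X Y (f : hom X Y) : hom (one ⋆ X) (Y ⋆ one) :=
  castH (esym (tob1l X)) (esym (tob1r Y)) f.
Definition of_unit X Y (f : hom (one ⋆ X) (Y ⋆ one)) : hom X Y :=
  castH (tob1l X) (tob1r Y) f.

Lemma tot_to_unit X Y (f : hom X Y) : totH (to_unit f) = totH f.
Proof. exact: tot_castH. Qed.

Lemma tot_of_unit X Y (f : hom (one ⋆ X) (Y ⋆ one)) : totH (of_unit f) = totH f.
Proof. exact: tot_castH. Qed.

Lemma to_unitK X Y (f : hom X Y) : of_unit (to_unit f) = f.
Proof.
by apply: (@tot_inj _ (fun X Y => car (hom X Y))); rewrite tot_of_unit tot_to_unit.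
Qed.

Lemma of_unitK X Y (f : hom (one ⋆ X) (Y ⋆ one)) : to_unit (of_unit f) = f.
Proof.
by apply: (@tot_inj _ (fun X Y => car (hom X Y))); rewrite tot_to_unit tot_of_unit.
Qed.

Lemma to_unit_lact X Y Y' (a : hom Y Y') (f : hom X Y) :
  to_unit (a ∘ f) = (a ⋆⋆ dgid one) ∘ to_unit f.
Proof.
apply: (@tot_inj _ (fun X Y => car (hom X Y))); rewrite tot_to_unit.
by apply: tot_comp; rewrite ?tot_thom1r ?tot_to_unit.
Qed.

Lemma to_unit_ract X X' Y (f : hom X Y) (a : hom X' X) :
  to_unit (f ∘ a) = to_unit f ∘ (dgid one ⋆⋆ a).
Proof.
apply: (@tot_inj _ (fun X Y => car (hom X Y))); rewrite tot_to_unit.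
by apply: tot_comp; rewrite ?tot_thom1l ?tot_to_unit.
Qed.

Lemma castH_cplx X X' Y Y' (e : X = X') (e' : Y = Y') :
  is_cplx_map (castH e e' : hom X Y -> hom X' Y').
Proof.
split; first exact: castH_lin.
  by move=> n x; exact: castH_hdeg.
by move=> x; rewrite castH_diff.
Qed.

Definition cyc_to_tr : cyclic_bar C -> trhom one one :=
  cyc_map (id_dgfunctor C) (M := diag_bimod C) (N := X12 one one)
    (fun Y X f => to_unit f).

Definition tr_to_cyc : trhom one one -> cyclic_bar C :=
  cyc_map (id_dgfunctor C) (M := X12 one one) (N := diag_bimod C)
    (fun Y X f => of_unit f).

Lemma cyc_to_tr_cplx : is_cplx_map cyc_to_tr.
Proof.
apply: (cyc_map_cplx HD HX) => [Y X|Y' Y X f m|Y X X' m f].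
- exact: castH_cplx.
- exact: to_unit_lact.
- exact: to_unit_ract.
Qed.

Lemma cyc_to_tr_elt Y Y' (c : hc Y Y') (f : hom Y Y') :
  cyc_to_tr (cyc_elt (M := diag_bimod C) c f) = trelt c (to_unit f).
Proof.
rewrite /cyc_to_tr cyc_map_elt ?chain_map_id //.
- by move=> Z X; exact: castH_cplx.
- by move=> *; exact: to_unit_lact.
- by move=> *; exact: to_unit_ract.
Qed.

Lemma tr_to_cyc_cplx : is_cplx_map tr_to_cyc.
Proof.
apply: (cyc_map_cplx HX HD) => [Y X|Y' Y X f m|Y X X' m f].
- exact: castH_cplx.
- by apply: (can_inj (@to_unitK _ _)); rewrite /= to_unit_lact !of_unitK.
- by apply: (can_inj (@to_unitK _ _)); rewrite /= to_unit_ract !of_unitK.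
Qed.

Lemma tr_to_cyc_elt Y Y' (c : hc Y Y') (f : hom (one ⋆ Y) (Y' ⋆ one)) :
  tr_to_cyc (trelt c f) = cyc_elt (M := diag_bimod C) c (of_unit f).
Proof.
rewrite /tr_to_cyc /trelt cyc_map_elt ?chain_map_id //.
- by move=> Z X; exact: castH_cplx.
- by move=> *; apply: (can_inj (@to_unitK _ _)); rewrite /= to_unit_lact !of_unitK.
- by move=> *; apply: (can_inj (@to_unitK _ _)); rewrite /= to_unit_ract !of_unitK.
Qed.

Lemma cyc_to_tr_lin : linear_map cyc_to_tr.
Proof. exact: (cm_linear cyc_to_tr_cplx). Qed.

Lemma tr_to_cyc_lin : linear_map tr_to_cyc.
Proof. exact: (cm_linear tr_to_cyc_cplx). Qed.

Lemma cyc_to_tr_scyc Y Y' (c : hc Y Y') (f : hom Y Y') :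
  cyc_to_tr (scyc_elt (M := diag_bimod C) c f) = strelt c (to_unit f).
Proof. by rewrite /scyc_elt (linZ cyc_to_tr_lin) cyc_to_tr_elt. Qed.

Lemma tr_to_cyc_strelt Y Y' (c : hc Y Y') (f : hom (one ⋆ Y) (Y' ⋆ one)) :
  tr_to_cyc (strelt c f) = scyc_elt (M := diag_bimod C) c (of_unit f).
Proof.
rewrite /strelt {1}/scyc_elt (linZ tr_to_cyc_lin).
by rewrite -/(trelt c f) tr_to_cyc_elt.
Qed.

Lemma cyc_to_trK : cancel cyc_to_tr tr_to_cyc.
Proof.
move=> x; move: x; apply: (cyc_ext HD) => [a x y|//|Y Z c m p _].
  by rewrite cyc_to_tr_lin tr_to_cyc_lin.
by rewrite cyc_to_tr_scyc tr_to_cyc_strelt to_unitK.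
Qed.

Lemma tr_to_cycK : cancel tr_to_cyc cyc_to_tr.
Proof.
move=> x; move: x; apply: (cyc_ext HX) => [a x y|//|Y Z c m p _].
  by rewrite tr_to_cyc_lin cyc_to_tr_lin.
by rewrite tr_to_cyc_strelt cyc_to_tr_scyc of_unitK.
Qed.

(** Gluing over the unit is (Id * f)(g * Id), that is, g * f up to the interchange
    sign. *)
Lemma trglue_unit Y Y' Z Z' (f : hom Y Y') (g : hom Z Z') p q :
  hdeg p f -> hdeg q g ->
  of_unit (trglue (to_unit f) (to_unit g)) = sgn k (p * q) *: (g ⋆⋆ f).
Proof.
move=> hf hg; rewrite -(thom_comp_rl hg hf).
apply: (@tot_inj _ (fun X Y => car (hom X Y))); rewrite tot_of_unit.
apply: tot_comp; rewrite tot_castH; apply: tot_thom => //; exact: tot_to_unit.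
Qed.

(** The product of C(C), transported from End(Tr(1)); it satisfies the formula that
    characterizes the product ([cyc_mulP]). *)
Definition cyc_mul (x y : cyclic_bar C) : cyclic_bar C :=
  tr_to_cyc (trc (cyc_to_tr x) (cyc_to_tr y)).

Lemma cyc_mulP : is_cyclic_bar_mul cyc_mul.
Proof.
split.
- by move=> a x x' y; rewrite /cyc_mul cyc_to_tr_lin trcomp_lin1 tr_to_cyc_lin.
- by move=> a x y y'; rewrite /cyc_mul cyc_to_tr_lin trcomp_lin2 tr_to_cyc_lin.
move=> Y Y' Z Z' c d f g; rewrite /cyc_mul !cyc_to_tr_scyc.
rewrite (trcompE _ _ _ (castH_hdeg _ _ (hvalP f))) (linZ tr_to_cyc_lin).
rewrite (shuffle_map tr_to_cyc_lin) [in RHS]sgnD -scalerA; congr (_ *: _).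
rewrite -[X in _ = _ *: X]/(shuffle_sum d c (fun t =>
  scyc_elt (M := diag_bimod C) t (hval g ⋆⋆ hval f))) -shuffleZ; apply: shuffle_congr => t _ _.
by rewrite tr_to_cyc_strelt (trglue_unit (hvalP f) (hvalP g)) (linZ (scyc_elt_lin _)).
Qed.

Lemma cyclic_bar_mulP : is_cyclic_bar_mul (@cyclic_bar_mul k C).
Proof. by apply: epsilon_spec; exists cyc_mul; exact: cyc_mulP. Qed.

Lemma cyclic_bar_mul_uniq m1 m2 :
  is_cyclic_bar_mul m1 -> is_cyclic_bar_mul m2 ->
  forall x y : cyclic_bar C, m1 x y = m2 x y.
Proof.
move=> [l1 r1 e1] [l2 r2 e2] x y.
move: x; apply: (cyc_ext HD) => [a x x'|a x x'|Y Z c m p hm] //.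
move: y; apply: (cyc_ext HD) => [a x x'|a x x'|Y' Z' d n q hn] //.
by rewrite (e1 _ _ _ _ c d (Helt hm) (Helt hn)) (e2 _ _ _ _ c d (Helt hm) (Helt hn)).
Qed.

Lemma cyclic_bar_mulE x y : cyclic_bar_mul x y = cyc_mul x y.
Proof. exact: cyclic_bar_mul_uniq cyclic_bar_mulP cyc_mulP x y. Qed.

Lemma cyc_to_tr_mul x y :
  cyc_to_tr (cyclic_bar_mul x y) = trc (cyc_to_tr x) (cyc_to_tr y).
Proof. by rewrite cyclic_bar_mulE tr_to_cycK. Qed.

Lemma cyc_to_tr_one : cyc_to_tr (cyclic_bar_one C) = trmor (dgid one).
Proof.
rewrite cyc_to_tr_elt; congr (trelt _ _).
by apply: (@tot_inj _ (fun X Y => car (hom X Y))); rewrite !tot_castH.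
Qed.

Lemma cyclic_bar_dgcat : is_dgcat (cyclic_bar_alg C).
Proof.
have T := Tr_dgcat C; have I := can_inj cyc_to_trK.
have TL := cyc_to_tr_lin; have HT := cyc_to_tr_cplx.
split=> /=.
- by move=> _ _; exact: cyc_complex.
- by move=> _ _ _ a f f' g; apply: I; rewrite !(TL, cyc_to_tr_mul) trcomp_lin1.
- by move=> _ _ _ a f g g'; apply: I; rewrite !(TL, cyc_to_tr_mul) trcomp_lin2.
- move=> _ _ _ p q f g hf hg; rewrite cyclic_bar_mulE.
  apply: (cm_hdeg tr_to_cyc_cplx).
  by apply: trcomp_hdeg; exact: (cm_hdeg HT).
- move=> _ _ _ p f g hf; apply: I.
  rewrite [LHS](cm_diff HT) (linD TL) (linZ TL) !cyc_to_tr_mul.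
  by rewrite (trcomp_diff _ (cm_hdeg HT hf)) -!(cm_diff HT).
- by move=> _ _ _ _ f g h; apply: I; rewrite !cyc_to_tr_mul trcompA.
- by move=> _ _ f; apply: I; rewrite cyc_to_tr_mul cyc_to_tr_one trcomp1l.
- by move=> _ _ f; apply: I; rewrite cyc_to_tr_mul cyc_to_tr_one trcomp1r.
- move=> _; rewrite -[cyclic_bar_one C]cyc_to_trK cyc_to_tr_one.
  by apply: (cm_hdeg tr_to_cyc_cplx); apply: trmor_hdeg; exact: id_hdeg.
move=> _; apply: I; rewrite [LHS](cm_diff HT) cyc_to_tr_one -trmor_diff.
by rewrite (dg_id_diff P) (lin0 (@trmor_lin _ _ _ _)) (lin0 TL).
Qed.

Definition HH_to_end : HH C -> coh (@dghom k (Tr C) one one) := coh_map cyc_to_tr.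

Lemma HH_to_end_iso :
  @is_coh_end_iso k (cyclic_bar_alg C) (Tr C) tt one HH_to_end.
Proof.
have HA := cyc_complex HD; have HB := trhom_complex (C := C) one one.
have HT := cyc_to_tr_cplx; have HT' := tr_to_cyc_cplx.
pose inv : coh (trhom one one) -> HH C := coh_map tr_to_cyc.
have HK : cancel HH_to_end inv.
  move=> x; have [z ez ->] := coh_cls_surj HA x.
  rewrite /HH_to_end /inv (coh_map_cls HB HT) //.
  by rewrite (coh_map_cls HA HT') ?cyc_to_trK //; exact: (cplx_map_cocycle HT).
have KH : cancel inv HH_to_end.
  move=> x; have [z ez ->] := coh_cls_surj HB x.
  rewrite /HH_to_end /inv (coh_map_cls HA HT') //.
  by rewrite (coh_map_cls HB HT) ?tr_to_cycK //; exact: (cplx_map_cocycle HT').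
split.
- exact: (coh_map_lin HB HT).
- by exists inv.
- move=> n x; split; first exact: (coh_map_deg HB HT).
  by move/(coh_map_deg HA HT'); rewrite -/inv HK.
- rewrite /= /HH_to_end (coh_map_cls HB HT) ?cyc_to_tr_one //.
  exact: (dg_id_diff cyclic_bar_dgcat tt).
move=> x y; have [z ez ->] := coh_cls_surj HA x; have [w ew ->] := coh_cls_surj HA y.
rewrite (coh_mul_cls cyclic_bar_dgcat (X := tt) ez ew).
rewrite /HH_to_end !(coh_map_cls HB HT) //; last first.
  rewrite (comp_diff_cocycle cyclic_bar_dgcat (X := tt) (Y := tt) (Z := tt) _ ew).
  rewrite ez; have L : linear_map (fun f => cyclic_bar_mul f w).
    by have [H _ _] := cyclic_bar_mulP; move=> a f f'; exact: H.
  exact: (lin0 L).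
rewrite (coh_mul_cls (Tr_dgcat C) (X := one)) /= ?cyc_to_tr_mul //.
- exact: (cplx_map_cocycle HT).
- exact: (cplx_map_cocycle HT).
Qed.

End CyclicBar.

(** * Naturality *)

Section NaturalityProof.
Variables (k : comPzRingType) (C D : smdgcat k) (Phi : smfunctor C D).
Local Notation homC := (@dghom k C).
Local Notation homD := (@dghom k D).
Let HPhi := sf_dg Phi.

Lemma chain_map_cmap Y X (c : hchain (C := C) Y X) : chain_map HPhi c = cmap Phi c.
Proof. by elim: c => //= {}Y Z {}X f c ->. Qed.

Definition bar_map : cyclic_bar C -> cyclic_bar D :=
  cyc_map HPhi (M := diag_bimod C) (N := diag_bimod D) (fun Y X f => sf1 Phi f).

Let bar_act Y Y' X (f : homC Y Y') (m : homC X Y) :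
  sf1 Phi (f ∘ m) = sf1 Phi f ∘ sf1 Phi m.
Proof. exact: (df_comp HPhi). Qed.

Lemma bar_mapP : is_cyclic_bar_map Phi bar_map.
Proof.
have C1 Y X := df_cplx HPhi X Y.
split.
  apply: (cyc_map_cplx (diag_bimodP C) (diag_bimodP D)) => [//|Y' Y X f m|Y X X' m f].
    exact: bar_act.
  exact: bar_act.
move=> Y Y' c f; rewrite /bar_map cyc_map_elt ?chain_map_cmap //.
- by move=> Y1 Y2 Z a m; exact: bar_act.
- by move=> Y1 Z Z' m a; exact: bar_act.
Qed.

Section HomMap.
Variables X X' : ob C.

Definition hom_map Y Y' (f : homC (X ⋆ Y) (Y' ⋆ X')) :
    homD (Phi X ⋆ Phi Y) (Phi Y' ⋆ Phi X') :=
  castH (sf_tob Phi X Y) (sf_tob Phi Y' X') (sf1 Phi f).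

Lemma hom_map_lact Y Y' Y'' (a : homC Y' Y'') (f : homC (X ⋆ Y) (Y' ⋆ X')) :
  hom_map ((a ⋆⋆ dgid X') ∘ f) = (sf1 Phi a ⋆⋆ dgid (Phi X')) ∘ hom_map f.
Proof.
rewrite /hom_map (df_comp HPhi) (castH_comp _ (sf_tob Phi Y' X')).
by rewrite sf_thom (df_id HPhi).
Qed.

Lemma hom_map_ract Y1 Y Y' (f : homC (X ⋆ Y) (Y' ⋆ X')) (a : homC Y1 Y) :
  hom_map (f ∘ (dgid X ⋆⋆ a)) = hom_map f ∘ (dgid (Phi X) ⋆⋆ sf1 Phi a).
Proof.
rewrite /hom_map (df_comp HPhi) (castH_comp _ (sf_tob Phi X Y)).
by rewrite sf_thom (df_id HPhi).
Qed.

Lemma hom_map_cplx Y Y' : is_cplx_map (@hom_map Y Y').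
Proof.
have F := df_cplx HPhi (X ⋆ Y) (Y' ⋆ X').
split.
- by move=> a f g; rewrite /hom_map (cm_linear F) castH_lin.
- by move=> n f hf; apply: castH_hdeg; exact: (cm_hdeg F).
- by move=> f; rewrite /hom_map (cm_diff F) castH_diff.
Qed.

Definition tr_map : trhom X X' -> trhom (Phi X) (Phi X') :=
  cyc_map HPhi (M := X12 X' X) (N := X12 (Phi X') (Phi X))
    (fun Y' Y f => hom_map f).

Lemma tr_map_cplx : is_cplx_map tr_map.
Proof.
apply: (cyc_map_cplx (X12_bimodP X' X) (X12_bimodP (Phi X') (Phi X))).
- by move=> Y Z; exact: hom_map_cplx.
- by move=> Y' Y Z f m; exact: hom_map_lact.
- by move=> Y Z Z' m f; exact: hom_map_ract.
Qed.

Lemma tr_map_elt Y Y' (c : hchain Y Y') (f : homC (X ⋆ Y) (Y' ⋆ X')) :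
  tr_map (trelt c f) = trelt (cmap Phi c) (hom_map f).
Proof.
rewrite /tr_map /trelt cyc_map_elt ?chain_map_cmap //.
- by move=> Y1 Z; exact: hom_map_cplx.
- by move=> Y1 Y2 Z a m; exact: hom_map_lact.
- by move=> Y1 Z Z' m a; exact: hom_map_ract.
Qed.

End HomMap.

Lemma tr_mapP : @is_tr_map k C D Phi tr_map.
Proof.
split; first exact: tr_map_cplx.
by move=> X X' Y Y' c f; exact: tr_map_elt.
Qed.

Lemma tot_sf1_castH X X' Y Y' (e : X = X') (e' : Y = Y') (f : homC X Y) :
  totH (sf1 Phi (castH e e' f)) = totH (sf1 Phi f).
Proof. by subst. Qed.

Lemma trelt_tot (E : smdgcat k) (X X' Y Y' Z Z' : ob E) (c : hchain Y Y')
    (d : hchain Z Z') (f : dghom (X ⋆ Y) (Y' ⋆ X')) (g : dghom (X ⋆ Z) (Z' ⋆ X')) :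
  totC c = totC d -> totH f = totH g -> trelt c f = trelt d g.
Proof.
move=> ec ef; have [e1 e2] := tot_ends ec; subst.
by rewrite (tot_inj ec) (tot_inj ef).
Qed.

Lemma tr_map_trmor X X' (f : homC X X') : tr_map (trmor f) = trmor (sf1 Phi f).
Proof.
rewrite tr_map_elt; apply: trelt_tot; first exact: tot_hnil (sf_tone Phi).
by rewrite !tot_castH tot_sf1_castH.
Qed.

Lemma castH_trelt (E : smdgcat k) (X X1 X' X1' Y Y' : ob E) (e : X = X1)
    (e' : X' = X1') (c : hchain Y Y') (f : dghom (X ⋆ Y) (Y' ⋆ X')) :
  @castH k (Tr E) _ _ _ _ e e' (trelt c f)
  = trelt c (castH (f_equal (fun U => U ⋆ Y) e) (f_equal (fun U => Y' ⋆ U) e') f).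
Proof. by subst. Qed.

(** The map induced by Phi on End(Tr(1)), where Phi(1) = 1 only holds as an
    equality of objects. *)
Definition end_map : trhom (tone C) (tone C) -> trhom (tone D) (tone D) :=
  fun z => @castH k (Tr D) _ _ _ _ (sf_tone Phi) (sf_tone Phi) (tr_map z).

Lemma end_map_cplx : is_cplx_map end_map.
Proof.
have V := tr_map_cplx (tone C) (tone C).
pose TD := DgCat (Tr_dgcat D).
split.
- move=> a x y; rewrite /end_map (cm_linear V).
  exact: (@castH_lin k TD _ _ _ _ (sf_tone Phi) (sf_tone Phi)).
- move=> n x hx; apply: (@castH_hdeg k TD); exact: (cm_hdeg V).
- move=> x; rewrite /end_map (cm_diff V); symmetry.
  exact: (@castH_diff k TD).
Qed.

Lemma bar_map_to_tr z : cyc_to_tr (bar_map z) = end_map (cyc_to_tr z).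
Proof.
have [B BE] := bar_mapP; have E := end_map_cplx.
move: z; apply: (cyc_ext (diag_bimodP C)) => [a x y|a x y|Y Z c m p _].
- by rewrite (cm_linear B) cyc_to_tr_lin.
- by rewrite cyc_to_tr_lin (cm_linear E).
have L1 := linZ (cm_linear B); have L2 := linZ (cm_linear E).
rewrite /scyc_elt L1 !(linZ (@cyc_to_tr_lin _ _)) L2; congr (_ *: _).
rewrite BE !cyc_to_tr_elt /end_map tr_map_elt castH_trelt.
apply: trelt_tot => //.
by rewrite !tot_castH tot_sf1_castH.
Qed.

End NaturalityProof.

Lemma HH_to_end_natural (k : comPzRingType) : is_natural (@HH_to_end k).
Proof.
move=> C D Phi; exists (bar_map Phi), (@tr_map k C D Phi); split.
- exact: bar_mapP.
- exact: tr_mapP.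
- by move=> X X' f; exact: tr_map_trmor.
move=> z z' ez ez'.
have HA E := cyc_complex (@diag_bimodP k E).
have HB (E : smdgcat k) := trhom_complex (C := E) (tone E) (tone E).
rewrite /HH_to_end (coh_map_cls (HB C) (@cyc_to_tr_cplx k C)) // => e.
have [B _] := bar_mapP Phi.
rewrite (coh_map_cls (HB D) (@cyc_to_tr_cplx k D)); last first.
  exact: (cplx_map_cocycle B).
have E := end_map_cplx Phi.
rewrite bar_map_to_tr -(coh_map_cls (HB D) E); last first.
  exact: (cplx_map_cocycle (@cyc_to_tr_cplx k C)).
by rewrite e (coh_map_cls (HB D) E).
Qed.

Theorem theorem1p2 (k : comPzRingType) :
  (forall C : smdgcat k,
     [/\ is_trcomp (@trcomp k C),
         is_dgcat (Tr C),
         @is_dgfunctor k C (Tr C) id (@trmor k C)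
       & homotopy_trace_like (@trswap k C)])
  /\ exists theta : forall C : smdgcat k,
       HH C -> coh (@dghom k (Tr C) (tone C) (tone C)),
     (forall C : smdgcat k,
        [/\ is_cyclic_bar_mul (@cyclic_bar_mul k C),
            is_dgcat (cyclic_bar_alg C)
          & @is_coh_end_iso k (cyclic_bar_alg C) (Tr C) tt (tone C) (theta C)])
     /\ is_natural theta.
Proof.
split.
  move=> C; split.
  - exact: trcompP.
  - exact: Tr_dgcat.
  - exact: trmor_dgfunctor.
  - exact: trswap_trace_like.
exists (@HH_to_end k); split; last exact: HH_to_end_natural.
move=> C; split.
- exact: cyclic_bar_mulP.
- exact: cyclic_bar_dgcat.
- exact: HH_to_end_iso.
Qed.
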